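(* Let $\widehat\alpha=\frac1q$. Then: 1. The identity $\displaystyle\int_{\mathcal O}\mathcal X_{\varphi,\widehat\alpha}(x)\varphi(x)\,dx=0$ holds almost surely. 2. The process $\mathcal X_{\varphi,\widehat\alpha}(x)$, $x\in\overline{\mathcal O}$, and the random variable $\int_{\mathcal O}X(u)\varphi(u)\,du$ are independent. 3. If $\varphi\in L_2(\mathcal O)$, then the integral operator with the kernel function $\mathcal G_{\varphi,\widehat\alpha}(x,y)=\mathbb E\,\mathcal X_{\varphi,\widehat\alpha}(x)\mathcal X_{\varphi,\widehat\alpha}(y)$ has a zero eigenvalue with the eigenfunction $\varphi$.
   Context: Let $\mathcal O\subset\mathbb R^n$ be a bounded domain and let $X(x)$, $x\in\overline{\mathcal O}$, be a zero mean-value Gaussian random function with covariance $G_X(x,y)=\mathbb E X(x)X(y)$, $x,y\in\overline{\mathcal O}$. Let $\varphi$ be a locally summable function in $\mathcal O$. It is assumed that the function $$\psi(x)=\int_{\mathcal O}G_X(x,y)\varphi(y)\,dy$$ is well defined a.e. in $\mathcal O$, that $\psi\not\equiv0$, and that $$q=\int_{\mathcal O}\psi(u)\varphi(u)\,du=\int_{\mathcal O}\int_{\mathcal O}G_X(u,v)\varphi(u)\varphi(v)\,du\,dv<\infty .$$ For $\alpha\in\mathbb R$ define $$\mathcal X_{\varphi,\alpha}(x)=X(x)-\alpha\,\psi(x)\int_{\mathcal O}X(u)\varphi(u)\,du,\qquad x\in\overline{\mathcal O}.$$ *)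

(* Defs.v *)
From HB Require Import structures.
From mathcomp Require Import all_boot all_order all_algebra.
From mathcomp Require Import all_classical all_reals all_analysis.

Set Implicit Arguments.
Unset Strict Implicit.
Unset Printing Implicit Defensive.

Import Order.TTheory GRing.Theory Num.Theory.
Import numFieldNormedType.Exports.

Local Open Scope classical_set_scope.
Local Open Scope ring_scope.

Section measurable_rV.
Context (R : realType) (n : nat).

Let coors : 'I_n -> 'rV[R]_n -> R := fun i v => v ord0 i.

Let rV_set0 : g_sigma_preimage coors set0.
Proof. exact: sigma_algebra0. Qed.

Let rV_setC A : g_sigma_preimage coors A -> g_sigma_preimage coors (~` A).
Proof. exact: sigma_algebraC. Qed.

Let rV_bigcup (F : _^nat) : (forall i, g_sigma_preimage coors (F i)) ->
  g_sigma_preimage coors (\bigcup_i (F i)).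
Proof. exact: sigma_algebra_bigcup. Qed.

(* As for tuples in the library, the sigma-algebra of R^n is the one generated
   by the coordinates; it is the Borel one, see open_measurable_rV. *)
HB.instance Definition _ := @isMeasurable.Build default_measure_display
  'rV[R]_n (g_sigma_preimage coors) rV_set0 rV_setC rV_bigcup.

Lemma measurable_coord (i : 'I_n) :
  measurable_fun [set: 'rV[R]_n] (fun v : 'rV[R]_n => v ord0 i).
Proof.
move=> _ Y mY; rewrite setTI; apply: sub_sigma_algebra => /=.
rewrite -bigcup_seq/=; exists i => /=; first by rewrite mem_index_enum.
by exists Y => //; rewrite setTI.
Qed.

Lemma measurable_fun_rVP d (T : measurableType d) (f : T -> 'rV[R]_n) :
  (forall i, measurable_fun [set: T] (fun x => f x ord0 i)) ->
  measurable_fun [set: T] f.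
Proof.
move=> mf _ A mA; rewrite setTI.
suff : preimage_set_system [set: T] f (g_sigma_preimage coors) `<=` measurable.
  by apply; exists A => //; rewrite setTI.
rewrite -g_sigma_preimageE.
apply: smallest_sub; first exact: sigma_algebra_measurable.
move=> _ [B + <-]; rewrite -bigcup_seq/= => -[i _ [C mC <-]].
by rewrite !setTI -[X in measurable X]setTI; exact: mf.
Qed.

Lemma open_measurable_rV (A : set 'rV[R]_n) : open A -> measurable A.
Proof.
move=> oA.
pose box (c : 'rV[rat]_n * nat) : set 'rV[R]_n :=
  [set v | forall i, `|ratr (c.1 ord0 i) - v ord0 i| < c.2.+1%:R^-1].
have mbox c : measurable (box c).
  rewrite (_ : box c = \big[setI/setT]_(i < n)
      [set v : 'rV[R]_n | `|ratr (c.1 ord0 i) - v ord0 i| < c.2.+1%:R^-1]).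
    apply: bigsetI_measurable => i _.
    have /= := @measurable_coord i measurableT
      (ball (ratr (c.1 ord0 i) : R) c.2.+1%:R^-1).
    by rewrite setTI; apply; apply: measurable_realfun.open_measurable; exact: ball_open.
  rewrite -bigcap_seq; apply/seteqP; split => v /= h.
    by move=> i _; exact: h.
  by move=> i; apply: h => /=; rewrite mem_index_enum.
rewrite (_ : A = \bigcup_(c in [set c | box c `<=` A]) box c).
  rewrite bigcup_mkcond; apply: countable_bigcupT_measurable => // c.
  by case: ifPn.
apply/seteqP; split => [v Av|v [c]]; last exact.
have /nbhs_ballP[e /= e0 eA] := open_nbhs_nbhs (conj oA Av).
have [m me] : exists m : nat, m.+1%:R^-1 < e / 2.
  exists (Num.truncn (e / 2)^-1).
  by rewrite invf_plt ?posrE ?divr_gt0// truncnS_gt.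
have rat_near i : exists q : rat, `|ratr q - v ord0 i| < m.+1%:R^-1.
  have [|q] := @rat_in_itvoo R (v ord0 i - m.+1%:R^-1) (v ord0 i + m.+1%:R^-1).
    by rewrite ltrBlDr -addrA ltrDl addr_gt0 ?invr_gt0.
  by rewrite in_itv/= => qv; exists q; rewrite ltr_distlC -ltr_distl ltr_distlC.
have [q qv] := choice rat_near.
exists (\row_i q i, m) => [w /= wv|i] /=; last by rewrite mxE.
apply: eA; split=> // i j; rewrite !ord1 /ball/=.
rewrite (le_lt_trans (ler_distD (ratr (q j)) _ _))// (splitr e) ltrD//.
  by rewrite distrC (lt_trans (qv j)).
by have := wv j; rewrite mxE => /lt_trans; exact.
Qed.

End measurable_rV.

Section lebesgue_rV.
Context (R : realType).
Local Open Scope ereal_scope.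

Section cons.
Context (n : nat).

Definition rV_cons (p : measurableTypeR R * 'rV[R]_n) : 'rV[R]_n.+1 :=
  \row_i oapp (p.2 ord0) p.1 (unlift ord0 i).

Definition rV_uncons (v : 'rV[R]_n.+1) : measurableTypeR R * 'rV[R]_n :=
  (v ord0 ord0, \row_i v ord0 (lift ord0 i)).

Lemma rV_consK : cancel rV_cons rV_uncons.
Proof.
case=> x v; rewrite /rV_uncons mxE unlift_none /=; congr pair.
by apply/rowP => i; rewrite !mxE liftK.
Qed.

Lemma measurable_rV_cons : measurable_fun [set: _] rV_cons.
Proof.
apply: measurable_fun_rVP => i.
case: (unliftP ord0 i) => [j ->|->].
  under eq_fun do rewrite mxE liftK /=.
  exact: (measurableT_comp (measurable_coord j) measurable_snd).
under eq_fun do rewrite mxE unlift_none /=.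
exact: measurable_fst.
Qed.

Lemma measurable_rV_uncons : measurable_fun [set: _] rV_uncons.
Proof.
apply/measurable_fun_pair => /=; first exact: measurable_coord.
apply: measurable_fun_rVP => i.
under eq_fun do rewrite mxE.
exact: measurable_coord.
Qed.

Context (mu : {sigma_finite_measure set 'rV[R]_n -> \bar R}).

Definition lebesgue_cons : set 'rV[R]_n.+1 -> \bar R :=
  pushforward (@lebesgue_measure R \x mu) rV_cons.

Let lebesgue_cons0 : lebesgue_cons set0 = 0.
Proof. by rewrite /lebesgue_cons /pushforward preimage_set0 measure0. Qed.

Let lebesgue_cons_ge0 A : 0 <= lebesgue_cons A.
Proof. by rewrite /lebesgue_cons /pushforward measure_ge0. Qed.

Let lebesgue_cons_sigma_additive : semi_sigma_additive lebesgue_cons.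
Proof.
move=> F mF tF mUF; rewrite /lebesgue_cons /pushforward preimage_bigcup.
have mp A : measurable A -> measurable (rV_cons @^-1` A).
  by rewrite -[X in _ -> measurable X]setTI; exact: measurable_rV_cons.
apply: measure_semi_sigma_additive => [k||]; first exact: mp (mF k).
  by apply/trivIsetP => i j _ _ ij; rewrite -preimage_setI;
    move/trivIsetP : tF => ->//; rewrite preimage_set0.
by rewrite -preimage_bigcup; exact: mp.
Qed.

HB.instance Definition _ := isMeasure.Build _ _ _ lebesgue_cons
  lebesgue_cons0 lebesgue_cons_ge0 lebesgue_cons_sigma_additive.

Let lebesgue_cons_sigma_finite : sigma_finite setT lebesgue_cons.
Proof.
have /sigma_finiteP[F [TF ndF Foo]] := sigma_finiteT (@lebesgue_measure R).
have /sigma_finiteP[G [TG ndG Goo]] := sigma_finiteT mu.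
exists (fun k => rV_uncons @^-1` (F k `*` G k)) => [|k].
  rewrite -preimage_bigcup -[LHS](preimage_setT rV_uncons); congr preimage.
  apply/esym; rewrite -subTset => -[x v] _.
  have [i _ Fx] : (\bigcup_k F k) x by rewrite -TF.
  have [j _ Gv] : (\bigcup_k G k) v by rewrite -TG.
  exists (maxn i j) => //; split => /=.
    by move: x Fx; exact/subsetPset/ndF/leq_maxl.
  by move: v Gv; exact/subsetPset/ndG/leq_maxr.
have [? ?] := Foo k; have [? ?] := Goo k; split.
  rewrite -[X in measurable X]setTI; apply: measurable_rV_uncons => //.
  exact: measurableX.
rewrite /lebesgue_cons /pushforward -comp_preimage.
rewrite (_ : _ \o _ = idfun); last by apply/funext => x /=; exact: rV_consK.
by rewrite preimage_id product_measure1E// lte_mul_pinfty// ge0_fin_numE.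
Qed.

HB.instance Definition _ := Measure_isSigmaFinite.Build _ _ _ lebesgue_cons
  lebesgue_cons_sigma_finite.

End cons.

Fixpoint lebesgue_rV n : {sigma_finite_measure set 'rV[R]_n -> \bar R} :=
  match n with
  | 0%N => [the {sigma_finite_measure set 'rV[R]_0 -> \bar R} of
             \d_(0%R : 'rV[R]_0)]
  | m.+1 => [the {sigma_finite_measure set 'rV[R]_m.+1 -> \bar R} of
              lebesgue_cons (lebesgue_rV m)]
  end.

Lemma lebesgue_rV_box n (I : 'I_n -> set R) : (forall i, measurable (I i)) ->
  lebesgue_rV n [set v | forall i, I i (v ord0 i)] =
  \prod_(i < n) @lebesgue_measure R (I i).
Proof.
elim: n I => [|n ih] I mI /=.
  by rewrite big_ord0 diracE mem_set// => -[].
rewrite big_ord_recl -ih//.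
have mbox : measurable [set v : 'rV[R]_n | forall i, I (lift ord0 i) (v ord0 i)].
  rewrite (_ : [set v | _] = \bigcap_(i in [set: 'I_n])
      ((fun v : 'rV[R]_n => v ord0 i) @^-1` I (lift ord0 i))).
    apply: fin_bigcap_measurable => // i _.
    by rewrite -[X in measurable X]setTI; exact: measurable_coord.
  by apply/seteqP; split => v /= h i; [move=> _; exact: h|exact: h].
rewrite -product_measure1E//; last exact: mI.
rewrite /lebesgue_cons /pushforward; congr (_ _).
apply/seteqP; split => [[x v] /= h|[x v] /= [Ix Iv] i]; last first.
  by rewrite mxE; case: unliftP => [j ->|->].
split => [|i]; first by have := h ord0; rewrite mxE unlift_none.
by have := h (lift ord0 i); rewrite mxE liftK.
Qed.

End lebesgue_rV.

Section random_fields.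
Local Open Scope ereal_scope.
Context (R : realType) (n : nat).
Context (d : measure_display) (Omega : measurableType d).
Context (P : probability Omega R).
Local Notation Rn := 'rV[R]_n.
Local Notation mu := (lebesgue_rV R n).

Definition bounded_domain (O : set Rn) :=
  [/\ open O, connected O, O !=set0 & bounded_set O].

Definition locally_summable (O : set Rn) (f : Rn -> R) :=
  measurable_fun O f /\
  forall K : set Rn, compact K -> K `<=` O -> mu.-integrable K (EFin \o f).

Definition square_summable (O : set Rn) (f : Rn -> R) :=
  f \_ O \in Lfun mu 2%:E.

(* The case distinction is needed because normal_prob m 0 is not the Dirac mass
   at m but, by convention, a uniform distribution. *)
Definition normal_law (m s : R) : set R -> \bar R :=
  if s == 0%R then \d_m else normal_prob m s.

Definition gaussian_rv (Y : Omega -> R) :=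
  measurable_fun [set: Omega] Y /\
  exists m s : R, forall A : set R, measurable A ->
    P (Y @^-1` A) = normal_law m s A.

Definition gaussian_field (D : set Rn) (X : Rn -> Omega -> R) :=
  forall (k : nat) (x : 'I_k -> Rn) (c : 'I_k -> R), (forall i, D (x i)) ->
    gaussian_rv (fun w => \sum_(i < k) c i * X (x i) w)%R.

Definition covariance_fun (X : Rn -> Omega -> R) (x y : Rn) : R :=
  fine 'E_P[fun w => X x w * X y w]%R.

Definition integral_operator (O : set Rn) (K : Rn -> Rn -> R) (f : Rn -> R)
  (x : Rn) : R := (\int[mu]_(y in O) (K x y * f y))%R.

(* The points at which the integral defining integral_operator O K f converges
   absolutely; elsewhere integral_operator has a junk value. *)
Definition integral_operator_dom (O : set Rn) (K : Rn -> Rn -> R)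
  (f : Rn -> R) : set Rn :=
  [set x | mu.-integrable O (fun y => (K x y * f y)%:E)].

(* f is an eigenfunction, in L_2(O), of the integral operator with kernel K,
   for the eigenvalue l. *)
Definition eigenfunction (O : set Rn) (K : Rn -> Rn -> R) (l : R)
    (f : Rn -> R) :=
  [/\ square_summable O f,
      ~ {ae mu, forall x, O x -> f x = 0%R} &
      {ae mu, forall x, O x -> integral_operator_dom O K f x /\
        integral_operator O K f x = (l * f x)%R}].

Definition exhaustion (O : set Rn) (A : (set Rn)^nat) :=
  [/\ (forall k, measurable (A k)), (forall k, A k `<=` A k.+1),
      (forall k, A k `<=` O) & mu (O `\` \bigcup_k A k) = 0].

Definition cvg_in_probability (Y : (Omega -> R)^nat) (S : Omega -> R) :=
  forall e : R, (0 < e)%R ->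
    P [set w | (e <= `|Y k w - S w|)%R] @[k --> \oo] --> 0.

(* S is a version of the random variable w |-> \int_O Z x w dx.  A condition on
   the second moments of Z, such as
     \int_O \int_O |'E[Z u * Z v]| du dv < +oo,
   guarantees that the integral converges in L_2, but not that almost all paths
   of Z are absolutely integrable over O.  The integral is therefore the limit
   in probability of pathwise Lebesgue integrals along an exhaustion of O.  When
   the paths are integrable over O, it is the pathwise Lebesgue integral (see
   stochastic_integral_pathwise). *)
Definition stochastic_integral (O : set Rn) (Z : Rn -> Omega -> R)
    (S : Omega -> R) :=
  exists A : (set Rn)^nat, [/\ exhaustion O A,
    (forall k, {ae P, forall w, mu.-integrable (A k) (EFin \o Z ^~ w)}) &
    cvg_in_probability (fun k w => \int[mu]_(x in A k) Z x w)%R S].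

Lemma stochastic_integral_pathwise (O : set Rn) (Z : Rn -> Omega -> R) :
  open O -> {ae P, forall w, mu.-integrable O (EFin \o Z ^~ w)} ->
  stochastic_integral O Z (fun w => \int[mu]_(x in O) Z x w)%R.
Proof.
move=> oO iZ; exists (fun=> O); split => //.
  split => [k|k|k|] //; first exact: open_measurable_rV.
  rewrite (_ : _ `\` _ = set0) ?measure0//.
  by apply/seteqP; split => // x [Ox] []; exists 0%N.
move=> e e0; rewrite (_ : (fun _ => _) = fun=> 0); first exact: cvg_cst.
apply/funext => k; rewrite (_ : [set w | _] = set0) ?measure0//.
by apply/seteqP; split => // w /=; rewrite subrr normr0 leNgt e0.
Qed.

Definition independent_of_process (D : set Rn) (Y : Rn -> Omega -> R)
    (S : Omega -> R) :=
  forall (A : set Omega) (B : set R),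
    <<s \bigcup_(x in D) preimage_set_system [set: Omega] (Y x) measurable >> A ->
    measurable B -> P (A `&` S @^-1` B) = P A * P (S @^-1` B).

(* In the intended use, psi is the image of a weight f under the covariance
   operator of X and S is a version of the integral of X * f. *)
Definition perturbed_field (X : Rn -> Omega -> R) (psi : Rn -> R)
  (S : Omega -> R) (alpha : R) (x : Rn) (w : Omega) : R :=
  (X x w - alpha * psi x * S w)%R.

End random_fields.

(* Main.v *)
Require Import Defs.
From HB Require Import structures.
From mathcomp Require Import all_boot all_order all_algebra.
From mathcomp Require Import all_classical all_reals all_analysis.
From mathcomp Require Import measurable_realfun.
From mathcomp Require Import ring lra.

Set Implicit Arguments.
Unset Strict Implicit.
Unset Printing Implicit Defensive.

Import Order.TTheory GRing.Theory Num.Theory.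
Import numFieldNormedType.Exports.

Local Open Scope classical_set_scope.
Local Open Scope ring_scope.

(** Write [S] for the integral of [X * phi].  Formally, exchanging expectations
and integrals gives [E[S * X x] = psi x] and [E[S ^+ 2] = q].  Hence [q] is not
zero, by the Cauchy-Schwarz inequality, since [psi] is not; the integral of
[Xhat * phi] is [S - q^-1 * q * S = 0]; and [Xhat x] is orthogonal to [S], which
for jointly Gaussian variables means independence.  Finally, as [Xhat x] is
orthogonal to [S], the image of [phi] at [x] under the covariance operator of
[Xhat] is [psi x - q^-1 * psi x * q = 0].

The work is in justifying these exchanges and the passage from orthogonality to
independence of a whole process, when [S] is only a limit in probability of path
integrals and nothing is assumed about the integrability of second moments.
Throughout, [gauss_space] stands for a linear space of centred jointly Gaussian
variables, expressed by the formula for their moment generating functions.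

Exchanges.  A centred Gaussian variable is comparable to its standard deviation
with a probability bounded below ([gauss_anticoncentration]).  This has two
consequences.  If almost all paths of a Gaussian field are integrable, then so is
its standard deviation ([gauss_sdev_integrable]), so that Fubini's theorem
applies to the path integral, which lies in the mean square closure of the space
spanned by the field ([path_integral_closure]).  And in a Gaussian space,
convergence in probability implies convergence in mean square
([gauss_cvgp_L2]), so that covariances pass to the limit along the exhaustion
that defines [S] ([ip_stochastic_integral]).  As the closure is again a Gaussian
space ([L2_closure_gauss]), [S] and the [Xhat x] are jointly Gaussian.

Independence.  A square-integrable weight [W] that is orthogonal to
all the exponentials [expR (t * Y)] of a Gaussian variable [Y] is orthogonal to
all the events [Y \in B] ([mgf0_preimage]): differentiating in [t] kills the
moments of [W], summing series then kills its integrals against bell curves of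
[Y], and these approximate Lipschitz functions of [Y].  Applied first to [S] and
then repeatedly to the variables of the process, this gives independence
([gauss_orthogonal_independent]).

Uniqueness of the integral of [Xhat * phi], along any exhaustion, follows since
two versions of [S] have the same second moments and mixed moment
([stochastic_integral_unique]). *)

(** * Integrable and square-integrable functions *)

Section square_integrable.
Context d (T : measurableType d) (R : realType).
Context (m : {measure set T -> \bar R}).

Definition L1 (f : T -> R) := m.-integrable [set: T] (EFin \o f).

Definition L2 (f : T -> R) :=
  measurable_fun [set: T] f /\ L1 (fun x => f x ^+ 2).

Implicit Types f g : T -> R.

Lemma L1_measurable f : L1 f -> measurable_fun [set: T] f.
Proof. by move=> /measurable_int /measurable_EFinP. Qed.

Lemma L1D f g : L1 f -> L1 g -> L1 (fun x => f x + g x).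
Proof. by move=> L1f L1g; exact: (integrableD measurableT L1f L1g). Qed.

Lemma L1B f g : L1 f -> L1 g -> L1 (fun x => f x - g x).
Proof. by move=> L1f L1g; exact: (integrableB measurableT L1f L1g). Qed.

Lemma L1Z a f : L1 f -> L1 (fun x => a * f x).
Proof. by move=> L1f; exact: (integrableZl measurableT a L1f). Qed.

Lemma L1_le f g : measurable_fun [set: T] f -> L1 g ->
  (forall x, `|f x| <= g x) -> L1 f.
Proof.
move=> mf L1g fg; apply: le_integrable L1g => //.
  exact/measurable_EFinP.
by move=> x _ /=; rewrite lee_fin (le_trans (fg x))// ler_norm.
Qed.

Lemma L1_abs f : L1 f -> L1 (fun x => `|f x|).
Proof. by move=> L1f; exact: (integrable_abse L1f). Qed.

Lemma ED f g : L1 f -> L1 g ->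
  \int[m]_x (f x + g x) = \int[m]_x f x + \int[m]_x g x.
Proof. by move=> *; rewrite RintegralD. Qed.

Lemma EB f g : L1 f -> L1 g ->
  \int[m]_x (f x - g x) = \int[m]_x f x - \int[m]_x g x.
Proof. by move=> *; rewrite RintegralB. Qed.

Lemma EZ a f : L1 f -> \int[m]_x (a * f x) = a * \int[m]_x f x.
Proof. by move=> *; rewrite RintegralZl. Qed.

Lemma E_ge0 f : (forall x, 0 <= f x) -> 0 <= \int[m]_x f x.
Proof. by move=> f0; apply: Rintegral_ge0. Qed.

Lemma E_le f g : L1 f -> L1 g -> (forall x, f x <= g x) ->
  \int[m]_x f x <= \int[m]_x g x.
Proof. by move=> L1f L1g fg; apply: le_Rintegral. Qed.

Lemma E_abs f : L1 f -> `|\int[m]_x f x| <= \int[m]_x `|f x|.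
Proof. by move=> L1f; apply: le_normr_Rintegral. Qed.

Lemma EFinE f : L1 f -> (\int[m]_x (f x)%:E = (\int[m]_x f x)%:E)%E.
Proof. by move=> L1f; rewrite /Rintegral fineK//; exact: integrable_fin_num. Qed.

Lemma L2_measurable f : L2 f -> measurable_fun [set: T] f.
Proof. by case. Qed.

Lemma L1M f g : L2 f -> L2 g -> L1 (fun x => f x * g x).
Proof.
move=> [mf f2] [mg g2]; apply: L1_le (L1D f2 g2) _; first exact: measurable_funM.
move=> x; rewrite ler_norml; apply/andP; split; nra.
Qed.

Lemma L2_lin a f g : L2 f -> L2 g -> L2 (fun x => a * f x + g x).
Proof.
move=> L2f L2g; have [mf f2] := L2f; have [mg g2] := L2g; split.
  by apply: measurable_funD => //; exact: measurable_funM.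
rewrite (_ : (fun _ => _) = (fun x => a ^+ 2 * f x ^+ 2 +
  (2 * a * (f x * g x) + g x ^+ 2))); last by apply/funext => x; ring.
by apply: L1D; [exact: L1Z|apply: L1D => //; apply: L1Z; exact: L1M].
Qed.

Lemma E_lin_sqr a f g : L2 f -> L2 g ->
  \int[m]_x (a * f x + g x) ^+ 2 = a ^+ 2 * \int[m]_x f x ^+ 2 +
    2 * a * \int[m]_x (f x * g x) + \int[m]_x g x ^+ 2.
Proof.
move=> L2f L2g; have [mf f2] := L2f; have [mg g2] := L2g.
have fg := L1M L2f L2g.
rewrite (_ : (fun _ => _) = (fun x => a ^+ 2 * f x ^+ 2 +
  (2 * a * (f x * g x) + g x ^+ 2))); last by apply/funext => x; ring.
rewrite ED; [|exact: L1Z|by apply: L1D => //; apply: L1Z].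
by rewrite ED//; [rewrite !EZ// addrA|exact: L1Z].
Qed.

Lemma L2Z a f : L2 f -> L2 (fun x => a * f x).
Proof.
move=> [mf f2]; split; first exact: measurable_funM.
rewrite (_ : (fun _ => _) = (fun x => a ^+ 2 * f x ^+ 2)); first exact: L1Z.
by apply/funext => x; ring.
Qed.

Lemma L2D f g : L2 f -> L2 g -> L2 (fun x => f x + g x).
Proof.
move=> L2f L2g; rewrite (_ : (fun _ => _) = (fun x => 1 * f x + g x)).
  exact: L2_lin.
by apply/funext => x; rewrite mul1r.
Qed.

Lemma L2B f g : L2 f -> L2 g -> L2 (fun x => f x - g x).
Proof.
move=> L2f L2g; rewrite (_ : (fun _ => _) = (fun x => -1 * g x + f x)).
  exact: L2_lin.
by apply/funext => x; ring.
Qed.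

(** Cauchy-Schwarz, in the form in which it follows from the sign of a
quadratic polynomial bounded below by [- c]. *)
Lemma quadratic_discr (a b c : R) : 0 <= a -> 0 <= c ->
  (forall t, 2 * t * b <= c + t ^+ 2 * a) -> b ^+ 2 <= a * c.
Proof.
move=> a0 c0 h; have [a_eq0|a_neq0] := eqVneq a 0.
  suff -> : b = 0 by rewrite expr0n mulr_ge0.
  apply/eqP/negPn/negP => b0; have := h ((c + 1) / b).
  by rewrite a_eq0 (_ : 2 * _ * b = 2 * (c + 1)); [lra|field].
have a_gt0 : 0 < a by rewrite lt_def a_neq0.
have := h (b / a).
have -> : (b / a) ^+ 2 * a = b ^+ 2 / a by field.
have -> : 2 * (b / a) * b = 2 * (b ^+ 2 / a) by field.
move=> {}h; have : b ^+ 2 / a <= c by lra.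
by rewrite ler_pdivrMr// mulrC.
Qed.

Lemma cauchy_schwarz f g : L2 f -> L2 g ->
  (\int[m]_x (f x * g x)) ^+ 2 <= \int[m]_x f x ^+ 2 * \int[m]_x g x ^+ 2.
Proof.
move=> L2f L2g; apply: quadratic_discr.
- by apply: E_ge0 => x; exact: sqr_ge0.
- by apply: E_ge0 => x; exact: sqr_ge0.
move=> t; have := @E_ge0 (fun x => (- t * f x + g x) ^+ 2).
rewrite E_lin_sqr// => /(_ (fun x => sqr_ge0 _)); lra.
Qed.

Lemma cauchy_schwarz_sqrt f g : L2 f -> L2 g -> `|\int[m]_x (f x * g x)| <=
  Num.sqrt (\int[m]_x f x ^+ 2) * Num.sqrt (\int[m]_x g x ^+ 2).
Proof.
move=> L2f L2g; rewrite -sqrtr_sqr -sqrtrM; last first.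
  by apply: E_ge0 => x; exact: sqr_ge0.
by rewrite ler_sqrt ?cauchy_schwarz// mulr_ge0//; apply: E_ge0 => x; exact: sqr_ge0.
Qed.

Lemma L1_ae (g : T -> \bar R) f : measurable_fun [set: T] f ->
  m.-integrable [set: T] g -> {ae m, forall x, g x = (f x)%:E} -> L1 f.
Proof.
move=> mf /integrableP[mg ig] gf; apply/integrableP; split.
  exact/measurable_EFinP.
rewrite (_ : (\int[m]_x _)%E = \int[m]_x `|g x|)%E//.
apply: ae_eq_integral => //.
- by apply/measurableT_comp => //; exact/measurable_EFinP.
- exact: measurableT_comp.
- by apply: filterS gf => x + _ => ->.
Qed.

Lemma dominated_cvg_Rintegral (f_ : nat -> T -> R) f g :
  (forall n, measurable_fun [set: T] (f_ n)) -> measurable_fun [set: T] f ->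
  (forall x, f_ n x @[n --> \oo] --> f x) -> L1 g ->
  (forall n x, `|f_ n x| <= g x) ->
  \int[m]_x f_ n x @[n --> \oo] --> \int[m]_x f x.
Proof.
move=> mf_ mf cf L1g fg.
have L1f_ n : L1 (f_ n) by exact: L1_le (fg n).
have L1f : L1 f.
  apply: L1_le L1g _ => // x; rewrite -[`|f x|](cvg_lim _ (cvg_norm (cf x)))//.
  by apply: limr_le; [apply: is_cvg_norm; apply/cvg_ex; exists (f x)|exact: nearW].
have [|||||_ _] := @dominated_convergence _ T R m _ measurableT
    (fun n => EFin \o f_ n) (EFin \o f) (EFin \o g).
- by move=> n; exact/measurable_EFinP.
- exact/measurable_EFinP.
- by apply: aeW => x _; apply: cvg_EFin; [exact: nearW|exact: cf].
- exact: L1g.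
- by apply: aeW => x n _ /=; rewrite lee_fin.
rewrite /= EFinE//; under eq_fun do rewrite EFinE//.
by move=> /fine_cvgP[].
Qed.

Lemma fatou_le (f_ : nat -> T -> R) f (c : R) :
  (forall n, L1 (f_ n)) -> (forall n x, 0 <= f_ n x) ->
  (forall n, \int[m]_x f_ n x <= c) -> measurable_fun [set: T] f ->
  {ae m, forall x, f_ n x @[n --> \oo] --> f x} -> (forall x, 0 <= f x) ->
  L1 f /\ \int[m]_x f x <= c.
Proof.
move=> L1f_ f_0 fc mf cf f0.
suff h : (\int[m]_x (f x)%:E <= c%:E)%E.
  have L1f : L1 f.
    apply/integrableP; split; first exact/measurable_EFinP.
    rewrite (le_lt_trans _ (ltry c))//; apply: le_trans h.
    by under eq_integral do rewrite /= ger0_norm//.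
  by split => //; rewrite -lee_fin -EFinE.
apply: le_trans (_ : \int[m]_x limn_einf (fun n => (f_ n x)%:E) <= _)%E.
  apply: ae_ge0_le_integral => //.
  - by move=> x _; rewrite lee_fin.
  - exact/measurable_EFinP.
  - move=> x _; rewrite limn_einf_lim; apply: lime_ge; first exact: is_cvg_einfs.
    by apply: nearW => n; apply: le_ereal_inf_tmp => _ [k _ <-]; rewrite lee_fin.
  - apply: measurableT_comp => //; apply: measurable_fun_limn_esup => n.
    by apply: measurableT_comp => //; apply/measurable_EFinP/L1_measurable.
  apply: filterS cf => x cfx _.
  have : (f_ n x)%:E @[n --> \oo] --> (f x)%:E.
    by apply: cvg_EFin; [exact: nearW|exact: cfx].
  by move=> /cvg_limn_einf_sup [-> _].
apply: le_trans (fatou _ _ _ _) _ => //.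
- by move=> n; exact/measurable_EFinP/L1_measurable.
- by move=> n x _; rewrite lee_fin.
rewrite limn_einf_lim; apply: lime_le; first exact: is_cvg_einfs.
apply: nearW => n; apply: ge_ereal_inf; exists (\int[m]_x (f_ n x)%:E)%E.
  by exists n => //=.
by rewrite EFinE// lee_fin.
Qed.

End square_integrable.

(** * Weights orthogonal to exponentials, moments and bell curves *)

Section exponential_bounds.
Context (R : realType).
Implicit Types x y : R.

(** The factor [|y| ^ k] is absorbed in an exponential, and any exponential of
[|y|] by the square in the exponent. *)
Lemma powexp_le_gauss (k : nat) (a h : R) : 0 < h ->
  exists2 C, 0 <= C & forall y, `|y| ^+ k * expR (a * `|y|) <= C * expR (h * y ^+ 2).
Proof.
move=> h0; set b := a + k%:R.
(* [b ^+ 2 / (4 * h)] is the maximum of [b * u - h * u ^+ 2] *)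
exists (expR (b ^+ 2 / (4 * h))) => [|y].
  exact: expR_ge0.
rewrite -expRD; apply: (@le_trans _ _ (expR (b * `|y|))).
  rewrite /b mulrDl addrC expRD [_ ^+ _ * _]mulrC [leRHS]mulrC ler_wpM2l ?expR_ge0//.
  rewrite expRM_natl lerXn2r ?nnegrE ?expR_ge0//.
  by have := expR_ge1Dx `|y|; lra.
rewrite ler_expR -(real_normK (num_real y)).
rewrite -subr_ge0 (_ : _ - _ = h * (`|y| - b / (2 * h)) ^+ 2).
  by rewrite mulr_ge0 ?sqr_ge0// ltW.
by field; rewrite gt_eqF.
Qed.

Lemma series_exp_coeff_le (n : nat) x : `|series (exp_coeff x) n| <= expR `|x|.
Proof.
apply: (@le_trans _ _ (series (exp_coeff `|x|) n)).
  rewrite /series/=; apply: le_trans (ler_norm_sum _ _ _) _.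
  apply: ler_sum => i _; rewrite /exp_coeff/= normrM normrX ler_wpM2l//.
  by rewrite ger0_norm// invr_ge0.
rewrite /expR; apply: nondecreasing_cvgn_le.
  by apply: nondecreasing_series => i _ _; exact: exp_coeff_ge0.
exact: is_cvg_series_exp_coeff.
Qed.

Lemma expR_Lipschitz x y : `|expR x - expR y| <= `|x - y| * (expR x + expR y).
Proof.
wlog yx : x y / y <= x.
  move=> h; have [/h//|xy] := leP y x.
  by rewrite distrC [`|x - y|]distrC [expR x + _]addrC; apply: h; exact: ltW.
rewrite !ger0_norm ?subr_ge0 ?ler_expR//.
apply: (@le_trans _ _ ((x - y) * expR x)); last first.
  by rewrite ler_wpM2l ?subr_ge0// lerDl expR_ge0.
have := expR_ge1Dx (y - x); rewrite expRD expRN => h.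
have ex := expR_gt0 x.
have : (1 + (y - x)) * expR x <= expR y by rewrite -ler_pdivlMr.
nra.
Qed.

Lemma is_derive_expZ (c y a : R) :
  is_derive a 1 (fun t => c * expR (t * y)) (c * (y * expR (a * y))).
Proof.
have dy : is_derive a 1 (fun t : R => t * y) y.
  rewrite (_ : (fun t => _) = y \*: id); last by apply/funext => t; rewrite mulrC.
  by apply: is_derive_eq; rewrite /GRing.scale/= mulr1.
have dexp : is_derive a 1 (expR \o (fun t => t * y)) (expR (a * y) * y).
  exact: is_derive1_comp.
rewrite (_ : (fun t => _) = c \*: (expR \o (fun t => t * y)))//.
apply: is_derive_eq.
by rewrite /GRing.scale/= (mulrC y (expR _)).
Qed.

End exponential_bounds.

Section exponential_integrals.
Context d (T : measurableType d) (R : realType).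
Context (m : {measure set T -> \bar R}).
Implicit Types W V Y : T -> R.

(** Integrating the exponential series term by term. *)
Lemma integral_exp_moments W V : measurable_fun [set: T] W ->
  measurable_fun [set: T] V -> L1 m (fun x => W x * expR `|V x|) ->
  (forall j, \int[m]_x (W x * V x ^+ j) = 0) -> \int[m]_x (W x * expR (V x)) = 0.
Proof.
move=> mW mV iWV WV0.
have iWVj j : L1 m (fun x => W x * V x ^+ j).
  apply: (L1_le _ (L1Z j`!%:R (L1_abs iWV))).
    by apply: measurable_funM => //; exact: measurable_funX.
  move=> x; rewrite !normrM normrX mulrCA ler_wpM2l//.
  rewrite (ger0_norm (expR_ge0 _)).
  case: j => [|j]; first by rewrite expr0 fact0 mul1r -expR0 ler_expR.
  rewrite -ler_pdivrMl ?ltr0n ?fact_gt0// mulrC.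
  by have := expR_ge1Dxn j (normr_ge0 (V x)); lra.
have e n : \int[m]_x (W x * series (exp_coeff (V x)) n) = 0.
  elim: n => [|n ih].
    under eq_Rintegral do rewrite /series/= big_geq// mulr0.
    by rewrite Rintegral_cst// mul0r.
  have iS n' : L1 m (fun x => W x * series (exp_coeff (V x)) n').
    apply: (L1_le _ (L1_abs iWV)) => [|x].
      apply: measurable_funM => //; rewrite /series/=.
      apply: measurable_sum => i; rewrite /exp_coeff/=.
      by apply: measurable_funM => //; exact: measurable_funX.
    rewrite !normrM ler_wpM2l// (ger0_norm (expR_ge0 _)).
    exact: series_exp_coeff_le.
  rewrite (_ : (fun _ => _) = (fun x => W x * series (exp_coeff (V x)) n +
      n`!%:R^-1 * (W x * V x ^+ n))).
    by rewrite ED ?EZ//; [rewrite ih WV0; ring|exact: L1Z].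
  apply/funext => x; rewrite /series/= big_nat_recr//= /exp_coeff/=; ring.
suff : \int[m]_x (W x * series (exp_coeff (V x)) n) @[n --> \oo] -->
    \int[m]_x (W x * expR (V x)).
  by under eq_fun do rewrite e; move=> /(cvg_unique _ (cvg_cst _)) <-.
apply: dominated_cvg_Rintegral (L1_abs iWV) _.
- move=> n; apply: measurable_funM => //; rewrite /series/=.
  apply: measurable_sum => i; rewrite /exp_coeff/=.
  by apply: measurable_funM => //; exact: measurable_funX.
- by apply: measurable_funM => //; exact: measurableT_comp.
- move=> x; apply: cvgM; first exact: cvg_cst.
  exact: is_cvg_series_exp_coeff.
- move=> n x; rewrite !normrM ler_wpM2l// (ger0_norm (expR_ge0 _)).
  exact: series_exp_coeff_le.
Qed.

Context (h : R) (W Y : T -> R).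
Hypotheses (h_gt0 : 0 < h) (mW : measurable_fun [set: T] W)
  (mY : measurable_fun [set: T] Y)
  (WY : L1 m (fun x => W x * expR (h * Y x ^+ 2))).

Lemma L1_gauss_weight (C : R) (g : R -> R) : measurable_fun [set: R] g ->
  (forall y, `|g y| <= C * expR (h * y ^+ 2)) -> L1 m (fun x => W x * g (Y x)).
Proof.
move=> mg gC; apply: (L1_le _ (L1Z C (L1_abs WY))).
  by apply: measurable_funM => //; exact: measurableT_comp.
by move=> x; rewrite !normrM mulrCA ler_wpM2l// (ger0_norm (expR_ge0 _)).
Qed.

Lemma L1_powexp (k : nat) (a : R) :
  L1 m (fun x => W x * (Y x ^+ k * expR (a * Y x))).
Proof.
have [C C0 hC] := powexp_le_gauss k `|a| h_gt0.
apply: (@L1_gauss_weight C (fun y => y ^+ k * expR (a * y))) => [|y].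
  apply: measurable_funM; first exact: measurable_funX.
  by apply: measurableT_comp => //; exact: measurable_funM.
rewrite normrM normrX (ger0_norm (expR_ge0 _)); apply: le_trans (hC y).
by rewrite ler_wpM2l ?exprn_ge0// ler_expR -normrM ler_norm.
Qed.

(** Differentiation under the integral sign: for [t] near [a], all the
derivatives of the integrand are dominated thanks to the weight
[expR (h * Y ^+ 2)]. *)
Lemma is_derive_mgf (k : nat) (a : R) :
  is_derive a 1 (fun t => \int[m]_x (W x * (Y x ^+ k * expR (t * Y x))))
    (\int[m]_x (W x * (Y x ^+ k.+1 * expR (a * Y x)))).
Proof.
pose f (t : R) x := W x * (Y x ^+ k * expR (t * Y x)).
have df (t : R) x : is_derive t 1 (f ^~ x) (W x * (Y x ^+ k.+1 * expR (t * Y x))).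
  rewrite /f; under eq_fun do rewrite mulrA.
  rewrite (_ : W x * (_ ^+ _.+1 * _) = W x * Y x ^+ k * (Y x * expR (t * Y x))).
    exact: is_derive_expZ.
  by rewrite exprSr; ring.
have d1f (t : R) x : partial1of2 f t x = W x * (Y x ^+ k.+1 * expR (t * Y x)).
  by rewrite partial1of2E; exact: derive_val.
pose G (x : T) : R := `|W x| * (`|Y x| ^+ k.+1 * expR ((`|a| + 1) * `|Y x|)).
have aI : a \in `](a - 1), (a + 1)[ by rewrite in_itv/=; apply/andP; split; lra.
have iG : L1 m G.
  have [C C0 hC] := powexp_le_gauss k.+1 (`|a| + 1) h_gt0.
  pose g (y : R) : R := `|y| ^+ k.+1 * expR ((`|a| + 1) * `|y|).
  have g0 y : 0 <= g y by rewrite mulr_ge0 ?exprn_ge0 ?expR_ge0.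
  rewrite (_ : G = fun x => `|W x * g (Y x)|); last first.
    by apply/funext => x; rewrite normrM (ger0_norm (g0 _)).
  apply: L1_abs; apply: (@L1_gauss_weight C).
    apply: measurable_funM; first by apply: measurable_funX; exact: normr_measurable.
    apply: measurableT_comp => //; apply: measurable_funM => //.
  by move=> y; rewrite (ger0_norm (g0 _)); exact: hC.
have intf (t : R) : t \in `](a - 1), (a + 1)[ -> m.-integrable [set: T] (EFin \o f t).
  by move=> _; exact: L1_powexp.
have G_ub (t : R) x : t \in `](a - 1), (a + 1)[ -> [set: T] x -> `|partial1of2 f t x| <= G x.
  rewrite in_itv/= => /andP[t1 t2] _; rewrite d1f /G !normrM normrX.
  rewrite (ger0_norm (expR_ge0 _)) !ler_wpM2l ?exprn_ge0// ler_expR.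
  apply: le_trans (ler_norm _) _; rewrite normrM ler_wpM2r//.
  rewrite ler_norml; have := ler_norm a; have := ler_norm (- a).
  by rewrite normrN => *; apply/andP; split; lra.
have derf (t : R) x : t \in `](a - 1), (a + 1)[ -> [set: T] x -> derivable (f ^~ x) t 1.
  by move=> _ _; apply: ex_derive.
have G0 x : 0 <= G x by rewrite !mulr_ge0 ?exprn_ge0 ?expR_ge0.
apply: DeriveDef.
  exact: (@derivable_under_integral _ _ _ m f _ measurableT a (a - 1) (a + 1) aI intf derf G G0 iG G_ub).
rewrite -derive1E.
rewrite (@differentiation_under_integral _ _ _ m f _ measurableT a (a - 1) (a + 1) aI intf derf G G0 iG G_ub).
by apply: eq_Rintegral => x _; rewrite d1f.
Qed.

Hypothesis mgf0 : forall t, \int[m]_x (W x * expR (t * Y x)) = 0.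

(** The moments are the derivatives at the origin of a function that vanishes
identically. *)
Lemma weighted_moment0 (k : nat) : \int[m]_x (W x * Y x ^+ k) = 0.
Proof.
have H : forall t, \int[m]_x (W x * (Y x ^+ k * expR (t * Y x))) = 0.
  elim: k => [t|k ih t]; first by under eq_Rintegral do rewrite mul1r.
  have := @derive_val _ _ _ _ _ _ _ (is_derive_mgf k t).
  by rewrite (funext ih : (fun _ => _) = cst 0) derive_cst => <-.
by rewrite -(H 0); apply: eq_Rintegral => x _; rewrite mul0r expR0 mulr1.
Qed.

Let h2 := h / 2.

Let measurable_gauss (a : R) (k : nat) :
  measurable_fun [set: R] (fun y : R => y ^+ k * expR (a * y ^+ 2)).
Proof.
apply: measurable_funM; first exact: measurable_funX.
by apply: measurableT_comp => //; apply: measurable_funM => //; exact: measurable_funX.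
Qed.

(** Multiplying by [expR (- h * Y ^+ 2 / 2)] keeps all moments zero, because the
series of this factor may be integrated term by term against
[W * expR (h * Y ^+ 2)].  The step has a fixed size, so that iterating it
reaches arbitrarily narrow bell curves. *)
Lemma weighted_gauss_moment0 (n k : nat) :
  \int[m]_x (W x * (Y x ^+ k * expR (- (n%:R * h2) * Y x ^+ 2))) = 0.
Proof.
have h2_gt0 : 0 < h2 by rewrite divr_gt0.
elim: n k => [|n ih] k.
  rewrite -[RHS](weighted_moment0 k); apply: eq_Rintegral => x _.
  by rewrite mul0r oppr0 mul0r expR0 mulr1.
have iW j a : a <= h2 -> L1 m (fun x => W x * (Y x ^+ j * expR (a * Y x ^+ 2))).
  move=> ah; have [C C0 hC] := powexp_le_gauss j 0 h2_gt0.
  apply: (@L1_gauss_weight C (fun y => y ^+ j * expR (a * y ^+ 2))) => // y.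
  rewrite normrM normrX (ger0_norm (expR_ge0 _)).
  have := hC y; rewrite mul0r expR0 mulr1 => {}hC.
  rewrite (_ : h * _ = h2 * y ^+ 2 + h2 * y ^+ 2); last by rewrite /h2; field.
  rewrite expRD mulrA ler_pM ?exprn_ge0 ?expR_ge0// ler_expR.
  by rewrite ler_wpM2r// sqr_ge0.
have nh : - (n%:R * h2) <= 0 by rewrite oppr_le0 mulr_ge0// ltW.
rewrite -[RHS](@integral_exp_moments (fun x => W x * (Y x ^+ k *
  expR (- (n%:R * h2) * Y x ^+ 2))) (fun x => - h2 * Y x ^+ 2)).
- have e : - (n.+1%:R * h2) = - (n%:R * h2) + - h2 by rewrite -natr1; ring.
  by apply: eq_Rintegral => x _; rewrite e mulrDl expRD !mulrA.
- apply: measurable_funM => //.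
  exact: (measurableT_comp (measurable_gauss _ _)).
- by apply: measurable_funM => //; exact: measurable_funX.
- have := iW k (- (n%:R * h2) + h2); rewrite gerDr => /(_ nh).
  congr L1; apply/funext => x.
  have -> : `|- h2 * Y x ^+ 2| = h2 * Y x ^+ 2.
    by rewrite mulNr normrN ger0_norm// mulr_ge0 ?sqr_ge0 ?ltW.
  by rewrite mulrDl expRD !mulrA.
move=> j; transitivity ((- h2) ^+ j * \int[m]_x (W x *
    (Y x ^+ (k + 2 * j) * expR (- (n%:R * h2) * Y x ^+ 2)))); last first.
  by rewrite ih mulr0.
rewrite -EZ; last by apply: iW; exact: le_trans (ltW h2_gt0).
by apply: eq_Rintegral => x _; rewrite exprMn exprD exprM; ring.
Qed.

(** Expanding [(Y - z) ^+ 2] leaves a Gaussian factor centred at the origin and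
the exponential of a multiple of [Y], whose series may again be integrated term
by term. *)
Lemma weighted_gauss_kernel0 (n : nat) (z : R) :
  \int[m]_x (W x * expR (- (n%:R * h2) * (Y x - z) ^+ 2)) = 0.
Proof.
have h2_ge0 : 0 <= h2 by rewrite divr_ge0// ltW.
set a := n%:R * h2; have a_ge0 : 0 <= a by rewrite mulr_ge0.
have iW j b : L1 m (fun x => W x * (expR (- a * Y x ^+ 2) * (Y x ^+ j * expR (b * `|Y x|)))).
  have [C C0 hC] := powexp_le_gauss j b h_gt0.
  apply: (@L1_gauss_weight C (fun y => expR (- a * y ^+ 2) *
      (y ^+ j * expR (b * `|y|)))) => [|y].
    apply: measurable_funM.
      by apply: measurableT_comp => //; apply: measurable_funM => //; exact: measurable_funX.
    apply: measurable_funM; first exact: measurable_funX.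
    by apply: measurableT_comp => //; apply: measurable_funM => //; exact: normr_measurable.
  rewrite !normrM normrX !(ger0_norm (expR_ge0 _)); apply: le_trans (hC y).
  rewrite ler_piMl ?mulr_ge0 ?exprn_ge0 ?expR_ge0// -expR0 ler_expR.
  by rewrite mulNr oppr_le0 mulr_ge0 ?sqr_ge0.
have mgauss : measurable_fun [set: T] (fun x => W x * expR (- a * Y x ^+ 2)).
  apply: measurable_funM => //; apply: measurableT_comp => //.
  by apply: measurable_funM => //; exact: measurable_funX.
have key : \int[m]_x (W x * expR (- a * Y x ^+ 2) * expR (2 * a * z * Y x)) = 0.
  apply: integral_exp_moments => //.
  - exact: measurable_funM.
  - have := iW 0%N `|2 * a * z|; congr L1; apply/funext => x.
    by rewrite expr0 mul1r mulrA (normrM _ (Y x)).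
  move=> j; transitivity ((2 * a * z) ^+ j *
      \int[m]_x (W x * (expR (- a * Y x ^+ 2) * (Y x ^+ j * expR (0 * `|Y x|))))).
    rewrite -EZ//; apply: eq_Rintegral => x _.
    by rewrite mul0r expR0 mulr1 exprMn; ring.
  apply/eqP; rewrite mulf_eq0; apply/orP; right; apply/eqP.
  rewrite -[RHS](weighted_gauss_moment0 n j) -/a; apply: eq_Rintegral => x _.
  by rewrite mul0r expR0 mulr1 [Y x ^+ j * _]mulrC.
rewrite -[RHS](mulr0 (expR (- a * z ^+ 2))) -{}key -EZ; last first.
  apply: (L1_le _ (L1_abs (iW 0%N `|2 * a * z|))).
    by apply: measurable_funM => //; apply: measurableT_comp => //; exact: measurable_funM.
  move=> x; rewrite expr0 mul1r -mulrA !normrM !(ger0_norm (expR_ge0 _)).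
  rewrite !ler_wpM2l ?expR_ge0// ler_expR -!normrM; exact: ler_norm.
apply: eq_Rintegral => x _.
rewrite (_ : - a * (Y x - z) ^+ 2 =
  (- a * z ^+ 2 + - a * Y x ^+ 2) + 2 * a * z * Y x); last by ring.
by rewrite !expRD; ring.
Qed.

End exponential_integrals.

(** * Fubini's theorem and normal densities *)

Section real_fubini.
Context d1 d2 (T1 : measurableType d1) (T2 : measurableType d2) (R : realType).
Context (m1 : {sigma_finite_measure set T1 -> \bar R}).
Context (m2 : {sigma_finite_measure set T2 -> \bar R}).
Context (F : T1 * T2 -> R).

Hypothesis mF : measurable_fun [set: T1 * T2] F.

Let posE x y : ((fun y => (F (x, y))%:E)^\+ y = (EFin \o F)^\+ (x, y))%E.
Proof. by rewrite -[LHS]/(((EFin \o F) \o pair x)^\+ y)%E funepos_comp. Qed.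

Let negE x y : ((fun y => (F (x, y))%:E)^\- y = (EFin \o F)^\- (x, y))%E.
Proof. by rewrite -[LHS]/(((EFin \o F) \o pair x)^\- y)%E funeneg_comp. Qed.

Let posE2 x y : ((fun x => (F (x, y))%:E)^\+ x = (EFin \o F)^\+ (x, y))%E.
Proof. by rewrite -[LHS]/(((EFin \o F) \o (pair ^~ y))^\+ x)%E funepos_comp. Qed.

Let negE2 x y : ((fun x => (F (x, y))%:E)^\- x = (EFin \o F)^\- (x, y))%E.
Proof. by rewrite -[LHS]/(((EFin \o F) \o (pair ^~ y))^\- x)%E funeneg_comp. Qed.

Let mpos : measurable_fun [set: T1 * T2] (EFin \o F)^\+%E.
Proof. by apply: measurable_funepos; exact/measurable_EFinP. Qed.

Let mneg : measurable_fun [set: T1 * T2] (EFin \o F)^\-%E.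
Proof. by apply: measurable_funeneg; exact/measurable_EFinP. Qed.

Lemma measurable_Rintegral1 :
  measurable_fun [set: T1] (fun x => \int[m2]_y F (x, y)).
Proof.
apply: measurableT_comp => //; under eq_fun => x do rewrite integralE.
apply: emeasurable_funB; under eq_fun do under eq_integral do rewrite ?posE ?negE.
  exact: (measurable_fun_fubini_tonelli_F _ mpos).
exact: (measurable_fun_fubini_tonelli_F _ mneg).
Qed.

Lemma measurable_Rintegral2 :
  measurable_fun [set: T2] (fun y => \int[m1]_x F (x, y)).
Proof.
apply: measurableT_comp => //; under eq_fun => x do rewrite integralE.
apply: emeasurable_funB; under eq_fun do under eq_integral do rewrite ?posE2 ?negE2.
  exact: (measurable_fun_fubini_tonelli_G _ mpos).
exact: (measurable_fun_fubini_tonelli_G _ mneg).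
Qed.

Hypothesis iF : (m1 \x m2)%E.-integrable [set: T1 * T2] (EFin \o F).

Lemma ae_Rintegral1 : {ae m1, forall x,
  (\int[m2]_y (F (x, y))%:E)%E = (\int[m2]_y F (x, y))%:E}.
Proof.
apply: filterS (ae_integrable1 iF) => x ix.
by rewrite /Rintegral fineK//; exact: integrable_fin_num.
Qed.

Lemma ae_Rintegral2 : {ae m2, forall y,
  (\int[m1]_x (F (x, y))%:E)%E = (\int[m1]_x F (x, y))%:E}.
Proof.
apply: filterS (ae_integrable2 iF) => x ix.
by rewrite /Rintegral fineK//; exact: integrable_fin_num.
Qed.

Lemma L1_Rintegral1 : L1 m1 (fun x => \int[m2]_y F (x, y)).
Proof.
apply: (L1_ae _ (integrable_fubini_F iF)); first exact: measurable_Rintegral1.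
exact: ae_Rintegral1.
Qed.

Lemma Rintegral_fubini :
  \int[m1]_x \int[m2]_y F (x, y) = \int[m2]_y \int[m1]_x F (x, y).
Proof.
congr fine; transitivity (\int[m1]_x \int[m2]_y (F (x, y))%:E)%E.
  apply: ae_eq_integral => //.
  - exact/measurable_EFinP/measurable_Rintegral1.
  - exact: measurable_fubini_F iF.
  - by apply: filterS ae_Rintegral1 => x + _.
rewrite (Fubini iF); apply: ae_eq_integral => //.
- exact: measurable_fubini_G iF.
- exact/measurable_EFinP/measurable_Rintegral2.
- by apply: filterS ae_Rintegral2 => x + _.
Qed.

End real_fubini.

Section normal_law_facts.
Context (R : realType).
Implicit Types m s t x y z : R.
Local Notation leb := (@lebesgue_measure R).

(** Completing the square: an exponential tilt translates a normal density. *)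
Lemma normal_pdf_expR m s t x : s != 0 -> normal_pdf m s x * expR (t * x) =
  expR (m * t + s ^+ 2 * t ^+ 2 / 2) * normal_pdf (m + s ^+ 2 * t) s x.
Proof.
move=> s0; rewrite !normal_pdfE// /normal_fun mulrCA -(mulrA (normal_peak s)) -!expRD.
have -> : m * t + s ^+ 2 * t ^+ 2 / 2 +
    - (x - (m + s ^+ 2 * t)) ^+ 2 / (s ^+ 2 *+ 2) =
    - (x - m) ^+ 2 / (s ^+ 2 *+ 2) + t * x by field.
by [].
Qed.

Lemma normal_pdf_expR_sqr s x : 0 < s ->
  normal_pdf 0 s x * expR (x ^+ 2 / (4 * s ^+ 2)) =
  Num.sqrt 2 * normal_pdf 0 (Num.sqrt 2 * s) x.
Proof.
move=> s0; have s20 : 0 < Num.sqrt 2 :> R by rewrite sqrtr_gt0.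
have s2E : (Num.sqrt 2 * s) ^+ 2 = 2 * s ^+ 2 by rewrite exprMn sqr_sqrtr.
rewrite !normal_pdfE ?mulf_neq0 ?gt_eqF// /normal_fun /normal_peak s2E.
have sqrtE (p : R) : Num.sqrt (2 * s ^+ 2 * p *+ 2) =
    Num.sqrt 2 * Num.sqrt (s ^+ 2 * p *+ 2).
  rewrite -(sqrtrM _ (ler0n R 2)).
  by have -> : 2 * (s ^+ 2 * p *+ 2) = 2 * s ^+ 2 * p *+ 2 by ring.
rewrite sqrtE (invfM (Num.sqrt 2)) (mulrA (Num.sqrt 2)) mulVKf ?gt_eqF//.
have e : - (x - 0) ^+ 2 / (s ^+ 2 *+ 2) + x ^+ 2 / (4 * s ^+ 2) =
    - (x - 0) ^+ 2 / (2 * s ^+ 2 *+ 2).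
  by field; rewrite gt_eqF.
by rewrite -e expRD; exact: esym (mulrA _ _ _).
Qed.

Lemma L1_normal_pdf m s : L1 leb (normal_pdf m s).
Proof. exact: integrable_normal_pdf. Qed.

Lemma Rintegral_normal_pdf m s : \int[leb]_x normal_pdf m s x = 1.
Proof. by rewrite /Rintegral integral_normal_pdf. Qed.

Lemma L1_normal_mgf m s t : s != 0 -> L1 leb (fun x => normal_pdf m s x * expR (t * x)).
Proof.
move=> s0; under eq_fun do rewrite normal_pdf_expR//.
by apply: L1Z; exact: L1_normal_pdf.
Qed.

Lemma normal_mgf m s t : s != 0 ->
  \int[leb]_x (normal_pdf m s x * expR (t * x)) = expR (m * t + s ^+ 2 * t ^+ 2 / 2).
Proof.
move=> s0; under eq_Rintegral do rewrite normal_pdf_expR//.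
by rewrite EZ ?Rintegral_normal_pdf ?mulr1//; exact: L1_normal_pdf.
Qed.

Lemma normal_exp_shift m s t : s != 0 ->
  L1 leb (fun x => normal_pdf m s x * expR (t * (x - m))) /\
  \int[leb]_x (normal_pdf m s x * expR (t * (x - m))) = expR (s ^+ 2 * t ^+ 2 / 2).
Proof.
move=> s0; have e x : normal_pdf m s x * expR (t * (x - m)) =
    expR (- (t * m)) * (normal_pdf m s x * expR (t * x)).
  by rewrite mulrBr expRD; ring.
split.
  by under eq_fun do rewrite e; apply: L1Z; exact: L1_normal_mgf.
under eq_Rintegral do rewrite e.
rewrite EZ; last exact: L1_normal_mgf.
rewrite normal_mgf// -expRD.
by have -> : - (t * m) + (m * t + s ^+ 2 * t ^+ 2 / 2) = s ^+ 2 * t ^+ 2 / 2 by ring.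
Qed.

(** The mean deviation of a normal law is at most a constant times its standard
deviation, by [|u| <= expR u + expR (- u)] and the mean of an exponential. *)
Lemma normal_smoothing (f : R -> R) (L y s : R) : measurable_fun [set: R] f ->
  (forall u, 0 <= f u <= 1) -> (forall u v, `|f u - f v| <= L * `|u - v|) -> 0 < s ->
  `|\int[leb]_z (f z * normal_pdf y s z) - f y| <= L * (2 * expR (1 / 2)) * s.
Proof.
move=> mf f01 fL s0; have s_neq0 : s != 0 by rewrite gt_eqF.
have L0 : 0 <= L.
  by have := fL 1 0; rewrite subr0 normr1 mulr1; apply: le_trans.
have ifp : L1 leb (fun z => f z * normal_pdf y s z).
  apply: (L1_le _ (L1_normal_pdf y s)) => [|z].
    by apply: measurable_funM => //; exact: measurable_normal_pdf.
  rewrite normrM (ger0_norm (normal_pdf_ge0 _ _ _)) ler_piMl ?normal_pdf_ge0//.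
  by have /andP[? ?] := f01 z; rewrite ger0_norm.
have ifc : L1 leb (fun z => f y * normal_pdf y s z).
  by apply: L1Z; exact: L1_normal_pdf.
rewrite [X in _ - X](_ : f y = \int[leb]_z (f y * normal_pdf y s z)); last first.
  by rewrite EZ ?Rintegral_normal_pdf ?mulr1//; exact: L1_normal_pdf.
rewrite -EB//; apply: le_trans (E_abs (L1B ifp ifc)) _.
have [i1 e1] := normal_exp_shift y s^-1 s_neq0.
have [i2 e2] := normal_exp_shift y (- s^-1) s_neq0.
have e12 : s ^+ 2 * s^-1 ^+ 2 / 2 = 1 / 2 by field.
rewrite sqrrN e12 in e2; rewrite e12 in e1.
rewrite (_ : L * _ * s = L * s * (\int[leb]_x (normal_pdf y s x * expR (s^-1 * (x - y))) +
  \int[leb]_x (normal_pdf y s x * expR (- s^-1 * (x - y))))); last first.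
  by rewrite e1 e2; ring.
rewrite -ED// -EZ; last exact: L1D.
apply: E_le.
- by apply: L1_abs; exact: L1B.
- by apply: L1Z; exact: L1D.
move=> z; rewrite -mulrBl normrM (ger0_norm (normal_pdf_ge0 _ _ _)) -mulrDr.
rewrite mulrCA mulrC ler_wpM2l ?normal_pdf_ge0//.
apply: le_trans (fL _ _) _; rewrite -mulrA ler_wpM2l//.
rewrite -ler_pdivrMl// (_ : s^-1 * `|z - y| = `|s^-1 * (z - y)|); last first.
  by rewrite normrM gtr0_norm ?invr_gt0.
set u := s^-1 * (z - y); rewrite mulNr -/u.
have := expR_ge1Dx u; have := expR_ge1Dx (- u).
have := expR_gt0 u; have := expR_gt0 (- u).
by case: (leP 0 u) => u0 *; [rewrite ger0_norm//|rewrite ltr0_norm//]; lra.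
Qed.

End normal_law_facts.

(** * Uniqueness of the Laplace transform of a weight *)

(** A pi-lambda argument for the signed measure of density [W]. *)
Lemma integral0_preimage d d' (T : measurableType d) (T' : measurableType d')
    (R : realType) (m : {measure set T -> \bar R}) (W : T -> R) (Y : T -> T')
    (G : set (set T')) : L1 m W -> \int[m]_x W x = 0 ->
  measurable_fun [set: T] Y -> setI_closed G -> G `<=` measurable ->
  (forall A, G A -> \int[m]_(x in Y @^-1` A) W x = 0) ->
  forall A, <<s G >> A -> \int[m]_(x in Y @^-1` A) W x = 0.
Proof.
move=> L1W W0 mY GI Gm G0 A.
have mY' (B : set T') : measurable B -> measurable (Y @^-1` B).
  by move=> mB; rewrite -[X in measurable X]setTI; exact: mY.
pose E := [set B : set T' | measurable B /\ \int[m]_(x in Y @^-1` B) W x = 0].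
suff : <<s G >> `<=` E by move=> /[apply] -[].
rewrite -(setI_closed_g_dynkin_g_sigma_algebra GI); apply: smallest_sub; last first.
  by move=> B GB; split; [exact: Gm|exact: G0].
split.
- by split => //; rewrite preimage_setT.
- move=> B [mB B0]; split; first exact: measurableC.
  have := @Rintegral_setU _ _ _ m (Y @^-1` B) (Y @^-1` (~` B)) W.
  rewrite -preimage_setU setUv preimage_setT W0 B0 add0r => -> //.
  + exact: mY'.
  + by apply: mY'; exact: measurableC.
  + by rewrite disj_set2E -preimage_setI setICr preimage_set0.
move=> F tF EF; have mF i : measurable (F i) by case: (EF i).
split; first exact: bigcup_measurable.
rewrite preimage_bigcup /Rintegral integral_bigcup.
- rewrite eseries0// => i _ _; have [_] := EF i; rewrite /Rintegral => H.
  rewrite -[LHS]fineK ?H//; apply: integrable_fin_num => //; first exact: mY'.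
  exact: (integrableS measurableT (mY' _ (mF i)) _ L1W).
- apply/trivIsetP => i j _ _ ij; rewrite -preimage_setI.
  by move/trivIsetP : tF => ->//; rewrite preimage_set0.
- by move=> k; exact: mY'.
- apply: (integrableS measurableT _ _ L1W) => //.
  by apply: bigcup_measurable => k _; exact: mY'.
Qed.

Section laplace_uniqueness.
Context d (T : measurableType d) (R : realType).
Context (m : {sigma_finite_measure set T -> \bar R}).
Context (h : R) (W Y : T -> R).
Hypotheses (h_gt0 : 0 < h) (mW : measurable_fun [set: T] W)
  (mY : measurable_fun [set: T] Y)
  (WY : L1 m (fun x => W x * expR (h * Y x ^+ 2)))
  (mgf0 : forall t, \int[m]_x (W x * expR (t * Y x)) = 0).
Local Notation leb := (@lebesgue_measure R).

Let L1W : L1 m W.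
Proof.
apply: (L1_le mW (L1_abs WY)) => x.
rewrite normrM (ger0_norm (expR_ge0 _)) ler_peMr// -expR0 ler_expR.
by rewrite mulr_ge0 ?sqr_ge0 ?ltW.
Qed.

(** The value [f (Y x)] is close to the mean of [f] under a normal law centred at
[Y x] with a small standard deviation [s].  By Fubini, the integral of this mean
against [W] is a superposition of integrals of [W] against bell curves in [Y x],
which vanish. *)
Lemma mgf0_Lipschitz (L : R) (f : R -> R) : measurable_fun [set: R] f ->
  (forall u, 0 <= f u <= 1) -> (forall u v, `|f u - f v| <= L * `|u - v|) ->
  \int[m]_x (W x * f (Y x)) = 0.
Proof.
move=> mf f01 fL.
have fb u : `|f u| <= 1 by have /andP[? ?] := f01 u; rewrite ger0_norm.
have key (s : R) (n : nat) : 0 < s -> (s ^+ 2 *+ 2)^-1 = n%:R * (h / 2) ->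
    `|\int[m]_x (W x * f (Y x))| <= L * (2 * expR (1 / 2)) * s * \int[m]_x `|W x|.
  move=> s0 sn; have s_neq0 : s != 0 by rewrite gt_eqF.
  pose F (p : T * measurableTypeR R) := W p.1 * (f p.2 * normal_pdf (Y p.1) s p.2).
  have mF : measurable_fun [set: T * measurableTypeR R] F.
    apply: measurable_funM; first exact: (measurableT_comp mW measurable_fst).
    apply: measurable_funM; first exact: (measurableT_comp mf measurable_snd).
    under eq_fun do rewrite normal_pdfE// /normal_fun.
    apply: measurable_funM => //; apply: measurableT_comp => //.
    apply: measurable_funM => //; apply: measurableT_comp => //.
    apply: measurable_funX; apply: measurable_funB; first exact: measurable_snd.
    exact: (measurableT_comp mY measurable_fst).
  have ifp y : L1 leb (fun z => f z * normal_pdf y s z).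
    apply: (L1_le _ (L1_normal_pdf y s)) => [|z].
      by apply: measurable_funM => //; exact: measurable_normal_pdf.
    by rewrite normrM (ger0_norm (normal_pdf_ge0 _ _ _)) ler_piMl ?normal_pdf_ge0.
  have iF : (m \x leb)%E.-integrable [set: T * measurableTypeR R] (EFin \o F).
    apply/integrable12ltyP; first exact/measurable_EFinP.
    have /integrableP[_] := L1W; apply: le_lt_trans.
    apply: ge0_le_integral => //.
    - by move=> x _; exact: integral_ge0.
    - apply: (measurable_fun_fubini_tonelli_F (m2 := leb) (abse \o (EFin \o F))); last first.
        by move=> p; exact: abse_ge0.
      by apply: measurableT_comp => //; exact/measurable_EFinP.
    - apply/measurable_EFinP; exact: L1_measurable (L1_abs L1W).
    move=> x _; under eq_integral do rewrite /F/= normrM EFinM.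
    rewrite ge0_integralZl//=; last first.
      by apply: measurableT_comp => //; apply: measurableT_comp => //; exact: L1_measurable (ifp _).
    rewrite -[leRHS]mule1 lee_wpmul2l//.
    rewrite (EFinE (L1_abs (ifp (Y x)))) lee_fin -(Rintegral_normal_pdf (Y x) s).
    apply: E_le; [exact: L1_abs|exact: L1_normal_pdf|] => z.
    by rewrite normrM (ger0_norm (normal_pdf_ge0 _ _ _)) ler_piMl ?normal_pdf_ge0.
  have sm0 : \int[m]_x (W x * \int[leb]_z (f z * normal_pdf (Y x) s z)) = 0.
    transitivity (\int[m]_x \int[leb]_z F (x, z)).
      by apply: eq_Rintegral => x _; rewrite -EZ.
    rewrite (Rintegral_fubini mF iF) (@eq_Rintegral _ _ _ leb setT (cst 0)).
      by rewrite Rintegral_cst// mul0r.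
    move=> z _; rewrite /F/=.
    have e x : W x * (f z * normal_pdf (Y x) s z) = f z * normal_peak s *
        (W x * expR (- (n%:R * (h / 2)) * (Y x - z) ^+ 2)).
      rewrite normal_pdfE// /normal_fun sn; set pk := normal_peak s.
      have -> : - (z - Y x) ^+ 2 * (n%:R * (h / 2)) =
        - (n%:R * (h / 2)) * (Y x - z) ^+ 2 by ring.
      by move: pk (expR _) => pk g; ring.
    under eq_Rintegral do rewrite e.
    rewrite EZ ?(weighted_gauss_kernel0 h_gt0 mW mY WY mgf0) ?mulr0//.
    apply: (L1_le _ (L1_abs L1W)) => [|x].
      apply: measurable_funM => //; apply: measurableT_comp => //.
      apply: measurable_funM => //; apply: measurable_funX; exact: measurable_funB.
    rewrite normrM (ger0_norm (expR_ge0 _)) ler_piMr// -expR0 ler_expR.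
    by rewrite mulNr oppr_le0 mulr_ge0 ?sqr_ge0// mulr_ge0// divr_ge0// ltW.
  have iWf : L1 m (fun x => W x * f (Y x)).
    apply: (L1_le _ (L1_abs L1W)) => [|x].
      by apply: measurable_funM => //; exact: measurableT_comp.
    by rewrite normrM ler_piMr.
  have iWs : L1 m (fun x => W x * \int[leb]_z (f z * normal_pdf (Y x) s z)).
    have := L1_Rintegral1 mF iF; congr (L1 m); apply/funext => x.
    by rewrite -EZ.
  rewrite -normrN -[X in `|X|]add0r -{1}sm0 -EB//.
  apply: le_trans (E_abs (L1B iWs iWf)) _; rewrite -EZ; last exact: L1_abs.
  apply: E_le; [exact/L1_abs/L1B|exact/L1Z/L1_abs|move=> x].
  by rewrite -mulrBr normrM mulrC ler_wpM2r//; exact: normal_smoothing.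
(* as [s] may be of order [n ^ (-1/2)], [c ^+ 2 * n] is bounded in [n] *)
set c := \int[m]_x _ in key *; set D := L * _ in key.
apply/eqP/negPn/negP => c0.
pose k := c ^+ 2; pose D2 := (D * \int[m]_x `|W x|) ^+ 2 / h.
have kn (n : nat) : k * n.+1%:R <= D2.
  pose v := (n.+1%:R * h)^-1.
  have v0 : 0 < v by rewrite invr_gt0 mulr_gt0.
  have s0 : 0 < Num.sqrt v by rewrite sqrtr_gt0.
  have := key _ n.+1 s0; rewrite sqr_sqrtr ?(ltW v0)// => /(_ _)/=.
  have -> : (v *+ 2)^-1 = n.+1%:R * (h / 2).
    by rewrite -[v *+ 2]mulr_natr invfM invrK mulrA.
  move=> /(_ erefl) H.
  have : k <= (D * Num.sqrt v * \int[m]_x `|W x|) ^+ 2.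
    rewrite /k -(real_normK (num_real c)) lerXn2r ?nnegrE//.
    exact: le_trans (normr_ge0 _) H.
  rewrite mulrAC exprMn sqr_sqrtr ?(ltW v0)//.
  rewrite (_ : _ * v = D2 / n.+1%:R); last first.
    by rewrite /D2 /v invfM; ring.
  by rewrite ler_pdivlMr.
have k0 : 0 < k by rewrite exprn_even_gt0.
have := kn (Num.truncn (D2 / k)); rewrite leNgt => /negP; apply.
by rewrite -ltr_pdivrMl// mulrC truncnS_gt.
Qed.

Let ramp (a : R) (n : nat) (u : R) : R := Num.min 1 (Num.max 0 (n%:R * (u - a))).

Let ramp01 a n u : 0 <= ramp a n u <= 1.
Proof. by rewrite /ramp le_min ler01 le_max lexx ge_min lexx. Qed.

Let measurable_ramp a n : measurable_fun [set: R] (ramp a n).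
Proof.
apply: measurable_minr => //; apply: measurable_maxr => //.
by apply: measurable_funM => //; exact: measurable_funB.
Qed.

Let ramp_Lipschitz a n u v : `|ramp a n u - ramp a n v| <= n%:R * `|u - v|.
Proof.
rewrite -[X in X * _](@ger0_norm _ n%:R)// -normrM.
rewrite (_ : n%:R * (u - v) = n%:R * (u - a) - n%:R * (v - a)); last by ring.
rewrite /ramp; move: (n%:R * (u - a)) (n%:R * (v - a)) => x y.
wlog xy : x y / x <= y.
  by move=> H; case: (leP x y) => [/H//|/ltW/H]; rewrite distrC [leRHS]distrC.
rewrite distrC [leRHS]distrC (ger0_norm (_ : 0 <= y - x)) ?subr_ge0//.
rewrite ler_norml; apply/andP; split;
  case: (leP 0 x) => ?; case: (leP 0 y) => ?; rewrite ?minElt; do ?case: ifPn; lra.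
Qed.

Let ramp_cvg a u : ramp a n u @[n --> \oo] --> (\1_`]a, +oo[ u : R).
Proof.
rewrite indicE; case: (leP u a) => ua.
  rewrite memNset; last by rewrite /= in_itv/= andbT; apply/negP; rewrite -leNgt.
  rewrite (_ : (fun n => _) = cst 0); first exact: cvg_cst.
  apply/funext => n; rewrite /ramp max_l ?min_r//.
  by rewrite mulr_ge0_le0// subr_le0.
rewrite mem_set; last by rewrite /= in_itv/= andbT.
apply: cvg_near_cst; exists (Num.truncn (u - a)^-1).+1 => //= n.
rewrite /= => nN; have h1 : 1 <= n%:R * (u - a).
  rewrite -ler_pdivrMr ?subr_gt0// mul1r; apply/ltW.
  by apply: lt_le_trans (truncnS_gt _) _; rewrite ler_nat.
by rewrite /ramp max_r ?min_l// (le_trans _ h1).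
Qed.

(** Uniqueness of the two-sided Laplace transform, for the signed measure that is
the image under [Y] of the measure of density [W]: indicators of half-lines are
limits of Lipschitz ramps, and half-lines generate the Borel sets. *)
Lemma mgf0_preimage (B : set R) : measurable B -> \int[m]_(x in Y @^-1` B) W x = 0.
Proof.
have preE (A : set R) : \int[m]_(x in Y @^-1` A) W x = \int[m]_x (W x * \1_A (Y x)).
  by rewrite Rintegral_mkcond; apply: eq_Rintegral => x _; rewrite patch_indic.
have L1W1 (A : set R) : measurable A -> L1 m (fun x => W x * \1_A (Y x)).
  move=> mA; apply: (L1_le _ (L1_abs L1W)) => [|x].
    by apply: measurable_funM => //; exact: measurableT_comp.
  by rewrite normrM ler_piMr// indicE; case: (_ \in _); rewrite ?normr1 ?normr0.
have W0 : \int[m]_x W x = 0.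
  by rewrite -(mgf0 0); apply: eq_Rintegral => x _; rewrite mul0r expR0 mulr1.
have GR : @measurable _ R = <<s @RGenOInfty.G R >> := RGenOInfty.measurableE R.
rewrite [X in X B -> _]GR; apply: (integral0_preimage L1W W0 mY).
- move=> _ _ [x ->] [y ->]; exists (Num.max x y).
  apply/seteqP; split => z /=; rewrite !in_itv/= !andbT.
    by move=> [xz yz]; rewrite gt_max xz.
  by rewrite gt_max => /andP[].
- by move=> _ [a ->]; exact: measurable_itv.
move=> _ [a ->]; rewrite preE.
have : \int[m]_x (W x * ramp a n (Y x)) @[n --> \oo] -->
    \int[m]_x (W x * \1_`]a, +oo[ (Y x)).
  apply: (dominated_cvg_Rintegral _ _ _ (L1_abs L1W)).
  - by move=> n; apply: measurable_funM => //; exact: measurableT_comp.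
  - exact: L1_measurable (L1W1 _ _).
  - by move=> x; apply: cvgM; [exact: cvg_cst|exact: ramp_cvg].
  - move=> n x; rewrite normrM ler_piMr//.
    by have /andP[? ?] := ramp01 a n (Y x); rewrite ger0_norm.
under eq_fun do rewrite (mgf0_Lipschitz (measurable_ramp _ _)
  (ramp01 _ _) (ramp_Lipschitz _ _)).
by move=> /(cvg_unique _ (cvg_cst _)) <-.
Qed.

End laplace_uniqueness.

(** [expR (s ^+ 2 * Y ^+ 2 / 2)] is the mean of [expR (Z * Y)] over a centred
normal variable [Z] of standard deviation [s], so that by Tonelli its integral
is the mean over [Z] of a function that grows like [expR (c * Z ^+ 2)]. *)
Lemma L1_expR_sqr d (T : measurableType d) (R : realType)
    (m : {sigma_finite_measure set T -> \bar R}) (Y : T -> R) (C c : R) :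
  0 < c -> measurable_fun [set: T] Y ->
  (forall t, L1 m (fun x => expR (t * Y x))) ->
  (forall t, \int[m]_x expR (t * Y x) <= C * expR (c * t ^+ 2)) ->
  L1 m (fun x => expR ((8 * c)^-1 * Y x ^+ 2)).
Proof.
move=> c0 mY iY YC.
have [s [s0 s2]] : exists s : R, 0 < s /\ s ^+ 2 = (4 * c)^-1.
  by exists (Num.sqrt (4 * c)^-1); rewrite sqrtr_gt0 sqr_sqrtr ?invr_gt0 ?invr_ge0 ?mulr_gt0 ?mulr_ge0 ?ltW.
have s_neq0 : s != 0 by rewrite gt_eqF.
set leb := @lebesgue_measure R.
pose F (p : T * measurableTypeR R) := normal_pdf 0 s p.2 * expR (p.2 * Y p.1).
have F0 p : 0 <= F p by rewrite mulr_ge0 ?normal_pdf_ge0 ?expR_ge0.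
have mF : measurable_fun [set: T * measurableTypeR R] (EFin \o F).
  apply/measurable_EFinP; apply: measurable_funM.
    exact: (measurableT_comp (measurable_normal_pdf 0 s) measurable_snd).
  apply: measurableT_comp => //; apply: measurable_funM; first exact: measurable_snd.
  exact: (measurableT_comp mY measurable_fst).
apply/integrableP; split.
  apply/measurable_EFinP; apply: measurableT_comp => //.
  by apply: measurable_funM => //; exact: measurable_funX.
have e x : (`|(expR ((8 * c)^-1 * Y x ^+ 2))%:E| = \int[leb]_t (F (x, t))%:E)%E.
  rewrite /F/= ger0_norm ?expR_ge0//; under eq_integral do rewrite [_ * Y x]mulrC.
  rewrite (EFinE (L1_normal_mgf _ _ s_neq0)) normal_mgf// mul0r add0r s2.
  by rewrite (_ : (4 * c)^-1 * Y x ^+ 2 / 2 = (8 * c)^-1 * Y x ^+ 2)//; field; rewrite gt_eqF.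
under eq_integral do rewrite e.
rewrite (@fubini_tonelli _ _ _ _ _ m leb _ mF); last by move=> p; rewrite lee_fin.
have iG : L1 leb (fun t => normal_pdf 0 s t * expR (c * t ^+ 2)).
  have e' t : normal_pdf 0 s t * expR (c * t ^+ 2) =
      Num.sqrt 2 * normal_pdf 0 (Num.sqrt 2 * s) t.
    rewrite -normal_pdf_expR_sqr// s2.
    by rewrite (_ : t ^+ 2 / (4 * (4 * c)^-1) = c * t ^+ 2)//; field; rewrite gt_eqF.
  by under eq_fun do rewrite e'; apply: L1Z; exact: L1_normal_pdf.
apply: le_lt_trans (_ : \int[leb]_t (C * (normal_pdf 0 s t * expR (c * t ^+ 2)))%:E < +oo)%E.
  apply: ge0_le_integral => //.
  - by move=> t _; apply: integral_ge0 => x _; rewrite lee_fin.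
  - apply: (measurable_fun_fubini_tonelli_G (m1 := m) (EFin \o F) mF) => p.
    by rewrite lee_fin.
  - exact: (measurable_int _ (L1Z C iG)).
  move=> t _; rewrite /F/=.
  rewrite (EFinE (L1Z (normal_pdf 0 s t) (iY t))) lee_fin EZ// mulrCA.
  by rewrite ler_wpM2l ?normal_pdf_ge0.
by rewrite (EFinE (L1Z C iG)) ltry.
Qed.

(** * Independence in Gaussian spaces *)

Section gaussian_spaces.
Context d (T : measurableType d) (R : realType) (P : probability T R).
Implicit Types (H : set (T -> R)) (f g Y Z W : T -> R).

Definition lin_closed H := forall a f g, H f -> H g -> H (fun x => a * f x + g x).

(** A linear space of centred jointly Gaussian variables.  As [H] is closed under
scaling, the last equation gives the moment generating function of each of its
elements. *)
Definition gauss_space H := [/\ lin_closed H,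
  (forall f, H f -> L2 P f),
  (forall f, H f -> L1 P (fun x => expR (f x))) &
  (forall f, H f -> \int[P]_x expR (f x) = expR ((\int[P]_x f x ^+ 2) / 2))].

Lemma lin_closedZ H a f : lin_closed H -> H f -> H (fun x => a * f x).
Proof.
move=> lH Hf; have := lH (a - 1) f f Hf Hf.
by congr H; apply/funext => x; ring.
Qed.

Lemma lin_closedB H f g : lin_closed H -> H f -> H g -> H (fun x => f x - g x).
Proof.
by move=> lH Hf Hg; have := lH (-1) g f Hg Hf; congr H; apply/funext => x; ring.
Qed.

Lemma L2_cst (c : R) : L2 P (cst c).
Proof. by split => //; exact: (finite_measure_integrable_cst P (c ^+ 2)). Qed.

Lemma gauss_mgf H f t : gauss_space H -> H f -> L1 P (fun x => expR (t * f x)) /\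
  \int[P]_x expR (t * f x) = expR (t ^+ 2 * (\int[P]_x f x ^+ 2) / 2).
Proof.
move=> [lH H2 H1 He] Hf; have Ht := lin_closedZ t lH Hf; split; first exact: H1.
rewrite He//; congr (expR (_ / 2)); under eq_Rintegral do rewrite exprMn.
by rewrite EZ//; case: (H2 _ Hf).
Qed.

Lemma gauss_exp_L2 H f : gauss_space H -> H f -> L2 P (fun x => expR (f x)).
Proof.
move=> gH Hf; have [lH H2 H1 He] := gH; split.
  exact: L1_measurable (H1 _ Hf).
have [+ _] := gauss_mgf 2 gH Hf; congr (L1 P); apply/funext => x.
by rewrite expRM_natl.
Qed.

Lemma gauss_exp_sqr_L2 H f : gauss_space H -> H f ->
  exists2 h, 0 < h & L2 P (fun x => expR (h * f x ^+ 2)).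
Proof.
move=> gH Hf; have [lH H2 H1 He] := gH; set v := \int[P]_x f x ^+ 2.
have v0 : 0 <= v by apply: E_ge0 => x; exact: sqr_ge0.
have mf := L2_measurable (H2 _ Hf).
have c0 : 0 < v / 2 + 1 by rewrite ltr_wpDl// divr_ge0.
have := @L1_expR_sqr _ T R P f 1 _ c0 mf.
set k := (8 * _)^-1 => iH.
have k0 : 0 < k by rewrite invr_gt0 mulr_gt0.
exists (k / 2); first by rewrite divr_gt0.
split.
  apply: measurableT_comp => //; apply: measurable_funM => //.
  exact: measurable_funX.
have : L1 P (fun x => expR (k * f x ^+ 2)).
  apply: iH => t; have [it et] := gauss_mgf t gH Hf; first exact: it.
  move: it et; rewrite mul1r -/v => _ ->; rewrite ler_expR; have := sqr_ge0 t; nra.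
congr (L1 P); apply/funext => x; rewrite -expRM_natl.
by have -> : 2%:R * (k / 2 * f x ^+ 2) = k * f x ^+ 2 by field.
Qed.

(** Multiplying a weight by the indicator of an event [Y \in B] preserves its
orthogonality to all exponentials of the space: [expR (t * Y + Z)] is itself
such an exponential. *)
Lemma gauss_weight_indic H W Y (B : set R) : gauss_space H ->
  measurable_fun [set: T] W -> (forall x, `|W x| <= 1) -> H Y -> measurable B ->
  (forall Z, H Z -> \int[P]_x (W x * expR (Z x)) = 0) ->
  forall Z, H Z -> \int[P]_x (W x * \1_B (Y x) * expR (Z x)) = 0.
Proof.
move=> gH mW W1 HY mB W0 Z HZ; have [lH H2 H1 He] := gH.
have [h h0 hY] := gauss_exp_sqr_L2 gH HY.
have eZ := gauss_exp_L2 gH HZ.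
have mY := L2_measurable (H2 _ HY).
have mWZ : measurable_fun [set: T] (fun x => W x * expR (Z x)).
  by apply: measurable_funM => //; exact: L2_measurable eZ.
have iWY : L1 P (fun x => W x * expR (Z x) * expR (h * Y x ^+ 2)).
  apply: (L1_le _ (L1_abs (L1M eZ hY))) => [|x].
    by apply: measurable_funM => //; exact: L2_measurable hY.
  rewrite -mulrA normrM ler_piMl//.
have H0 t : \int[P]_x (W x * expR (Z x) * expR (t * Y x)) = 0.
  rewrite -(W0 (fun x => t * Y x + Z x)); last exact: lH.
  by apply: eq_Rintegral => x _; rewrite addrC expRD mulrA.
have := mgf0_preimage h0 mWZ mY iWY H0 mB; rewrite Rintegral_mkcond => e.
by rewrite -[RHS]e; apply: eq_Rintegral => x _; rewrite patch_indic/= mulrAC.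
Qed.

(** Finite-dimensional events; the inductive form adds one condition at a time,
as does the induction that multiplies a weight by their indicators. *)
Inductive cylinder (I : Type) (D : set I) (Y : I -> T -> R) : set T -> Prop :=
| cylinderT : cylinder D Y setT
| cylinderI i B C : D i -> measurable B -> cylinder D Y C ->
    cylinder D Y (Y i @^-1` B `&` C).

Lemma cylinder_setI I (D : set I) (Y : I -> T -> R) : setI_closed (cylinder D Y).
Proof.
move=> A B; elim=> [|i C A' Di mC _ ih] cB; first by rewrite setTI.
by rewrite -setIA; apply: cylinderI => //; exact: ih.
Qed.

Lemma cylinder_measurable I (D : set I) (Y : I -> T -> R) A :
  (forall i, D i -> measurable_fun [set: T] (Y i)) -> cylinder D Y A -> measurable A.
Proof.
move=> mY; elim=> [//|i B C Di mB _ mC]; apply: measurableI => //.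
by rewrite -[X in measurable X]setTI; exact: mY.
Qed.

Lemma gauss_weight_cylinder H I (D : set I) (Y : I -> T -> R) C : gauss_space H ->
  (forall i, D i -> H (Y i)) -> cylinder D Y C ->
  forall W, measurable_fun [set: T] W -> (forall x, `|W x| <= 1) ->
  (forall Z, H Z -> \int[P]_x (W x * expR (Z x)) = 0) ->
  forall Z, H Z -> \int[P]_x (W x * \1_C x * expR (Z x)) = 0.
Proof.
move=> gH HY; elim=> [W _ _ W0 Z HZ|i B {}C Di mB _ ih W mW W1 W0 Z HZ].
  by rewrite -[RHS](W0 Z HZ); apply: eq_Rintegral => x _; rewrite indicT mulr1.
have [lH H2 H1 He] := gH; have mY := L2_measurable (H2 _ (HY _ Di)).
rewrite -[RHS](ih (fun x => W x * \1_B (Y i x)) _ _ _ Z)//.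
- by apply: eq_Rintegral => x _; rewrite indicI/= -!mulrA.
- by apply: measurable_funM => //; exact: measurableT_comp.
- move=> x; rewrite normrM -[leRHS]mulr1 ler_pM// indicE.
  by case: (_ \in _); rewrite ?normr1 ?normr0.
- exact: gauss_weight_indic (HY _ Di) _ _.
Qed.

(** In a Gaussian space, orthogonality implies independence.  Let [K] be the
subspace of the elements orthogonal to [S].  For [Z] in [K], the product rule for
the moment generating functions says that the weight [expR Z - 'E[expR Z]] is
orthogonal to all [expR (t * S)], hence to the event [E := (S \in B)]; in other
words, the weight [\1_E - P E] is orthogonal to all exponentials of [K].  It
remains so when it is multiplied by indicators of events in variables of [K], and
taking [Z = 0] gives the product rule on cylinders. *)
Lemma gauss_orthogonal_independent H (I : Type) (D : set I) (Y : I -> T -> R)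
    (S : T -> R) : gauss_space H -> H S -> (forall i, D i -> H (Y i)) ->
  (forall i, D i -> \int[P]_x (Y i x * S x) = 0) ->
  forall (A : set T) (B : set R),
    <<s \bigcup_(i in D) preimage_set_system [set: T] (Y i) measurable >> A ->
    measurable B -> (P (A `&` S @^-1` B) = P A * P (S @^-1` B))%E.
Proof.
move=> gH HS HY YS A B sA mB; have [lH H2 H1 He] := gH.
have L2S := H2 _ HS; have mS := L2_measurable L2S.
pose K := [set Z | H Z /\ \int[P]_x (Z x * S x) = 0].
have gK : gauss_space K.
  split; last 3 first; [by move=> f []; auto..|].
  move=> a f g [Hf fS] [Hg gS]; split; first exact: lH.
  have iS u : H u -> L1 P (fun x => u x * S x) by move=> /H2 L2u; exact: L1M.
  under eq_Rintegral do rewrite mulrDl -mulrA.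
  by rewrite ED ?EZ ?iS// ?fS ?gS ?mulr0 ?addr0//; apply: L1Z; exact: iS.
set E := S @^-1` B.
have mE : measurable E by rewrite -[X in measurable X]setTI; exact: mS.
pose p := fine (P E); have pE : P E = p%:E by rewrite fineK ?fin_num_measure.
have p01 : 0 <= p <= 1.
  by rewrite -!lee_fin -pE measure_ge0 probability_le1.
pose W x : R := \1_E x - p.
have mW : measurable_fun [set: T] W by exact: measurable_funB.
have W1 x : `|W x| <= 1.
  have /andP[p0 p1] := p01; rewrite /W indicE.
  by case: (x \in E) => /=; rewrite ler_norml; apply/andP; split; lra.
have WK Z : K Z -> \int[P]_x (W x * expR (Z x)) = 0.
  move=> [HZ ZS]; have [iZ eZ] := gauss_mgf 1 gK (conj HZ ZS).
  have [h h0 hS] := gauss_exp_sqr_L2 gH HS.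
  have eZ2 := gauss_exp_L2 gH HZ; have mZ := L2_measurable eZ2.
  set c := \int[P]_x expR (Z x).
  pose V x : R := expR (Z x) - c.
  have L2V : L2 P V by apply: L2B => //; exact: L2_cst.
  have iV := L1M L2V hS.
  have V0 t : \int[P]_x (V x * expR (t * S x)) = 0.
    have [iS eS] := gauss_mgf t gH HS.
    have HtSZ : H (fun x => t * S x + Z x) by exact: lH.
    under eq_Rintegral do rewrite mulrBl -expRD (addrC (Z _)).
    rewrite EB ?EZ//; [|exact: H1|exact: L1Z].
    rewrite He// eS /c He// -expRD E_lin_sqr//; last exact: H2.
    have SZ : \int[P]_x (S x * Z x) = 0.
      by rewrite -[RHS]ZS; apply: eq_Rintegral => x _; rewrite mulrC.
    by rewrite SZ mulr0 addr0 mulrDl (addrC (_ / 2)) subrr.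
  have := mgf0_preimage h0 (L2_measurable L2V) mS iV V0 mB.
  rewrite Rintegral_mkcond => e.
  have iE : L1 P (fun x => \1_E x * expR (Z x)).
    apply: (L1_le _ (H1 _ HZ)) => [|x].
      by apply: measurable_funM => //; exact: measurable_indic.
    rewrite normrM (ger0_norm (expR_ge0 _)) ler_piMl ?expR_ge0// indicE.
    by case: (_ \in _); rewrite ?normr1 ?normr0.
  under eq_Rintegral do rewrite mulrBl.
  rewrite EB ?EZ//; [|exact: H1|by apply: L1Z; exact: H1].
  rewrite -/c; move: e.
  have -> : patch (cst 0) (S @^-1` B) V = fun x => \1_E x * expR (Z x) - c * \1_E x.
    by apply/funext => x; rewrite patch_indic/= /V; ring.
  have i1 : L1 P (\1_E) by exact: integrable_indic.
  rewrite EB ?EZ//; last exact: L1Z.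
  rewrite (_ : \int[P]_x \1_E x = p); first by move=> e; rewrite (mulrC p).
  by rewrite /Rintegral integral_indic// setIT.
have mY i : D i -> measurable_fun [set: T] (Y i) by move=> /HY/H2[].
have iW : L1 P W.
  by apply: L1B; [exact: integrable_indic|exact: finite_measure_integrable_cst].
have K0 : K (cst 0).
  split.
    by have := lin_closedZ 0 lH HS; congr H; apply/funext => x; rewrite mul0r.
  by under eq_Rintegral do rewrite mul0r; rewrite Rintegral_cst// mul0r.
have W0 : \int[P]_x W x = 0.
  by rewrite -[RHS](WK _ K0); apply: eq_Rintegral => x _; rewrite expR0 mulr1.
have AW : \int[P]_(x in A) W x = 0.
  apply: (@integral0_preimage _ _ _ _ _ P W id (cylinder D Y)) => //.
  - exact: cylinder_setI.
  - by move=> C; exact: cylinder_measurable.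
  - move=> C cC; rewrite preimage_id Rintegral_mkcond.
    rewrite -[RHS](gauss_weight_cylinder gK _ cC mW W1 WK K0); last by split; auto.
    by apply: eq_Rintegral => x _; rewrite patch_indic/= expR0 mulr1.
  apply: smallest_sub sA; first exact: smallest_sigma_algebra.
  move=> _ [i Di [C mC <-]]; apply: sub_sigma_algebra; rewrite setTI -[X in cylinder _ _ X]setIT.
  by apply: cylinderI => //; exact: cylinderT.
have mA : measurable A.
  apply: smallest_sub sA; first exact: sigma_algebra_measurable.
  by move=> _ [i Di [C mC <-]]; exact: mY.
move: AW; rewrite Rintegral_mkcond.
have -> : patch (cst 0) A W = fun x => \1_(A `&` E) x - p * \1_A x.
  by apply/funext => x; rewrite patch_indic/= /W indicI/=; ring.
have iA : L1 P (\1_A) by exact: integrable_indic.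
have iAE : L1 P (\1_(A `&` E)) by apply: integrable_indic; exact: measurableI.
rewrite EB ?EZ//; last exact: L1Z.
rewrite /Rintegral !integral_indic//; last exact: measurableI.
rewrite !setIT => /eqP; rewrite subr_eq0 => /eqP e.
rewrite -[LHS]fineK ?fin_num_measure//; last exact: measurableI.
by rewrite e pE -[P A]fineK ?fin_num_measure// -EFinM mulrC.
Qed.

End gaussian_spaces.

(** * Exponential and second moments of Gaussian variables *)

Section gaussian_rv_facts.
Context d (T : measurableType d) (R : realType) (P : probability T R).
Implicit Types Y : T -> R.
Local Notation leb := (@lebesgue_measure R).

Lemma ge0_integral_normal_prob (m s : R) (f : R -> R) :
  measurable_fun [set: R] f -> (forall x, 0 <= f x) ->
  (\int[normal_prob m s]_x (f x)%:E = \int[leb]_x (normal_pdf m s x * f x)%:E)%E.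
Proof.
move=> mf f0; have dom := @normal_prob_dominates R m s.
rewrite -(Radon_Nikodym_SigmaFinite.change_of_variables dom)//=; last first.
  exact/measurable_EFinP.
have mRN := measurable_int _ (Radon_Nikodym_SigmaFinite.f_integrable dom).
apply: ae_eq_integral => //.
- by apply: emeasurable_funM => //; exact/measurable_EFinP.
- apply/measurable_EFinP; apply: measurable_funM => //.
  exact: measurable_normal_pdf.
have e : ae_eq leb setT (Radon_Nikodym_SigmaFinite.f (normal_prob m s) leb)
    (fun x => (normal_pdf m s x)%:E).
  apply: integral_ae_eq => //.
  - exact: Radon_Nikodym_SigmaFinite.f_integrable.
  - by apply/measurable_EFinP; exact: measurable_normal_pdf.
  - by move=> E _ mE; rewrite -Radon_Nikodym_SigmaFinite.f_integral.
by apply: filterS e => x /(_ I) ex _; rewrite ex -EFinM mulrC.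
Qed.

Lemma gaussian_rv_mgf Y : gaussian_rv P Y -> exists m s : R, forall t,
  L1 P (fun x => expR (t * Y x)) /\
  \int[P]_x expR (t * Y x) = expR (m * t + s ^+ 2 * t ^+ 2 / 2).
Proof.
move=> [mY [m [s law]]]; exists m, s => t.
have mE : measurable_fun [set: R] (fun y : R => expR (t * y)).
  by apply: measurableT_comp => //; exact: measurable_funM.
suff e : (\int[P]_x (expR (t * Y x))%:E = (expR (m * t + s ^+ 2 * t ^+ 2 / 2))%:E)%E.
  split; last by rewrite /Rintegral e.
  apply/integrableP; split; first exact/measurable_EFinP/(measurableT_comp mE mY).
  under eq_integral do rewrite /= ger0_norm ?expR_ge0//.
  by rewrite e ltry.
have mY' : measurable_fun [set: T] (Y : T -> measurableTypeR R) := mY.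
pose Y' : {mfun T >-> measurableTypeR R} :=
  HB.pack (Y : T -> measurableTypeR R) (isMeasurableFun.Build _ _ _ _ _ mY').
transitivity (\int[pushforward P Y']_y (expR (t * y))%:E)%E.
  by rewrite ge0_integral_pushforward//; exact/measurable_EFinP.
have [s0|s0] := eqVneq s 0.
  transitivity (\int[\d_(m : measurableTypeR R)]_y (expR (t * y))%:E)%E.
    apply: eq_measure_integral => A mA _.
    by rewrite -[LHS]/(P (Y @^-1` A)) law// /normal_law s0 eqxx.
  rewrite integral_dirac//; last exact/measurable_EFinP.
  by rewrite diracT mul1e s0 expr0n/= !mul0r addr0 mulrC.
transitivity (\int[normal_prob m s]_y (expR (t * y))%:E)%E.
  apply: eq_measure_integral => A mA _.
  by rewrite -[LHS]/(P (Y @^-1` A)) law// /normal_law (negbTE s0).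
rewrite ge0_integral_normal_prob//.
by rewrite (EFinE (L1_normal_mgf _ _ s0)) normal_mgf.
Qed.

(** The first two derivatives at the origin of the moment generating function
identify its two parameters with the mean and the variance. *)
Lemma centred_gaussian_rv Y : gaussian_rv P Y -> ('E_P[Y] = 0)%E ->
  [/\ L2 P Y, L1 P (fun x => expR (Y x)) &
    \int[P]_x expR (Y x) = expR ((\int[P]_x Y x ^+ 2) / 2)].
Proof.
move=> gY EY0; have mY : measurable_fun [set: T] Y by case: gY.
have [m [s h]] := gaussian_rv_mgf gY.
pose c := m ^+ 2 / 2 + s ^+ 2 / 2 + 1; pose w := m ^+ 2 + s ^+ 2.
have c0 : 0 < c.
  by rewrite /c; have := sqr_ge0 m; have := sqr_ge0 s; lra.
have iYh : L1 P (fun x => 1 * expR ((8 * c)^-1 * Y x ^+ 2)).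
  under eq_fun do rewrite mul1r.
  apply: (@L1_expR_sqr _ T R P Y (expR 1) _ c0 mY) => t; have [it et] := h t.
    exact: it.
  rewrite et -expRD ler_expR /c.
  have := sqr_ge0 (m - t); have := sqr_ge0 t; have := sqr_ge0 s; nra.
have k0 : 0 < (8 * c)^-1 by rewrite invr_gt0 mulr_gt0.
have iYk k a := @L1_powexp _ T R P _ (cst 1) Y k0 (@measurable_cst _ _ _ _ setT (1 : R)) mY iYh k a.
have dY k a := @is_derive_mgf _ T R P _ (cst 1) Y k0 (@measurable_cst _ _ _ _ setT (1 : R)) mY iYh k a.
pose M (k : nat) (t : R) := \int[P]_x (1 * (Y x ^+ k * expR (t * Y x))).
have M0E t : M 0%N t = expR (m * t + s ^+ 2 * t ^+ 2 / 2).
  have [_ <-] := h t; apply: eq_Rintegral => x _.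
  by rewrite expr0 !mul1r.
have dM (k : nat) (a : R) : is_derive a 1 (M k) (M k.+1 a) by exact: dY.
have M1E t : M 1%N t = (m + s ^+ 2 * t) * M 0%N t.
  pose g : R -> R := (m \*: id) + ((s ^+ 2 / 2) \*: id ^+ 2).
  have gE u : g u = m * u + s ^+ 2 * u ^+ 2 / 2.
    by rewrite /g/= -[LHS]/(m * u + s ^+ 2 / 2 * u ^+ 2) mulrAC.
  have D1 : is_derive t 1 g (m + s ^+ 2 * t).
    by rewrite /g; apply: is_derive_eq; rewrite /GRing.scale/= expr1; field.
  have D2 : is_derive t 1 (expR \o g) (expR (g t) * (m + s ^+ 2 * t)).
    exact: is_derive1_comp.
  have M0g : M 0%N = expR \o g by apply/funext => u; rewrite M0E /= gE.
  have := @derive_val _ _ _ _ _ _ _ (dM 0%N t).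
  by rewrite M0g (@derive_val _ _ _ _ _ _ _ D2) mulrC => ->.
have M2E : M 2%N 0 = m ^+ 2 + s ^+ 2.
  have D0 : is_derive (0 : R) 1 (M 0%N) (M 1%N 0) by exact: dM.
  have D1 : is_derive (0 : R) 1 (cst m + (s ^+ 2 \*: id) : R -> R) (s ^+ 2).
    by apply: is_derive_eq; rewrite /GRing.scale/=; ring.
  have M1M : M 1%N = (cst m + (s ^+ 2 \*: id)) * M 0%N.
    by apply/funext => t; rewrite M1E.
  have D2 := @is_deriveM _ _ _ _ _ _ _ _ D1 D0.
  have := @derive_val _ _ _ _ _ _ _ (dM 1%N 0).
  rewrite M1M (@derive_val _ _ _ _ _ _ _ D2) => <-.
  rewrite /GRing.scale/= M1E M0E -[(cst m + _) 0]/(m + s ^+ 2 * 0).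
  rewrite !mulr0 expr0n/= mulr0 mul0r !addr0 expR0; ring.
have mom k : \int[P]_x Y x ^+ k = M k 0.
  by apply: eq_Rintegral => x _; rewrite mul0r expR0 mul1r mulr1.
have m0 : m = 0.
  have := mom 1%N; rewrite M1E M0E !mulr0 addr0 expr0n/= !mulr0 mul0r addr0 expR0 mulr1.
  by move=> <-; rewrite -[RHS]/(fine 0%E) -EY0 unlock.
have i2 : L1 P (fun x => Y x ^+ 2).
  have := iYk 2%N 0; congr (L1 P); apply/funext => x.
  by rewrite mul0r expR0 mul1r mulr1.
have [i1 e1] := h 1.
split; [by []|by under eq_fun do rewrite -[Y _]mul1r|].
under eq_Rintegral do rewrite -[Y _]mul1r.
rewrite e1 mom M2E m0 expr0n/= add0r mul0r add0r.
by rewrite expr1n mulr1.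
Qed.

End gaussian_rv_facts.

(** * Anticoncentration of Gaussian variables *)

Section gaussian_limits.
Context d (T : measurableType d) (R : realType) (P : probability T R).
Implicit Types (H : set (T -> R)) (f g S : T -> R).

Lemma measurable_ge (a : R) g : measurable_fun [set: T] g ->
  measurable [set x | a <= g x].
Proof.
move=> mg; rewrite (_ : [set x | _] = g @^-1` `[a, +oo[).
  by rewrite -[X in measurable X]setTI; apply: mg.
by apply/seteqP; split => x /=; rewrite in_itv/= andbT.
Qed.

Lemma Rintegral_indic (A : set T) : measurable A -> \int[P]_x \1_A x = fine (P A).
Proof. by move=> mA; rewrite /Rintegral integral_indic// setIT. Qed.

Lemma E_cst (c : R) : \int[P]_x c = c.
Proof.
rewrite Rintegral_cst//; have e : P setT = 1%E := probability_setT P.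
by rewrite -[RHS]mulr1; congr *%R; rewrite -[LHS]/(fine (P setT)) e.
Qed.

(** The fourth moment of a centred Gaussian variable is at most this multiple of
the square of its variance. *)
Definition kurtosis_bound : R := 48 * expR (1 / 2).

Lemma kurtosis_bound_gt0 : 0 < kurtosis_bound.
Proof. by rewrite mulr_gt0 ?expR_gt0. Qed.

(** From [y ^+ 4 <= 24 * expR |y|] at [y = f x / s], with [s] the standard
deviation of [f]. *)
Lemma gauss_fourth_moment H f : gauss_space P H -> H f ->
  L1 P (fun x => f x ^+ 4) /\
  \int[P]_x f x ^+ 4 <= kurtosis_bound * (\int[P]_x f x ^+ 2) ^+ 2.
Proof.
move=> gH Hf; have [lH H2 H1 He] := gH; set v := \int[P]_x f x ^+ 2.
have mf := L2_measurable (H2 _ Hf).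
have v0 : 0 <= v by apply: E_ge0 => x; exact: sqr_ge0.
have bound (s : R) : 0 < s -> L1 P (fun x => f x ^+ 4) /\
    \int[P]_x f x ^+ 4 <= s ^+ 4 * (48 * expR ((s^-1) ^+ 2 * v / 2)).
  move=> s0; have [i1 e1] := gauss_mgf s^-1 gH Hf.
  have [i2 e2] := gauss_mgf (- s^-1) gH Hf.
  pose B x := s ^+ 4 * (24 * (expR (s^-1 * f x) + expR (- s^-1 * f x))).
  have iB : L1 P B by apply: L1Z; apply: L1Z; exact: L1D.
  have fB x : f x ^+ 4 <= B x.
    have fE : f x = s * (s^-1 * f x) by rewrite mulrA mulfV ?mul1r// gt_eqF.
    rewrite /B mulNr {1}fE; set y := s^-1 * f x.
    rewrite exprMn ler_wpM2l ?exprn_ge0 ?(ltW s0)//.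
    have y4 z : 0 <= z -> z ^+ 4 <= 24 * expR z.
      move=> z0; have := expR_ge1Dxn 3 z0; rewrite -[4`!]/24%N => le1.
      have : z ^+ 4 / 24 <= expR z by lra.
      by rewrite ler_pdivrMr// mulrC.
    have := expR_ge0 y; have := expR_ge0 (- y).
    case: (leP 0 y) => [/y4|/ltW]; first by move=> *; lra.
    rewrite -oppr_ge0 => /y4; have -> : (- y) ^+ 4 = y ^+ 4 by ring.
    by move=> *; lra.
  split.
    apply: (L1_le _ iB) => [|x]; first exact: measurable_funX.
    by rewrite ger0_norm// exprn_even_ge0.
  apply: (@le_trans _ _ (\int[P]_x B x)).
    apply: E_le => //; apply: (L1_le _ iB) => [|x]; first exact: measurable_funX.
    by rewrite ger0_norm// exprn_even_ge0.
  rewrite /B !EZ//; [|exact: L1D|by apply: L1Z; exact: L1D].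
  by rewrite ED// e1 e2 sqrrN; have := expR_ge0 (s^-1 ^+ 2 * v / 2); lra.
split; first by have [] := bound 1 ltr01.
have [v_eq0|v_neq0] := eqVneq v 0.
  (* a degenerate variable: the bound holds for all [s], and tends to zero *)
  rewrite v_eq0 expr0n/= mulr0; apply/ler_addgt0Pl => e e0; rewrite addr0.
  have s0 : 0 < Num.sqrt (Num.sqrt (e / 48)).
    by rewrite !sqrtr_gt0 divr_gt0.
  have [_] := bound _ s0; rewrite v_eq0 mulr0 mul0r expR0 mulr1.
  rewrite (@exprM _ _ 2 2) !sqr_sqrtr ?sqrtr_ge0 ?divr_ge0 ?(ltW e0)//.
  by rewrite divfK.
have s0 : 0 < Num.sqrt v by rewrite sqrtr_gt0 lt_def v_neq0.
have [_] := bound _ s0; rewrite exprVn (@exprM _ _ 2 2) sqr_sqrtr// mulVf//.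
by rewrite mulrC.
Qed.

(** The Paley-Zygmund inequality: a centred Gaussian variable is comparable to
its standard deviation with a probability bounded below. *)
Lemma gauss_anticoncentration H f : gauss_space P H -> H f ->
  (4 * kurtosis_bound)^-1 <= fine (P [set x | (\int[P]_x f x ^+ 2) / 2 <= f x ^+ 2]).
Proof.
move=> gH Hf; have [lH H2 H1 He] := gH; set v := \int[P]_x f x ^+ 2.
have [mf if2] := H2 _ Hf.
have [if4 Ef4] := gauss_fourth_moment gH Hf.
set K := kurtosis_bound; have K0 : 0 < K := kurtosis_bound_gt0.
set A := [set x | _]; have mA : measurable A.
  by apply: measurable_ge; exact: measurable_funX.
have v_ge0 : 0 <= v by apply: E_ge0 => x; exact: sqr_ge0.
rewrite -Rintegral_indic//; have iA : L1 P (\1_A) by exact: integrable_indic.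
have [v_eq0|v_neq0] := eqVneq v 0.
  rewrite Rintegral_indic// (_ : A = setT).
    rewrite probability_setT/= invf_le1 ?mulr_gt0// /K /kurtosis_bound.
    by have := expR_ge1Dx (1 / 2 : R); lra.
  by apply/seteqP; split => // x _; rewrite /A/= v_eq0 mul0r sqr_ge0.
have v0 : 0 < v by rewrite lt_def v_neq0.
(* outside [A], [f ^+ 2] is at most [v / 2]; on [A], it is at most
   [lam * f ^+ 4 + K * v], by completing a square *)
pose lam := (4 * K * v)^-1.
have lam0 : 0 < lam by rewrite invr_gt0 !mulr_gt0.
have key : v <= v / 2 + (lam * \int[P]_x f x ^+ 4 + K * v * \int[P]_x \1_A x).
  rewrite {1}/v -(EZ _ if4) -(EZ _ iA).
  have -> : v / 2 = \int[P]_x (v / 2).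
    by rewrite E_cst.
  have ic : L1 P (fun=> v / 2) := finite_measure_integrable_cst P (v / 2) measurableT.
  rewrite -ED; [|exact: L1Z|exact: L1Z].
  rewrite -ED//; last by apply: L1D; exact: L1Z.
  apply: E_le => //; first by apply: L1D => //; apply: L1D; exact: L1Z.
  move=> x; rewrite indicE; case: (boolP (x \in A)) => [_|].
    rewrite mulr1 -[f x ^+ 4]/(f x ^+ (2 * 2)) exprM; set y := f x ^+ 2.
    have e : (lam * y ^+ 2 + K * v) - y = lam * (y - 2 * K * v) ^+ 2.
      by rewrite /lam; field; rewrite !gt_eqF.
    have : 0 <= lam * (y - 2 * K * v) ^+ 2 by rewrite mulr_ge0 ?sqr_ge0 ?ltW.
    by rewrite -e; lra.
  rewrite notin_setE/= => /negP; rewrite -ltNge mulr0 => h.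
  have : 0 <= lam * f x ^+ 4 by rewrite mulr_ge0 ?exprn_even_ge0// ltW.
  lra.
have : lam * \int[P]_x f x ^+ 4 <= v / 4.
  apply: (@le_trans _ _ (lam * (K * v ^+ 2))); first by rewrite ler_wpM2l// ltW.
  by rewrite le_eqVlt; apply/orP; left; apply/eqP; rewrite /lam; field; rewrite !gt_eqF.
move: key; set p := \int[P]_x \1_A x => key h.
have : v / 4 <= K * v * p by lra.
rewrite -ler_pdivrMl ?mulr_gt0//; apply: le_trans.
by rewrite le_eqVlt; apply/orP; left; apply/eqP; field; rewrite !gt_eqF.
Qed.

End gaussian_limits.

(** * Convergence in probability *)

Section convergence_in_probability.
Context d (T : measurableType d) (R : realType) (P : probability T R).
Implicit Types (Y : nat -> T -> R) (f g S : T -> R).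

Lemma measurable_dev (e : R) f g : measurable_fun [set: T] f ->
  measurable_fun [set: T] g -> measurable [set x | e <= `|f x - g x|].
Proof.
move=> mf mg; apply: measurable_ge; apply: measurableT_comp => //.
exact: measurable_funB.
Qed.

Lemma fineP_leU (A B C : set T) : measurable A -> measurable B -> measurable C ->
  A `<=` B `|` C -> fine (P A) <= fine (P B) + fine (P C).
Proof.
move=> mA mB mC ABC; rewrite -fineD ?fin_num_measure//.
apply: fine_le; rewrite ?fin_numD ?fin_num_measure//.
apply: le_trans (measureU2 _ mB mC) => //.
by apply: le_measure; rewrite ?inE//; exact: measurableU.
Qed.

Lemma cvgpP Y S : (forall k, measurable_fun [set: T] (Y k)) ->
  measurable_fun [set: T] S ->
  cvg_in_probability P Y S <-> forall e r : R, 0 < e -> 0 < r ->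
    exists N, forall k, (N <= k)%N -> fine (P [set x | e <= `|Y k x - S x|]) <= r.
Proof.
move=> mY mS; split => [cY e r e0 r0|H e e0].
  have /fine_cvgP[_ /cvgrPdist_le/(_ _ r0)[N _ HN]] := cY _ e0.
  exists N => k Nk; have := HN k Nk; rewrite /= sub0r normrN ger0_norm//.
  exact: fine_ge0.
apply/fine_cvgP; split.
  by apply: nearW => k; rewrite fin_num_measure//; exact: measurable_dev.
apply/cvgrPdist_le => r r0; have [N HN] := H _ _ e0 r0.
exists N => // k /= Nk; rewrite sub0r normrN ger0_norm ?fine_ge0//.
exact: HN.
Qed.

Lemma chebyshev_L2 f (e : R) : L2 P f -> 0 < e ->
  fine (P [set x | e <= `|f x|]) <= (\int[P]_x f x ^+ 2) / e ^+ 2.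
Proof.
move=> [mf if2] e0; set A := [set x | _].
have mA : measurable A by apply: measurable_ge; exact: measurableT_comp.
rewrite -Rintegral_indic// ler_pdivlMr ?exprn_gt0// mulrC.
have iA : L1 P (\1_A) by exact: integrable_indic.
rewrite -EZ//; apply: E_le => //; first exact: L1Z.
move=> x; rewrite indicE; case: (boolP (x \in A)) => [|_].
  by rewrite inE /A/= mulr1 -(real_normK (num_real (f x))) ler_sqr ?nnegrE// ltW.
by rewrite mulr0 sqr_ge0.
Qed.

(** Borel-Cantelli, along indices chosen so that the deviation probabilities are
summable. *)
Lemma cvgp_subsequence Y S : (forall k, measurable_fun [set: T] (Y k)) ->
  measurable_fun [set: T] S -> cvg_in_probability P Y S ->
  exists phi : nat -> nat, (forall j, (j <= phi j)%N) /\
    {ae P, forall x, Y (phi j) x @[j --> \oo] --> S x}.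
Proof.
move=> mY mS /(cvgpP mY mS) cY.
have pow0 (j : nat) : 0 < (2 ^- j.+1 : R) by rewrite invr_gt0 exprn_gt0.
have [phi Hphi] := choice (fun j => cY _ _ (pow0 j) (pow0 j)).
pose psi j := maxn j (phi j).
exists psi; split=> [j|]; first exact: leq_maxl.
pose F j := [set x | 2 ^- j.+1 <= `|Y (psi j) x - S x|].
have mF j : measurable (F j) by exact: measurable_dev.
have F0 : P (lim_sup_set F) = 0%E.
  apply: lim_sup_set_cvg0 => //.
  apply: (@le_lt_trans _ _ (\sum_(j <oo) (2 ^- j.+1 : R)%:E)%E).
    apply: lee_nneseries => // j _.
    rewrite -[X in (X <= _)%E]fineK ?fin_num_measure// lee_fin.
    by apply: Hphi; exact: leq_maxr.
  apply: le_lt_trans (ltry 1); have := epsilon_trick0 xpredT (@ler01 R).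
  apply: le_trans; apply: lee_nneseries => [j _|j _]; rewrite lee_fin.
    by move=> _; exact: ltW (pow0 j).
  by rewrite div1r natrX.
exists (lim_sup_set F); split => //.
  apply: bigcap_measurable => // k _; exact: bigcup_measurable.
move=> x /= xY; apply: contrapT => xF; apply: xY.
have [N HN] : exists N, forall j, (N <= j)%N -> `|Y (psi j) x - S x| < 2 ^- j.+1.
  apply: contrapT => HN; apply: xF => N _; apply: contrapT => HF; apply: HN.
  exists N => j Nj; rewrite ltNge; apply/negP => Fj; apply: HF.
  by exists j.
apply/cvgrPdist_le => e e0; exists (maxn N (Num.truncn e^-1)) => // j /=.
rewrite geq_max => /andP[Nj ej]; rewrite distrC; apply: le_trans (ltW (HN j Nj)) _.
rewrite -[leRHS]invrK lef_pV2 ?posrE ?invr_gt0 ?exprn_gt0//.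
apply: le_trans (ltW (truncnS_gt _)) _; rewrite -natrX ler_nat.
by apply: leq_trans (_ : j.+1 <= _)%N; [rewrite ltnS|exact/ltnW/ltn_expl].
Qed.

(** Fatou's lemma along convergence in probability. *)
Lemma fatou_cvgp Y S (h : R -> R) (c : R) :
  (forall k, measurable_fun [set: T] (Y k)) -> measurable_fun [set: T] S ->
  cvg_in_probability P Y S -> continuous h -> (forall u, 0 <= h u) ->
  (exists N, forall k, (N <= k)%N ->
    L1 P (fun x => h (Y k x)) /\ \int[P]_x h (Y k x) <= c) ->
  L1 P (fun x => h (S x)) /\ \int[P]_x h (S x) <= c.
Proof.
move=> mY mS cY ch h0 [N HN].
have [phi [phij ae]] := cvgp_subsequence mY mS cY.
have mh : measurable_fun [set: R] h by exact: continuous_measurable_fun.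
have Nphi j : (N <= phi (j + N))%N by apply: leq_trans (phij _); exact: leq_addl.
apply: (@fatou_le _ _ _ P (fun j x => h (Y (phi (j + N)%N) x))) => //.
- by move=> j; have [] := HN _ (Nphi j).
- by move=> j; have [] := HN _ (Nphi j).
- exact: measurableT_comp.
apply: filterS ae => x cx.
have : Y (phi (j + N)%N) x @[j --> \oo] --> S x.
  by have := cx; rewrite -(cvg_shiftn N).
exact: (continuous_cvg _ (ch (S x))).
Qed.

End convergence_in_probability.

(** * Mean square closure of a Gaussian space *)

Section gaussian_closure.
Context d (T : measurableType d) (R : realType) (P : probability T R).
Implicit Types (H : set (T -> R)) (f g S : T -> R).

Lemma L2_L1 f : L2 P f -> L1 P f.
Proof.
move=> L2f; have := L1M L2f (L2_cst P 1).
by congr (L1 P); apply/funext => x; rewrite /= mulr1.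
Qed.

Lemma E_sqr_ge0 f : 0 <= \int[P]_x f x ^+ 2.
Proof. by apply: E_ge0 => x; exact: sqr_ge0. Qed.

Section L2_limits.
Context (f_ : nat -> T -> R) (f : T -> R).
Hypotheses (L2f_ : forall k, L2 P (f_ k)) (L2f : L2 P f).
Hypothesis cvg_f : \int[P]_x (f_ k x - f x) ^+ 2 @[k --> \oo] --> 0.

Let sqrt_dev : Num.sqrt (\int[P]_x (f_ k x - f x) ^+ 2) @[k --> \oo] --> 0.
Proof.
have : Num.sqrt u @[u --> (0 : R)] --> (0 : R).
  by rewrite -[X in _ --> X]sqrtr0; exact: sqrt_continuous.
exact: cvg_comp cvg_f.
Qed.

Lemma L2_cvg_ip g : L2 P g ->
  \int[P]_x (f_ k x * g x) @[k --> \oo] --> \int[P]_x (f x * g x).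
Proof.
move=> L2g; apply/cvgrPdist_le => /= e e0.
pose c := Num.sqrt (\int[P]_x g x ^+ 2) + 1.
have c0 : 0 < c by rewrite ltr_wpDl.
have ec0 : 0 < e / c by rewrite divr_gt0.
move/cvgrPdist_le : sqrt_dev => /(_ _ ec0); apply: filterS => k.
rewrite sub0r normrN ger0_norm// ler_pdivlMr// => h.
have fk := L2_measurable (L2f_ k).
rewrite distrC -EB; [|exact: L1M|exact: L1M].
under eq_Rintegral do rewrite -mulrBl.
apply: le_trans (cauchy_schwarz_sqrt (L2B (L2f_ k) L2f) L2g) _.
by apply: le_trans h; rewrite ler_wpM2l// lerDl.
Qed.

Lemma L2_cvg_sqr : \int[P]_x f_ k x ^+ 2 @[k --> \oo] --> \int[P]_x f x ^+ 2.
Proof.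
rewrite (_ : (fun k => _) = (fun k => \int[P]_x (f_ k x - f x) ^+ 2 +
    2 * \int[P]_x (f_ k x * f x) - \int[P]_x f x ^+ 2)).
  rewrite [X in _ --> X](_ : _ = 0 + 2 * \int[P]_x (f x * f x) -
      \int[P]_x f x ^+ 2); last first.
    by under [X in 2 * X]eq_Rintegral do rewrite -expr2; ring.
  apply: cvgB; last exact: cvg_cst.
  by apply: cvgD => //; apply: cvgM; [exact: cvg_cst|exact: L2_cvg_ip].
apply/funext => k; have [_ if2] := L2f; have [_ ik2] := L2f_ k.
have iff := L1M (L2f_ k) L2f; have [_ idev] := L2B (L2f_ k) L2f.
rewrite -EZ// -ED//; last exact: L1Z.
rewrite -EB//; last by apply: L1D => //; exact: L1Z.
by apply: eq_Rintegral => x _; ring.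
Qed.

Lemma L2_cvgp : cvg_in_probability P f_ f.
Proof.
apply/cvgpP; [by move=> k; exact: L2_measurable (L2f_ k)|
  exact: L2_measurable L2f|].
move=> e r e0 r0; have re0 : 0 < r * e ^+ 2 by rewrite mulr_gt0 ?exprn_gt0.
move/cvgrPdist_le : cvg_f => /(_ _ re0)[N _ HN]; exists N => k Nk.
apply: le_trans (chebyshev_L2 (L2B (L2f_ k) L2f) e0) _.
rewrite ler_pdivrMr ?exprn_gt0//; have := HN k Nk.
by rewrite /= sub0r normrN ger0_norm ?E_sqr_ge0.
Qed.

End L2_limits.

(** The approximation error [e] bounds the mean square distance, not its
root. *)
Definition L2_closure H : set (T -> R) := [set f | L2 P f /\
  forall e : R, 0 < e -> exists g, H g /\ \int[P]_x (f x - g x) ^+ 2 <= e].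

Lemma sub_L2_closure H f : (forall g, H g -> L2 P g) -> H f -> L2_closure H f.
Proof.
move=> H2 Hf; split; first exact: H2.
move=> e e0; exists f; split => //.
under eq_Rintegral do rewrite subrr expr0n.
by rewrite E_cst ltW.
Qed.

Lemma L2_closure_lin H : (forall g, H g -> L2 P g) -> lin_closed H ->
  lin_closed (L2_closure H).
Proof.
move=> H2 lH a f f' [L2f Hf] [L2f' Hf']; split; first exact: L2_lin.
move=> e e0; have a1 : 0 < 4 * (a ^+ 2 + 1) by have := sqr_ge0 a; lra.
have [g [Hg fg]] := Hf _ (divr_gt0 e0 a1).
have [g' [Hg' fg']] := Hf' _ (divr_gt0 e0 (ltr0Sn R 3)).
exists (fun x => a * g x + g' x); split; first exact: lH.
have [L2d id] := L2B L2f (H2 _ Hg); have [L2d' id'] := L2B L2f' (H2 _ Hg').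
have L2s := L2B (L2_lin a L2f L2f') (L2_lin a (H2 _ Hg) (H2 _ Hg')).
apply: (@le_trans _ _ (2 * a ^+ 2 * \int[P]_x (f x - g x) ^+ 2 +
    2 * \int[P]_x (f' x - g' x) ^+ 2)).
  rewrite -!EZ// -ED; [|exact: L1Z|exact: L1Z].
  apply: E_le; [by case: L2s|by apply: L1D; exact: L1Z|move=> x].
  rewrite (_ : _ - _ = a * (f x - g x) + (f' x - g' x)); last by ring.
  move: (f x - g x) (f' x - g' x) => u v.
  by have := sqr_ge0 (a * u - v); nra.
have : 2 * a ^+ 2 * (e / (4 * (a ^+ 2 + 1))) <= e / 2.
  rewrite mulrA ler_pdivrMr//; have := sqr_ge0 a; nra.
have : 2 * a ^+ 2 * \int[P]_x (f x - g x) ^+ 2 <= 2 * a ^+ 2 * (e / (4 * (a ^+ 2 + 1))).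
  by rewrite ler_wpM2l// mulr_ge0 ?sqr_ge0.
move: fg'; lra.
Qed.

Lemma L2_closure_cvg H f : L2_closure H f -> exists2 g_ : nat -> T -> R,
  forall k, H (g_ k) & \int[P]_x (g_ k x - f x) ^+ 2 @[k --> \oo] --> 0.
Proof.
move=> [L2f Hf].
have pos (k : nat) : 0 < (harmonic k : R) by rewrite invr_gt0.
have [g_ Hg] := choice (fun k => Hf _ (pos k)).
exists g_; first by move=> k; case: (Hg k).
apply: (squeeze_cvgr _ (cvg_cst 0) (@cvg_harmonic R)).
apply: nearW => k; rewrite E_sqr_ge0/=; have [_] := Hg k; apply: le_trans.
rewrite le_eqVlt; apply/orP; left; apply/eqP.
by apply: eq_Rintegral => x _; rewrite -sqrrN opprB.
Qed.

(** Moment generating functions pass to the limit because the exponentials of a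
convergent sequence of Gaussian variables are bounded in [L2]. *)
Lemma L2_closure_gauss H : gauss_space P H -> gauss_space P (L2_closure H).
Proof.
move=> gH; have [lH H2 H1 He] := gH.
have key f : L2_closure H f -> L1 P (fun x => expR (f x)) /\
    \int[P]_x expR (f x) = expR ((\int[P]_x f x ^+ 2) / 2).
  move=> cf; have [L2f _] := cf; have [g Hg cg] := L2_closure_cvg cf.
  have L2g k : L2 P (g k) by exact: H2.
  have cg2 := L2_cvg_sqr L2g L2f cg; set v := \int[P]_x f x ^+ 2 in cg2 *.
  pose C := expR (2 * (v + 1)).
  have C0 : 0 < C by exact: expR_gt0.
  have [N HN] : exists N, forall k, (N <= k)%N -> \int[P]_x g k x ^+ 2 <= v + 1.
    move/cvgrPdist_le : cg2 => /(_ _ ltr01)[N _ HN]; exists N => k Nk.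
    by have := HN k Nk; rewrite /= ler_norml => /andP[+ _]; lra.
  have g2 k : (N <= k)%N -> L1 P (fun x => expR (2 * g k x)) /\
      \int[P]_x expR (2 * g k x) <= C.
    move=> Nk; have [i e] := gauss_mgf 2 gH (Hg k); split => //.
    by rewrite e ler_expR; have := HN k Nk; lra.
  have [if2 f2C] : L1 P (fun x => expR (2 * f x)) /\ \int[P]_x expR (2 * f x) <= C.
    apply: (fatou_cvgp (h := fun u => expR (2 * u)) _ _ (L2_cvgp L2g L2f cg)).
    - by move=> k; exact: L2_measurable (L2g k).
    - exact: L2_measurable L2f.
    - move=> u; apply: (cvg_comp (fun u => 2 * u) expR); last exact: continuous_expR.
      by apply: cvgM; [exact: cvg_cst|exact: cvg_id].
    - by move=> u; exact: expR_ge0.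
    - by exists N.
  have exp2 (u : R) : expR (2 * u) = expR u ^+ 2 by rewrite expRM_natl.
  have L2ef : L2 P (fun x => expR (f x)).
    split; first by apply: measurableT_comp => //; exact: L2_measurable L2f.
    by move: if2; under eq_fun do rewrite exp2.
  have L2eg k := gauss_exp_L2 gH (Hg k).
  split; first exact: L2_L1.
  have lim1 : \int[P]_x expR (g k x) @[k --> \oo] --> \int[P]_x expR (f x).
    have sdev : Num.sqrt (\int[P]_x (g k x - f x) ^+ 2) @[k --> \oo] --> 0.
      have : Num.sqrt u @[u --> (0 : R)] --> (0 : R).
        by rewrite -[X in _ --> X]sqrtr0; exact: sqrt_continuous.
      exact: cvg_comp cg.
    apply/cvgrPdist_le => /= e e0.
    have D0 : 0 < Num.sqrt (4 * C) by rewrite sqrtr_gt0 mulr_gt0.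
    move/cvgrPdist_le : sdev => /(_ _ (divr_gt0 e0 D0))[M _ HM].
    exists (maxn N M) => // k /=; rewrite geq_max => /andP[Nk Mk].
    have := HM k Mk; rewrite /= sub0r normrN ger0_norm// ler_pdivlMr//.
    apply: le_trans.
    have L2s := L2D (L2eg k) L2ef; have L2d := L2B (L2g k) L2f.
    have L2da : L2 P (fun x => `|g k x - f x|).
      split; first by apply: measurableT_comp => //; exact: L2_measurable L2d.
      by under eq_fun do rewrite real_normK ?num_real//; case: L2d.
    rewrite distrC -EB; [|exact: L2_L1|exact: L2_L1].
    apply: le_trans (E_abs (L1B (L2_L1 (L2eg k)) (L2_L1 L2ef))) _.
    apply: (@le_trans _ _ (\int[P]_x (`|g k x - f x| * (expR (g k x) + expR (f x))))).
      apply: E_le; [|exact: L1M|by move=> x; exact: expR_Lipschitz].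
      by apply: L1_abs; apply: L1B; exact: L2_L1.
    apply: le_trans (ler_norm _) _.
    apply: le_trans (cauchy_schwarz_sqrt L2da L2s) _.
    under eq_Rintegral do rewrite real_normK ?num_real//.
    rewrite ler_wpM2l// ler_sqrt ?mulr_ge0 ?(ltW C0)//.
    have [ig2 g2C] := g2 k Nk.
    apply: (@le_trans _ _ (2 * (\int[P]_x expR (2 * g k x) + \int[P]_x expR (2 * f x)))).
      rewrite -ED// -EZ; last exact: L1D.
      apply: E_le; [by case: L2s|by apply: L1Z; exact: L1D|move=> x].
      by rewrite !exp2; have := sqr_ge0 (expR (g k x) - expR (f x)); nra.
    by move: g2C f2C; lra.
  have : \int[P]_x expR (g k x) @[k --> \oo] --> expR (v / 2).
    rewrite (_ : (fun k => _) = expR \o (fun k => (\int[P]_x g k x ^+ 2) / 2)).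
      apply: (cvg_comp _ expR); last exact: continuous_expR.
      by apply: cvgM; [exact: cg2|exact: cvg_cst].
    by apply/funext => k; exact: He.
  exact: cvg_unique lim1.
split.
- exact: L2_closure_lin.
- by move=> f [].
- by move=> f /key[].
- by move=> f /key[].
Qed.

(** Among jointly Gaussian variables, convergence in probability implies
convergence in mean square: by anticoncentration, a difference that is small
with high probability has a small variance. *)
Lemma gauss_cvgp_L2 H (f_ : nat -> T -> R) S : gauss_space P H ->
  (forall k, H (f_ k)) -> measurable_fun [set: T] S -> cvg_in_probability P f_ S ->
  L2 P S /\ \int[P]_x (f_ k x - S x) ^+ 2 @[k --> \oo] --> 0.
Proof.
move=> gH Hf mS; have [lH H2 H1 He] := gH.
have mf k : measurable_fun [set: T] (f_ k) by exact: L2_measurable (H2 _ (Hf k)).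
move=> /(cvgpP P mf mS) cf.
pose p0 : R := (4 * kurtosis_bound R)^-1.
have p00 : 0 < p0 by rewrite invr_gt0 mulr_gt0 ?kurtosis_bound_gt0.
have key (e : R) : 0 < e -> exists N, forall k, (N <= k)%N ->
    L1 P (fun x => (f_ k x - S x) ^+ 2) /\ \int[P]_x (f_ k x - S x) ^+ 2 <= e.
  move=> e0; pose h := Num.sqrt (e / 8).
  have h0 : 0 < h by rewrite sqrtr_gt0 divr_gt0.
  have h2 : h ^+ 2 = e / 8 by rewrite sqr_sqrtr// divr_ge0// ltW.
  have p04 : 0 < p0 / 4 by rewrite divr_gt0.
  have [N HN] := cf h _ h0 p04; exists N => k Nk.
  have Hkl l : (N <= l)%N -> L1 P (fun x => (f_ l x - f_ k x) ^+ 2) /\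
      \int[P]_x (f_ l x - f_ k x) ^+ 2 <= e.
    move=> Nl; have Hd := lin_closedB lH (Hf l) (Hf k); have [md id] := H2 _ Hd.
    split => //; rewrite leNgt; apply/negP => ev.
    have := gauss_anticoncentration gH Hd; rewrite leNgt => /negP; apply.
    apply: (@le_lt_trans _ _ (p0 / 4 + p0 / 4)); last by rewrite -/p0; lra.
    apply: le_trans (lerD (HN l Nl) (HN k Nk)).
    apply: fineP_leU; [|exact: measurable_dev|exact: measurable_dev|].
      by apply: measurable_ge; exact: measurable_funX.
    move=> x /= vx; apply/orP; rewrite -[_ || _]negbK negb_or -!ltNge.
    apply/negP => /andP[]; rewrite !ltr_norml => /andP[? ?] /andP[? ?].
    have : (f_ l x - f_ k x) ^+ 2 < 4 * h ^+ 2 by nra.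
    by rewrite h2; move: vx ev; lra.
  have := @fatou_cvgp _ T R P (fun l x => f_ l x - f_ k x) (fun x => S x - f_ k x)
    (fun u => u ^+ 2) e.
  case=> //.
  - by move=> l; exact: measurable_funB.
  - exact: measurable_funB.
  - apply/cvgpP; [by move=> l; exact: measurable_funB|exact: measurable_funB|].
    move=> e' r e'0 r0; have [M HM] := cf e' r e'0 r0; exists M => l Ml.
    apply: le_trans (HM l Ml); rewrite le_eqVlt; apply/orP; left; apply/eqP.
    by congr (fine (P _)); apply/funext => x /=; rewrite opprB addrA subrK.
  - exact: exprn_continuous.
  - by move=> u; exact: sqr_ge0.
  - by exists N.
  have e2 x : (S x - f_ k x) ^+ 2 = (f_ k x - S x) ^+ 2 by ring.
  by rewrite /= (funext e2).
have [N1 HN1] := key 1 ltr01.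
have L2S : L2 P S.
  have [iN _] := HN1 N1 (leqnn _).
  have L2d : L2 P (fun x => f_ N1 x - S x) by split => //; exact: measurable_funB.
  have := L2B (H2 _ (Hf N1)) L2d; congr (L2 P); apply/funext => x; ring.
split => //; apply/cvgrPdist_le => e e0; have [N HN] := key _ e0.
exists N => // k Nk; rewrite /= sub0r normrN ger0_norm ?E_sqr_ge0//.
by have [] := HN k Nk.
Qed.

End gaussian_closure.

(** * Integrals of the paths of square-integrable fields *)

Section path_integrals.
Context d1 d (T1 : measurableType d1) (T : measurableType d) (R : realType).
Context (mu : {sigma_finite_measure set T1 -> \bar R}) (P : probability T R).
Context (F : T1 -> T -> R).
Hypothesis mF : measurable_fun [set: T1 * T] (fun p => F p.1 p.2).
Hypothesis L2F : forall x, L2 P (F x).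

Definition sdev (x : T1) : R := Num.sqrt (\int[P]_w F x w ^+ 2).

Definition path_integral (w : T) : R := \int[mu]_x F x w.

Let I := path_integral.

Lemma measurable_sdev : measurable_fun [set: T1] sdev.
Proof.
apply: (measurableT_comp (f := @Num.sqrt R)).
  by apply: continuous_measurable_fun; exact: sqrt_continuous.
apply: (@measurable_Rintegral1 _ _ T1 T R P (fun p => F p.1 p.2 ^+ 2)).
exact: measurable_funX.
Qed.

Lemma measurable_path_integral : measurable_fun [set: T] I.
Proof. exact: (@measurable_Rintegral2 _ _ T1 T R mu (fun p => F p.1 p.2)). Qed.

Hypothesis iF : L1 mu sdev.

Let Z := \int[mu]_x sdev x.

Let Enorm (f : T -> R) : \int[P]_w `|f w| ^+ 2 = \int[P]_w f w ^+ 2.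
Proof. by apply: eq_Rintegral => w _; rewrite real_normK ?num_real. Qed.

Let sdev_ge0 x : 0 <= sdev x. Proof. exact: sqrtr_ge0. Qed.

Let Z_ge0 : 0 <= Z. Proof. exact: E_ge0. Qed.

Let weighted (W : T -> R) (p : T1 * T) := F p.1 p.2 * W p.2.

Let measurable_weighted W : L2 P W -> measurable_fun [set: T1 * T] (weighted W).
Proof.
move=> L2W; apply: measurable_funM => //.
exact: (measurableT_comp (L2_measurable L2W) measurable_snd).
Qed.

Let integrable_weighted W : L2 P W ->
  (mu \x P)%E.-integrable [set: T1 * T] (EFin \o weighted W).
Proof.
move=> L2W; have mG := measurable_weighted L2W; set G := weighted W in mG *.
apply/integrable12ltyP; first exact/measurable_EFinP.
have L2aW : L2 P (fun w => `|W w|).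
  split; first by apply: measurableT_comp => //; exact: L2_measurable L2W.
  by under eq_fun do rewrite real_normK ?num_real//; case: L2W.
have iB : L1 mu (fun x => Num.sqrt (\int[P]_w W w ^+ 2) * sdev x) by exact: L1Z.
apply: le_lt_trans (_ : (\int[mu]_x (Num.sqrt (\int[P]_w W w ^+ 2) * sdev x)%:E < +oo)%E);
  last by rewrite (EFinE iB) ltry.
apply: ge0_le_integral => //.
- by move=> x _; exact: integral_ge0.
- apply: (measurable_fun_fubini_tonelli_F (m2 := P) (abse \o (EFin \o G))).
    by apply: measurableT_comp => //; exact/measurable_EFinP.
  by move=> p; exact: abse_ge0.
- exact: (measurable_int _ iB).
move=> x _; have L2aF : L2 P (fun w => `|F x w|).
  split; first by apply: measurableT_comp => //; exact: L2_measurable (L2F x).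
  by under eq_fun do rewrite real_normK ?num_real//; case: (L2F x).
rewrite /G/=; under eq_integral do rewrite normrM.
rewrite (EFinE (L1M L2aF L2aW)) lee_fin; apply: le_trans (ler_norm _) _.
apply: le_trans (cauchy_schwarz_sqrt L2aF L2aW) _; rewrite mulrC.
by rewrite !Enorm.
Qed.

Lemma ae_path_integrable : {ae P, forall w, L1 mu (F ^~ w)}.
Proof.
apply: filterS (ae_integrable2 (integrable_weighted (L2_cst P 1))) => w.
by apply: eq_integrable => // x _; rewrite /= /weighted/= mulr1.
Qed.

Section against_weight.
Context (W : T -> R).
Hypothesis L2W : L2 P W.
Let mG := measurable_weighted L2W.
Let iG := integrable_weighted L2W.

Lemma L1_ip_path : L1 mu (fun x => \int[P]_w (F x w * W w)).
Proof. exact: (L1_Rintegral1 mG iG). Qed.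

Lemma ae_path_weight :
  {ae P, forall w, \int[mu]_x (F x w * W w) = I w * W w}.
Proof.
apply: filterS ae_path_integrable => w iw.
by under eq_Rintegral do rewrite mulrC; rewrite EZ// mulrC.
Qed.

Lemma ip_path_integral :
  \int[P]_w (I w * W w) = \int[mu]_x \int[P]_w (F x w * W w).
Proof.
rewrite (Rintegral_fubini mG iG) /weighted/=; congr fine; apply: ae_eq_integral => //.
- apply/measurable_EFinP; apply: measurable_funM.
    exact: measurable_path_integral.
  exact: L2_measurable L2W.
- by apply/measurable_EFinP; exact: (@measurable_Rintegral2 _ _ T1 T R mu (weighted W)).
- by apply: filterS ae_path_weight => w e _; rewrite e.
Qed.

(** Minkowski's integral inequality, in its dual form. *)
Lemma ip_path_integral_le : `|\int[P]_w (I w * W w)| <=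
  Z * Num.sqrt (\int[P]_w W w ^+ 2).
Proof.
rewrite ip_path_integral mulrC -EZ//; apply: le_trans (E_abs L1_ip_path) _.
apply: E_le; [exact: L1_abs L1_ip_path|exact: L1Z|move=> x].
by rewrite mulrC; exact: cauchy_schwarz_sqrt.
Qed.

End against_weight.

(** Testing against the truncations of the path integral itself bounds its
second moment. *)
Lemma L2_path_integral : L2 P I.
Proof.
have mI := measurable_path_integral.
pose E (k : nat) := [set w | `|I w| <= k%:R].
have mE k : measurable (E k).
  rewrite (_ : E k = (fun w => k%:R - `|I w|) @^-1` `[0, +oo[).
    rewrite -[X in measurable X]setTI.
    have : measurable_fun [set: T] (fun w => k%:R - `|I w|).
      by apply: measurable_funB => //; exact: measurableT_comp.
    by apply.
  by apply/seteqP; split => w /=; rewrite in_itv/= andbT subr_ge0.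
pose V k w := I w * \1_(E k) w.
have L2V k : L2 P (V k).
  have mV : measurable_fun [set: T] (V k).
    by apply: measurable_funM => //; exact: measurable_indic.
  split => //.
  apply: (L1_le _ (finite_measure_integrable_cst P (k%:R ^+ 2) measurableT)).
    exact: measurable_funX.
  move=> w; rewrite /= /V indicE; case: (boolP (w \in E k)) => [|_].
    rewrite inE /E/= mulr1 normrX => h; rewrite ler_sqr ?nnegrE//.
  by rewrite mulr0 expr0n normr0 exprn_ge0.
have V2 k : \int[P]_w V k w ^+ 2 <= Z ^+ 2.
  have := ip_path_integral_le (L2V k).
  rewrite (_ : \int[P]_w (I w * V k w) = \int[P]_w V k w ^+ 2); last first.
    apply: eq_Rintegral => w _; rewrite /V indicE.
    by case: (_ \in _); rewrite ?mulr1 ?mulr0 ?expr2 ?mulr0.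
  set a := \int[P]_w _; have a0 : 0 <= a by exact: E_sqr_ge0.
  rewrite ger0_norm// -{1}(sqr_sqrtr a0) => h.
  rewrite -(sqr_sqrtr a0) lerXn2r ?nnegrE//.
  have := sqrtr_ge0 a; rewrite le_eqVlt => /predU1P[<-//|s0].
  by move: h; rewrite expr2 ler_pM2r.
have [||||||i2 _] := @fatou_le _ _ _ P (fun k w => V k w ^+ 2) (fun w => I w ^+ 2) (Z ^+ 2).
- by move=> k; case: (L2V k).
- by move=> k w; exact: sqr_ge0.
- exact: V2.
- exact: measurable_funX.
- apply: aeW => w; apply: cvg_near_cst; exists (Num.truncn `|I w|).+1 => // k /= Ik.
  rewrite /V indicE mem_set ?mulr1// /E/=.
  by apply/ltW; apply: lt_le_trans (truncnS_gt _) _; rewrite ler_nat.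
- by move=> w; exact: sqr_ge0.
by split.
Qed.

(** The path integral lies in the closure of any linear space containing the
[F x]: the residue [r] of a nearly optimal approximation is nearly orthogonal to
this space, hence to all the [F x], and hence, exchanging integrals, to the path
integral. *)
Lemma path_integral_closure (H : set (T -> R)) : lin_closed H -> H (cst 0) ->
  (forall f, H f -> L2 P f) -> (forall x, H (F x)) -> L2_closure P H I.
Proof.
move=> lH H0 H2 HF; have L2I := L2_path_integral; split => //.
pose E := [set a : R | exists2 g, H g & a = \int[P]_w (I w - g w) ^+ 2].
have E0 : E !=set0 by exists (\int[P]_w (I w - cst 0 w) ^+ 2); exists (cst 0).
have lbE : has_lbound E by exists 0 => _ [g Hg ->]; exact: E_sqr_ge0.
have infE : has_inf E by split.
set e := inf E.
have e_ge0 : 0 <= e by apply: lb_le_inf => // _ [g Hg ->]; exact: E_sqr_ge0.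
set v := \int[P]_w I w ^+ 2.
pose C := Z + Num.sqrt (2 * v + 2 * (e + 1)) + 1.
have C0 : 0 < C by rewrite ltr_wpDl// addr_ge0.
have key (h : R) : 0 < h -> h <= 1 -> e <= h * C.
  move=> h0 h1; have hh0 : 0 < h ^+ 2 by rewrite exprn_gt0.
  have [_ [g Hg ->]] := inf_adherent hh0 infE; rewrite -/e => ge.
  have L2g := H2 _ Hg; have L2r := L2B L2I L2g.
  pose r w := I w - g w; pose a := \int[P]_w r w ^+ 2.
  have ea : e <= a by apply: ge_inf => //; exists g.
  have orth Y : H Y -> `|\int[P]_w (Y w * r w)| <= h * Num.sqrt (\int[P]_w Y w ^+ 2).
    move=> HY; have L2Y := H2 _ HY.
    have : (\int[P]_w (Y w * r w)) ^+ 2 <= (\int[P]_w Y w ^+ 2) * h ^+ 2.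
      apply: quadratic_discr; [exact: E_sqr_ge0|exact: ltW|move=> t].
      have : e <= \int[P]_w (I w - (t * Y w + g w)) ^+ 2.
        by apply: ge_inf => //; exists (fun w => t * Y w + g w) => //; exact: lH.
      rewrite (_ : \int[P]_w _ = \int[P]_w (- t * Y w + r w) ^+ 2); last first.
        by apply: eq_Rintegral => w _; rewrite /r; ring.
      rewrite E_lin_sqr// -/a; move: ge; rewrite -/a sqrrN; lra.
    move=> /ler_wsqrtr; rewrite sqrtr_sqr.
    by rewrite sqrtrM ?E_sqr_ge0// sqrtr_sqr (ger0_norm (ltW h0)) mulrC.
  have oI : \int[P]_w (I w * r w) <= h * Z.
    rewrite (ip_path_integral L2r) -EZ//.
    apply: le_trans (ler_norm _) _; apply: le_trans (E_abs (L1_ip_path L2r)) _.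
    apply: E_le; [exact: L1_abs (L1_ip_path L2r)|exact: L1Z|move=> x].
    exact: orth (HF x).
  have og : - (\int[P]_w (g w * r w)) <= h * Num.sqrt (2 * v + 2 * (e + 1)).
    apply: le_trans (ler_norm _) _; rewrite normrN; apply: le_trans (orth _ Hg) _.
    rewrite ler_wpM2l ?(ltW h0)// ler_sqrt; last first.
      by rewrite !addr_ge0// ?mulr_ge0// ?addr_ge0//; exact: E_sqr_ge0.
    apply: (@le_trans _ _ (2 * v + 2 * a)).
      have [_ ir] := L2r; have [_ iI] := L2I.
      rewrite /v /a -!EZ// -ED; [|exact: L1Z|exact: L1Z].
      apply: E_le; [by case: L2g|by apply: L1D; exact: L1Z|move=> w].
      by rewrite /r; have := sqr_ge0 (2 * I w - g w); nra.
    rewrite lerD2l ler_wpM2l//; apply: le_trans (ltW ge) _.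
    by rewrite lerD2l exprn_ile1// ltW.
  have ar : a = \int[P]_w (I w * r w) - \int[P]_w (g w * r w).
    rewrite -EB; [|exact: L1M|exact: L1M].
    by apply: eq_Rintegral => w _; rewrite /r; ring.
  apply: le_trans ea _; rewrite ar /C; move: oI og h0.
  set s := Num.sqrt _; lra.
have e0 : e = 0.
  apply/eqP/negPn/negP => e_neq0; have e_gt0 : 0 < e by rewrite lt_def e_neq0.
  pose h := Num.min 1 (e / (2 * C)).
  have h0 : 0 < h by rewrite lt_min ltr01/= divr_gt0// mulr_gt0.
  have := key h h0; rewrite ge_min lexx => /(_ isT); apply/negP; rewrite -ltNge.
  apply: (@le_lt_trans _ _ (e / (2 * C) * C)).
    by rewrite ler_wpM2r ?(ltW C0)// ge_min lexx orbT.
  rewrite (_ : e / (2 * C) * C = e / 2); first lra.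
  by field; rewrite gt_eqF.
move=> c c0; have [_ [g Hg ->]] := inf_adherent c0 infE.
by rewrite -/e e0 add0r => /ltW gc; exists g.
Qed.

End path_integrals.

(** * Integrals of the paths of Gaussian fields *)

Section gaussian_path_integrals.
Context d1 d (T1 : measurableType d1) (T : measurableType d) (R : realType).
Context (mu : {sigma_finite_measure set T1 -> \bar R}) (P : probability T R).
Context (H : set (T -> R)) (F : T1 -> T -> R).
Hypothesis gH : gauss_space P H.
Hypothesis mF : measurable_fun [set: T1 * T] (fun p => F p.1 p.2).
Hypothesis HF : forall x, H (F x).
Hypothesis ae_iF : {ae P, forall w, L1 mu (F ^~ w)}.

Let L2F x : L2 P (F x). Proof. by have [_ H2 _ _] := gH; exact: H2. Qed.

(** If almost all paths are integrable, then so is the standard deviation: on an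
event [E] of probability close to one, where the integral of the absolute
values of the path is bounded, the mean of [`|F x|] over [E] is still comparable to the
standard deviation, by anticoncentration. *)
Lemma gauss_sdev_integrable : L1 mu (sdev P F).
Proof.
have maF : measurable_fun [set: T1 * T] (fun p => `|F p.1 p.2|).
  exact: measurableT_comp.
pose N w : R := \int[mu]_x `|F x w|.
have mN : measurable_fun [set: T] N.
  exact: (@measurable_Rintegral2 _ _ T1 T R mu (fun p => `|F p.1 p.2|)).
have N_ge0 w : 0 <= N w by exact: E_ge0.
pose B (n : nat) := [set w | n%:R <= N w].
have mB n : measurable (B n) by exact: measurable_ge.
pose p0 : R := (4 * kurtosis_bound R)^-1.
have p0_gt0 : 0 < p0 by rewrite invr_gt0 mulr_gt0 ?kurtosis_bound_gt0.
have [n Bn] : exists n, fine (P (B n)) <= p0 / 2.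
  have : \int[P]_w \1_(B n) w @[n --> \oo] --> \int[P]_w (cst 0 w : R).
    apply: (dominated_cvg_Rintegral _ _ _ (finite_measure_integrable_cst P 1 measurableT)).
    - by move=> n; exact: measurable_indic.
    - exact: measurable_cst.
    - move=> w; apply: cvg_near_cst; exists (Num.truncn (N w)).+1 => // n /= Nn.
      rewrite indicE memNset// /B/=; apply/negP; rewrite -ltNge.
      by apply: lt_le_trans (truncnS_gt _) _; rewrite ler_nat.
    - move=> n w /=; rewrite indicE.
      by case: (_ \in _); rewrite ?normr1 ?normr0.
  rewrite E_cst => /cvgrPdist_le/(_ _ (divr_gt0 p0_gt0 (ltr0Sn R 1)))[M _ HM].
  exists M; have := HM M (leqnn M); rewrite /= sub0r normrN Rintegral_indic//.
  exact: le_trans (ler_norm _).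
pose E := ~` B n; have mE : measurable E by exact: measurableC.
pose G (p : T1 * T) := `|F p.1 p.2| * \1_E p.2.
have G_ge0 p : 0 <= G p by rewrite mulr_ge0// indicE ler0n.
have mG : measurable_fun [set: T1 * T] (EFin \o G).
  apply/measurable_EFinP; apply: measurable_funM => //.
  apply: (measurableT_comp (f := \1_E : T -> R) _ measurable_snd).
  exact: measurable_indic.
have L1a x : L1 P (fun w => `|F x w|) by exact: L1_abs (L2_L1 (L2F x)).
have indic01 (C : set T) w : 0 <= (\1_C w : R) <= 1.
  by rewrite indicE; case: (_ \in _) => /=; rewrite ler01 lexx.
have iG x : L1 P (fun w => G (x, w)).
  apply: (L1_le _ (L1a x)) => [|w].
    apply: measurable_funM; last exact: measurable_indic.
    exact: L1_measurable (L1a x).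
  rewrite normrM normr_id ler_piMr//.
  by have /andP[? ?] := indic01 E w; rewrite ger0_norm.
have G_lb x : p0 / 4 * sdev P F x <= \int[P]_w G (x, w).
  set s := sdev P F x; have s0 : 0 <= s by exact: sqrtr_ge0.
  have := gauss_anticoncentration gH (HF x).
  set v := \int[P]_w _; set A := [set w | _].
  have mA : measurable A.
    by apply: measurable_ge; apply: measurable_funX; exact: L2_measurable (L2F x).
  have s2 : s ^+ 2 = v by rewrite sqr_sqrtr// E_sqr_ge0.
  rewrite -/p0 => pA.
  have iA : L1 P (\1_A) by exact: integrable_indic.
  have iB : L1 P (\1_(B n)) by exact: integrable_indic.
  apply: (@le_trans _ _ (\int[P]_w (s / 2 * (\1_A w - \1_(B n) w)))).
    rewrite EZ; last exact: L1B.
    rewrite EB// !Rintegral_indic//; move: pA Bn; nra.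
  apply: E_le => //; first by apply: L1Z; exact: L1B.
  move=> w; rewrite /G/= (indicE _ E) /E in_setC.
  have /andP[A0 A1] := indic01 A w; have /andP[B0 B1] := indic01 (B n) w.
  move: A0 A1 B0 B1; rewrite (indicE _ (B n)) => A0 A1.
  case: (w \in B n) => /= _ _.
    by rewrite mulr0; nra.
  rewrite subr0 mulr1 indicE; case: (boolP (w \in A)) => [|_].
    rewrite inE /A/= -s2 -(real_normK (num_real (F x w))) mulr1 => h.
    rewrite -(@ler_pXn2r _ 2) ?nnegrE ?divr_ge0//; apply: le_trans h.
    by rewrite exprMn exprVn; have := sqr_ge0 s; lra.
  by rewrite mulr0.
have c0 : 0 < p0 / 4 by rewrite divr_gt0.
have fubini : (\int[mu]_x \int[P]_w (G (x, w))%:E <= n%:R%:E)%E.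
  rewrite (@fubini_tonelli _ _ _ _ _ mu P _ mG); last by move=> p; rewrite lee_fin.
  apply: (@le_trans _ _ (\int[P]_w (n%:R)%:E)%E); last first.
    rewrite (EFinE (finite_measure_integrable_cst P n%:R measurableT)).
    by rewrite E_cst.
  apply: ae_ge0_le_integral => //.
  - by move=> w _; apply: integral_ge0 => x _; rewrite lee_fin.
  - apply: (measurable_fun_fubini_tonelli_G (m1 := mu) (EFin \o G) mG) => p.
    by rewrite lee_fin.
  apply: filterS ae_iF => w iw _; rewrite /G/=.
  under eq_integral do rewrite mulrC.
  rewrite (EFinE (L1Z _ (L1_abs iw))) EZ ?L1_abs// lee_fin -/(N w).
  rewrite indicE /E in_setC; case: (boolP (w \in B n)) => /=.
    by rewrite mul0r.
  by rewrite notin_setE /B/= => /negP; rewrite -ltNge mul1r => /ltW.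
have i1 : L1 mu (fun x => \int[P]_w G (x, w)).
  apply/integrableP; split.
    apply/measurable_EFinP; apply: (@measurable_Rintegral1 _ _ T1 T R P G).
    exact/measurable_EFinP.
  apply: le_lt_trans (ltry n%:R); apply: le_trans fubini.
  rewrite le_eqVlt; apply/orP; left; apply/eqP; apply: eq_integral => x _.
  by rewrite EFinE//= ger0_norm// E_ge0.
apply: (L1_le _ (L1Z (p0 / 4)^-1 i1)) => [|x]; first exact: measurable_sdev.
by rewrite ger0_norm ?sqrtr_ge0// ler_pdivlMl.
Qed.

End gaussian_path_integrals.

(** * Gaussian fields on subsets of the Euclidean space *)

Section field_span.
Context (R : realType) (n : nat) d (T : measurableType d) (P : probability T R).
Context (D : set 'rV[R]_n) (X : 'rV[R]_n -> T -> R).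

Definition field_span : set (T -> R) := [set f | exists (k : nat)
  (x : 'I_k -> 'rV[R]_n) (c : 'I_k -> R), (forall i, D (x i)) /\
  f = fun w => \sum_(i < k) c i * X (x i) w].

Lemma field_span0 : field_span (cst 0).
Proof.
exists 0%N, (fun=> 0), (fun=> 0); split; first by case.
by apply/funext => w; rewrite big_ord0.
Qed.

Lemma mem_field_span x : D x -> field_span (X x).
Proof.
move=> Dx; exists 1%N, (fun=> x), (fun=> 1); split => //.
by apply/funext => w; rewrite big_ord1 mul1r.
Qed.

Lemma field_span_lin : lin_closed field_span.
Proof.
move=> a _ _ [k [x [c [Dx ->]]]] [k' [x' [c' [Dx' ->]]]].
exists (k + k')%N, (fun i => match fintype.split i with inl j => x j | inr j => x' j end),
  (fun i => match fintype.split i with inl j => a * c j | inr j => c' j end); split.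
  by move=> i; case: fintype.split.
apply/funext => w; rewrite big_split_ord/= mulr_sumr; congr +%R.
  apply: eq_bigr => i _.
  by rewrite -[lshift k' i]/(unsplit (inl i)) unsplitK mulrA.
by apply: eq_bigr => i _; rewrite -[rshift k i]/(unsplit (inr i)) unsplitK.
Qed.

Hypothesis gX : gaussian_field P D X.
Hypothesis cX : forall x, D x -> ('E_P[X x] = 0)%E.

Lemma field_span_gauss : gauss_space P field_span.
Proof.
have gD x : D x -> gaussian_rv P (X x).
  move=> Dx; have := @gX 1%N (fun=> x) (fun=> 1) (fun=> Dx).
  by under eq_fun do rewrite big_ord1 mul1r.
have L1X x : D x -> L1 P (X x).
  by move=> Dx; have [L2X _ _] := centred_gaussian_rv (gD _ Dx) (cX Dx); exact: L2_L1.
have EX x : D x -> \int[P]_w X x w = 0.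
  by move=> Dx; have := cX Dx; rewrite unlock /Rintegral => ->.
have key f : field_span f -> [/\ L2 P f, L1 P (fun w => expR (f w)) &
    \int[P]_w expR (f w) = expR ((\int[P]_w f w ^+ 2) / 2)].
  move=> [k [x [c [Dx ->]]]]; apply: centred_gaussian_rv; first exact: gX.
  have : L1 P (fun w => \sum_(i < k) c i * X (x i) w) /\
      \int[P]_w (\sum_(i < k) c i * X (x i) w) = 0.
    elim: k x c Dx => [|k ih] x c Dx.
      split; first by under eq_fun do rewrite big_ord0; exact: L2_L1 (L2_cst P 0).
      by under eq_Rintegral do rewrite big_ord0; exact: E_cst.
    have [i1 e1] := ih (fun i => x (lift ord0 i)) (fun i => c (lift ord0 i)) (fun i => Dx _).
    have i0 : L1 P (fun w => c ord0 * X (x ord0) w) by apply: L1Z; exact: L1X.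
    split; first by under eq_fun do rewrite big_ord_recl; exact: L1D.
    under eq_Rintegral do rewrite big_ord_recl.
    by rewrite ED// e1 addr0 EZ ?EX ?mulr0//; exact: L1X.
  by move=> [i e]; rewrite unlock (EFinE i) e.
split; first exact: field_span_lin.
- by move=> f /key[].
- by move=> f /key[].
- by move=> f /key[].
Qed.

End field_span.

Section weighted_field.
Context (R : realType) (n : nat) d (T : measurableType d) (P : probability T R).
Context (O : set 'rV[R]_n) (X : 'rV[R]_n -> T -> R) (phi : 'rV[R]_n -> R).
Context (H : set (T -> R)).
Local Notation mu := (lebesgue_rV R n).
Hypothesis mO : measurable O.
Hypothesis gH : gauss_space P H.
Hypothesis H0 : H (cst 0).
Hypothesis HX : forall x, O x -> H (X x).
Hypothesis mX : measurable_fun (O `*` [set: T])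
  (fun p : 'rV[R]_n * T => X p.1 p.2).
Hypothesis mphi : measurable_fun O phi.

Let H2 f : H f -> L2 P f. Proof. by move: f; case: gH. Qed.

Section one_set.
Context (A : set 'rV[R]_n).
Hypotheses (mA : measurable A) (AO : A `<=` O).
Hypothesis iA : {ae P, forall w, mu.-integrable A (EFin \o (fun x => X x w * phi x))}.

Let F x w : R := ((fun x => X x w * phi x) \_ A) x.

Let mF : measurable_fun [set: 'rV[R]_n * T] (fun p => F p.1 p.2).
Proof.
rewrite (_ : (fun p => _) = (fun p => X p.1 p.2 * phi p.1) \_ (A `*` setT)); last first.
  apply/funext => -[x w]; rewrite /F !patchE.
  have -> : ((x, w) \in A `*` [set: T]) = (x \in A) by rewrite in_setX in_setT andbT.
  by [].
apply/(measurable_restrictT _ _).1; first exact: measurableX.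
apply: measurable_funM.
  by apply: measurable_funS mX; [exact: measurableX|move=> p [/AO]].
have mphiA : measurable_fun A phi by exact: measurable_funS mphi.
apply: (measurable_comp mA _ mphiA); last exact: measurable_funTS measurable_fst.
by move=> _ [p [Ap _] <-].
Qed.

Let HF x : H (F x).
Proof.
rewrite (_ : F x = fun w => (phi \_ A) x * X x w) /F; last first.
  by apply/funext => w; rewrite !patchE; case: ifPn => _; rewrite ?mul0r// mulrC.
have [lH _ _ _] := gH; rewrite patchE; case: ifPn => [|_].
  by rewrite inE => Ax; apply: lin_closedZ => //; exact/HX/AO.
by move: H0; congr H; apply/funext => w; rewrite mul0r.
Qed.

Let iF : L1 mu (sdev P F).
Proof.
apply: (gauss_sdev_integrable gH) => //; apply: filterS iA => w.
by rewrite integrable_mkcond// restrict_EFin.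
Qed.

Let L2F x : L2 P (F x). Proof. exact: H2. Qed.

Definition weighted_integral w : R := \int[mu]_(x in A) (X x w * phi x).

Let weighted_integralE : weighted_integral = path_integral mu F.
Proof. by apply/funext => w; rewrite /weighted_integral Rintegral_mkcond. Qed.

Lemma measurable_weighted_integral : measurable_fun [set: T] weighted_integral.
Proof. by rewrite weighted_integralE; exact: measurable_path_integral. Qed.

(** Almost sure integrability of the paths of a Gaussian field makes the standard
deviation integrable, and so brings the path integral into the mean square
closure, without any assumption on the second moments. *)
Lemma weighted_integral_closure : L2_closure P H weighted_integral.
Proof.
have [lH _ _ _] := gH; rewrite weighted_integralE.
exact: path_integral_closure.
Qed.

Let ipE W x : L2 P W -> \int[P]_w (F x w * W w) =
  ((fun x => (\int[P]_w (X x w * W w)) * phi x) \_ A) x.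
Proof.
move=> L2W; rewrite patchE; case: ifPn => xA.
  have Ax : A x by rewrite -inE.
  rewrite [RHS]mulrC -EZ; last by apply: L1M => //; exact/H2/HX/AO.
  by apply: eq_Rintegral => w _; rewrite /F patchE xA; ring.
rewrite -[RHS](E_cst P); apply: eq_Rintegral => w _.
by rewrite /F patchE (negbTE xA) mul0r.
Qed.

Lemma integrable_weighted_ip W : L2 P W ->
  mu.-integrable A (EFin \o (fun x => (\int[P]_w (X x w * W w)) * phi x)).
Proof.
move=> L2W; rewrite integrable_mkcond// restrict_EFin.
have := L1_ip_path mF L2F iF L2W; congr (integrable _ _ (EFin \o _)).
by apply/funext => x; exact: ipE.
Qed.

Lemma ip_weighted_integral W : L2 P W ->
  \int[P]_w (weighted_integral w * W w) =
  \int[mu]_(x in A) ((\int[P]_w (X x w * W w)) * phi x).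
Proof.
move=> L2W; rewrite weighted_integralE (ip_path_integral mF L2F iF L2W).
by rewrite [RHS]Rintegral_mkcond; apply: eq_Rintegral => x _; exact: ipE.
Qed.

End one_set.

End weighted_field.

(** * Stochastic integrals of Gaussian fields *)

Section convergence_tools.
Context d (T : measurableType d) (R : realType) (P : probability T R).
Implicit Types (Y : nat -> T -> R) (S : T -> R).

Lemma cvgp_ae Y Y' S : (forall k, measurable_fun [set: T] (Y k)) ->
  (forall k, measurable_fun [set: T] (Y' k)) -> measurable_fun [set: T] S ->
  (forall k, {ae P, forall w, Y k w = Y' k w}) ->
  cvg_in_probability P Y' S -> cvg_in_probability P Y S.
Proof.
move=> mY mY' mS YY' /(cvgpP P mY' mS) cY'; apply/cvgpP => // e r e0 r0.
have [N HN] := cY' e r e0 r0; exists N => k Nk; apply: le_trans (HN k Nk).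
have [B [mB B0 YB]] := YY' k.
have fB : fine (P B) = 0 by rewrite B0.
rewrite -[leRHS]addr0 -fB; apply: fineP_leU => //; try exact: measurable_dev.
move=> w /= ew; have [e'|ne] := pselect (Y k w = Y' k w).
  by left; rewrite /= -e'.
by right; exact: YB.
Qed.

Lemma cvgpD Y Y' S S' : (forall k, measurable_fun [set: T] (Y k)) ->
  (forall k, measurable_fun [set: T] (Y' k)) -> measurable_fun [set: T] S ->
  measurable_fun [set: T] S' ->
  cvg_in_probability P Y S -> cvg_in_probability P Y' S' ->
  cvg_in_probability P (fun k w => Y k w + Y' k w) (fun w => S w + S' w).
Proof.
move=> mY mY' mS mS' /(cvgpP P mY mS) cY /(cvgpP P mY' mS') cY'.
apply/cvgpP; [by move=> k; exact: measurable_funD|exact: measurable_funD|].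
move=> e r e0 r0; have e2 : 0 < e / 2 by rewrite divr_gt0.
have r2 : 0 < r / 2 by rewrite divr_gt0.
have [N HN] := cY _ _ e2 r2; have [N' HN'] := cY' _ _ e2 r2.
exists (maxn N N') => k; rewrite geq_max => /andP[Nk N'k].
rewrite [leRHS]splitr; apply: le_trans (lerD (HN k Nk) (HN' k N'k)).
apply: fineP_leU; [|exact: measurable_dev|exact: measurable_dev|].
  by apply: measurable_dev; exact: measurable_funD.
move=> w /= ew; apply/orP; rewrite -[_ || _]negbK negb_or -!ltNge; apply/negP.
move=> /andP[h1 h2]; move: ew; rewrite leNgt => /negP; apply.
rewrite opprD addrACA (le_lt_trans (ler_normD _ _))//; lra.
Qed.

(** Dominated convergence: the sets increase to [O] up to a null set. *)
Lemma exhaustion_cvg n (O : set 'rV[R]_n) (A : (set 'rV[R]_n)^nat)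
    (g : 'rV[R]_n -> R) : measurable O -> exhaustion O A ->
  (lebesgue_rV R n).-integrable O (EFin \o g) ->
  \int[lebesgue_rV R n]_(x in A k) g x @[k --> \oo] -->
  \int[lebesgue_rV R n]_(x in O) g x.
Proof.
move=> mO [mA ndA AO A0] ig; set mu := lebesgue_rV R n.
pose U := \bigcup_k A k.
have mU : measurable U by exact: bigcup_measurable.
have UO : U `<=` O by move=> x [k _ /AO].
have -> : \int[mu]_(x in O) g x = \int[mu]_(x in U) g x.
  rewrite /Rintegral (negligible_integral _ _ _ A0)//; last exact: measurableD.
  by rewrite setDD setIC (setIidl UO).
rewrite [X in _ --> X]Rintegral_mkcond; under eq_fun do rewrite Rintegral_mkcond.
have iO : L1 mu (g \_ O) by move: ig; rewrite integrable_mkcond// restrict_EFin.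
have mgA (B : set 'rV[R]_n) : measurable B -> B `<=` O -> measurable_fun setT (g \_ B).
  move=> mB BO; apply/(measurable_restrictT _ _).1 => //.
  apply: (measurable_funS mO BO); apply/measurable_EFinP; exact: (measurable_int _ ig).
apply: (dominated_cvg_Rintegral _ _ _ (L1_abs iO)).
- by move=> k; exact: mgA.
- exact: mgA.
- move=> x; apply: cvg_near_cst; rewrite /= !patchE.
  have [[k _ Akx]|nU] := pselect (U x).
    exists k => // j /= kj; rewrite patchE !mem_set//; first by exists k.
    elim: j kj => [|j ih]; first by rewrite leqn0 => /eqP <-.
    by rewrite leq_eqVlt ltnS => /predU1P[<-//|/ih/ndA].
  apply: nearW => k; rewrite patchE !memNset// => Akx; apply: nU; by exists k.
- move=> k x; rewrite !patchE; case: (boolP (x \in A k)) => [|_]; last by rewrite normr0.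
  by rewrite inE => /AO Ox; rewrite mem_set.
Qed.

End convergence_tools.

Section gaussian_stochastic_integral.
Context (R : realType) (n : nat) d (T : measurableType d) (P : probability T R).
Context (O : set 'rV[R]_n) (X : 'rV[R]_n -> T -> R) (phi : 'rV[R]_n -> R).
Context (H : set (T -> R)).
Local Notation mu := (lebesgue_rV R n).
Hypothesis mO : measurable O.
Hypothesis gH : gauss_space P H.
Hypothesis H0 : H (cst 0).
Hypothesis HX : forall x, O x -> H (X x).
Hypothesis mX : measurable_fun (O `*` [set: T])
  (fun p : 'rV[R]_n * T => X p.1 p.2).
Hypothesis mphi : measurable_fun O phi.
Context (S : T -> R).
Hypothesis mS : measurable_fun [set: T] S.
Hypothesis SI : stochastic_integral P O (fun x w => X x w * phi x) S.

Let I A := weighted_integral X phi A.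

(** A stochastic integral is defined by convergence in probability; as the
integrals over the sets of the exhaustion are jointly Gaussian, the convergence
holds in mean square. *)
Lemma stochastic_integral_L2 : exists A : (set 'rV[R]_n)^nat, [/\ exhaustion O A,
  (forall k, {ae P, forall w, mu.-integrable (A k) (EFin \o (fun x => X x w * phi x))}),
  L2 P S & \int[P]_w (I (A k) w - S w) ^+ 2 @[k --> \oo] --> 0].
Proof.
have [A [exA iA cA]] := SI; exists A; have [mA _ AO _] := exA.
have closI k : L2_closure P H (I (A k)).
  exact: (weighted_integral_closure mO gH H0 HX mX mphi (mA k) (AO k) (iA k)).
by have [? ?] := gauss_cvgp_L2 (L2_closure_gauss gH) closI mS cA.
Qed.

(** The integrals over the sets of the exhaustion lie in the closure of [H], and
[S] is a limit of such integrals.  Closing twice spares the proof that the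
closure is closed, and preserves Gaussian spaces just as well. *)
Lemma stochastic_integral_closure : L2_closure P (L2_closure P H) S.
Proof.
have [A [exA iA L2S cS]] := stochastic_integral_L2; have [mA _ AO _] := exA.
split => // e e0; move/cvgrPdist_le : cS => /(_ _ e0)[N _ HN].
exists (I (A N)); split; first
  exact: (weighted_integral_closure mO gH H0 HX mX mphi (mA N) (AO N) (iA N)).
have := HN N (leqnn N); rewrite /= sub0r normrN ger0_norm ?E_sqr_ge0//.
by apply: le_trans; rewrite le_eqVlt; apply/orP; left; apply/eqP;
  apply: eq_Rintegral => w _; ring.
Qed.

(** Expectations may be exchanged with the stochastic integral: by Fubini for
each set of the exhaustion, then on the left by convergence in mean square and on
the right by dominated convergence. *)
Lemma ip_stochastic_integral W (g : 'rV[R]_n -> R) : L2 P W ->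
  mu.-integrable O (EFin \o g) ->
  {ae mu, forall x, O x -> (\int[P]_w (X x w * W w)) * phi x = g x} ->
  \int[P]_w (S w * W w) = \int[mu]_(x in O) g x.
Proof.
move=> L2W ig eg; have [A [exA iA L2S cS]] := stochastic_integral_L2.
have [mA _ AO _] := exA.
have L2I k : L2 P (I (A k)).
  by have [] := weighted_integral_closure mO gH H0 HX mX mphi (mA k) (AO k) (iA k).
have lim1 := L2_cvg_ip L2I L2S cS L2W.
have lim2 := exhaustion_cvg mO exA ig.
suff e : (fun k => \int[P]_w (I (A k) w * W w)) = (fun k => \int[mu]_(x in A k) g x).
  by rewrite e in lim1; apply: (cvg_unique _ lim1 lim2); exact: Rhausdorff.
apply/funext => k; rewrite (ip_weighted_integral mO gH H0 HX mX mphi (mA k) (AO k) (iA k) L2W).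
congr fine; apply: ae_eq_integral => //.
- exact: measurable_int (integrable_weighted_ip mO gH H0 HX mX mphi (mA k) (AO k) (iA k) L2W).
- exact: measurable_funS (AO k) (measurable_int _ ig).
- by apply: filterS eg => x ex /AO Ox; rewrite ex.
Qed.

End gaussian_stochastic_integral.

(** * The perturbed field *)

Lemma cvgpZ d (T : measurableType d) (R : realType) (P : probability T R)
    (b_ : nat -> R) (b : R) (S : T -> R) : L2 P S -> b_ k @[k --> \oo] --> b ->
  cvg_in_probability P (fun k w => b_ k * S w) (fun w => b * S w).
Proof.
move=> L2S bb; apply: L2_cvgp => [k||]; [exact: L2Z|exact: L2Z|].
rewrite (_ : (fun k => _) = fun k => (b_ k - b) ^+ 2 * \int[P]_w S w ^+ 2); last first.
  apply/funext => k; have [_ i2] := L2S; rewrite -(EZ _ i2).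
  by apply: eq_Rintegral => w _; ring.
have bb0 : (b_ k - b) * (b_ k - b) @[k --> \oo] --> (b - b) * (b - b).
  by apply: cvgM; apply: cvgB => //; exact: cvg_cst.
rewrite subrr mulr0 in bb0.
rewrite -[X in _ --> X](mul0r (\int[P]_w S w ^+ 2)); exact: cvgMl.
Qed.

Lemma L2_eq0_ae d (T : measurableType d) (R : realType) (P : probability T R)
    (f : T -> R) : L2 P f -> \int[P]_w f w ^+ 2 = 0 -> {ae P, forall w, f w = 0}.
Proof.
move=> [mf i2] E0.
have m2 : measurable_fun [set: T] (fun w => (f w ^+ 2)%:E) by exact: (measurable_int _ i2).
have /(ae_eq_integral_abs P measurableT m2) : (\int[P]_w `|(f w ^+ 2)%:E| = 0)%E.
  under eq_integral => w _ do rewrite abse_EFin ger0_norm ?sqr_ge0//.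
  by rewrite (EFinE i2) E0.
by apply: filterS => w /(_ I) [/eqP]; rewrite sqrf_eq0 => /eqP.
Qed.

Section perturbation.
Context (R : realType) (n : nat) d (T : measurableType d) (P : probability T R).
Context (O : set 'rV[R]_n) (X : 'rV[R]_n -> T -> R) (phi : 'rV[R]_n -> R).
Context (H : set (T -> R)).
Local Notation mu := (lebesgue_rV R n).
Hypothesis mO : measurable O.
Hypothesis gH : gauss_space P H.
Hypothesis H0 : H (cst 0).
Hypothesis HX : forall x, closure O x -> H (X x).
Hypothesis mX : measurable_fun (O `*` [set: T])
  (fun p : 'rV[R]_n * T => X p.1 p.2).
Hypothesis mphi : measurable_fun O phi.
Local Notation G := (covariance_fun P X).
Local Notation psi := (integral_operator O G phi).
Local Notation D := (integral_operator_dom O G phi).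
Hypothesis hpsi : {ae mu, forall x, O x -> D x}.
Hypothesis hq : mu.-integrable O (fun x => (psi x * phi x)%:E).

Let HXO x : O x -> H (X x). Proof. by move=> Ox; apply/HX/subset_closure. Qed.

Let L2H f : H f -> L2 P f. Proof. by move: f; case: gH. Qed.

Let L2X x : closure O x -> L2 P (X x). Proof. by move=> /HX /L2H. Qed.

Let mpsiphi : measurable_fun O (fun x => psi x * phi x).
Proof. by apply/measurable_EFinP; exact: (measurable_int _ hq). Qed.

Lemma covariance_funE (Z : 'rV[R]_n -> T -> R) x y :
  covariance_fun P Z x y = \int[P]_w (Z x w * Z y w).
Proof. by rewrite /covariance_fun unlock. Qed.

Section one_version.
Context (S : T -> R).
Hypothesis mS : measurable_fun [set: T] S.
Hypothesis SI : stochastic_integral P O (fun x w => X x w * phi x) S.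

Lemma stochastic_integral_bi_closure : L2_closure P (L2_closure P H) S.
Proof. exact: (stochastic_integral_closure mO gH H0 HXO mX mphi mS SI). Qed.

Lemma L2_stochastic_integral : L2 P S.
Proof. by have [] := stochastic_integral_bi_closure. Qed.

(** The covariance operator enters here: exchanging the expectation with the
stochastic integral gives the integral defining [psi x], which converges
absolutely for [x] in [D]. *)
Lemma ip_stochastic_integral_field x : closure O x -> D x ->
  \int[P]_w (S w * X x w) = psi x.
Proof.
move=> cx Dx; rewrite (ip_stochastic_integral mO gH H0 HXO mX mphi mS SI (L2X cx) Dx)//.
apply: nearW => y _; rewrite covariance_funE; congr (_ * _).
by apply: eq_Rintegral => w _; rewrite mulrC.
Qed.

End one_version.

Section two_versions.
Context (S S' : T -> R).
Hypothesis mS : measurable_fun [set: T] S.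
Hypothesis SI : stochastic_integral P O (fun x w => X x w * phi x) S.
Hypothesis mS' : measurable_fun [set: T] S'.
Hypothesis SI' : stochastic_integral P O (fun x w => X x w * phi x) S'.

Let L2S := L2_stochastic_integral mS SI.

Lemma stochastic_integral_ip : \int[P]_w (S w * S' w) =
  \int[mu]_(x in O) (psi x * phi x).
Proof.
have L2S' := L2_stochastic_integral mS' SI'.
rewrite (ip_stochastic_integral mO gH H0 HXO mX mphi mS SI L2S' hq)//.
apply: filterS hpsi => x Dx Ox; congr (_ * _).
rewrite -(ip_stochastic_integral_field mS' SI' (subset_closure Ox) (Dx Ox)).
by apply: eq_Rintegral => w _; rewrite mulrC.
Qed.

End two_versions.

(** Two versions, even along different exhaustions, have the same second moments
and the same mixed moment, all equal to the integral of [psi * phi]; so the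
second moment of their difference is zero. *)
Lemma stochastic_integral_unique S S' :
  measurable_fun [set: T] S -> measurable_fun [set: T] S' ->
  stochastic_integral P O (fun x w => X x w * phi x) S ->
  stochastic_integral P O (fun x w => X x w * phi x) S' ->
  {ae P, forall w, S w = S' w}.
Proof.
move=> mS mS' SI SI'.
have L2S := L2_stochastic_integral mS SI.
have L2S' := L2_stochastic_integral mS' SI'.
have L2d : L2 P (fun w => S w - S' w) by exact: L2B.
suff E0 : \int[P]_w (S w - S' w) ^+ 2 = 0.
  by apply: filterS (L2_eq0_ae L2d E0) => w /subr0_eq.
under eq_Rintegral => w _ do rewrite addrC -mulN1r.
have sqr f : \int[P]_w f w ^+ 2 = \int[P]_w (f w * f w) by [].
rewrite E_lin_sqr// !sqr (stochastic_integral_ip mS' SI' mS SI).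
rewrite (stochastic_integral_ip mS' SI' mS' SI').
rewrite (stochastic_integral_ip mS SI mS SI); ring.
Qed.

Section perturbed.
Context (S : T -> R).
Hypothesis mS : measurable_fun [set: T] S.
Hypothesis SI : stochastic_integral P O (fun x w => X x w * phi x) S.
Let q := \int[mu]_(x in O) (psi x * phi x).
Hypothesis hpsi0 : exists x, [/\ O x, D x & psi x != 0].
Let Xhat := perturbed_field X psi S q^-1.

Let L2S : L2 P S. Proof. exact: L2_stochastic_integral mS SI. Qed.

Let ES2 : \int[P]_w (S w * S w) = q.
Proof. exact: stochastic_integral_ip. Qed.

(** By the Cauchy-Schwarz inequality, [psi x ^+ 2 <= q * 'E[X x ^+ 2]]. *)
Lemma perturbation_q_neq0 : q != 0.
Proof.
have [x [Ox Dx]] := hpsi0; apply: contraNneq => q0.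
have cx := subset_closure Ox.
have := cauchy_schwarz L2S (L2X cx).
rewrite (ip_stochastic_integral_field mS SI cx Dx).
under [X in _ <= X * _]eq_Rintegral do rewrite expr2.
rewrite ES2 q0 mul0r => h; rewrite -sqrf_eq0.
by apply/eqP/le_anti; rewrite h sqr_ge0.
Qed.

Lemma L2_perturbed x : closure O x -> L2 P (Xhat x).
Proof. by move=> cx; apply: L2B; [exact: L2X|exact: L2Z]. Qed.

(** The choice of the coefficient: the covariance of [alpha * psi x * S] with [S]
is [alpha * psi x * q], which is [psi x] exactly when [alpha] is [q^-1]. *)
Lemma ip_perturbed x : closure O x -> D x -> \int[P]_w (Xhat x w * S w) = 0.
Proof.
move=> cx Dx.
have -> : (fun w => Xhat x w * S w) = fun w => X x w * S w - (q^-1 * psi x) * (S w * S w).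
  by apply/funext => w; rewrite /Xhat /perturbed_field; ring.
have iSS : L1 P (fun w => S w * S w) by exact: L1M.
rewrite (EB (L1M (L2X cx) L2S) (L1Z _ iSS)) (EZ _ iSS).
have -> : (fun w => X x w * S w) = fun w => S w * X x w.
  by apply/funext => w; rewrite mulrC.
rewrite (ip_stochastic_integral_field mS SI cx Dx) ES2.
by rewrite mulrAC mulVf ?mul1r ?subrr// perturbation_q_neq0.
Qed.

Let XhatE x w : Xhat x w * phi x = X x w * phi x - (q^-1 * S w) * (psi x * phi x).
Proof. by rewrite /Xhat /perturbed_field; ring. Qed.

Section one_set.
Context (A : set 'rV[R]_n).
Hypotheses (mA : measurable A) (AO : A `<=` O).

Let ipsiA : mu.-integrable A (EFin \o (fun x => psi x * phi x)).
Proof. exact: integrableS hq. Qed.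

Lemma integrable_perturbed w :
  mu.-integrable A (EFin \o (fun x => Xhat x w * phi x)) <->
  mu.-integrable A (EFin \o (fun x => X x w * phi x)).
Proof.
have ipsiw : mu.-integrable A (EFin \o (fun x => (q^-1 * S w) * (psi x * phi x))).
  exact: (integrableZl mA (q^-1 * S w) ipsiA).
split => h.
  have := integrableD mA h ipsiw; congr (integrable _ _ _).
  by apply/funext => x /=; rewrite -EFinD XhatE subrK.
have := integrableB mA h ipsiw; congr (integrable _ _ _).
by apply/funext => x /=; rewrite -EFinB XhatE.
Qed.

Lemma Rintegral_perturbed w :
  mu.-integrable A (EFin \o (fun x => X x w * phi x)) ->
  \int[mu]_(x in A) (Xhat x w * phi x) = weighted_integral X phi A w +
    - (q^-1 * \int[mu]_(x in A) (psi x * phi x)) * S w.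
Proof.
move=> iX; under eq_Rintegral do rewrite XhatE.
rewrite RintegralB//; last exact: (integrableZl mA (q^-1 * S w) ipsiA).
by rewrite RintegralZl// /weighted_integral; ring.
Qed.

Lemma measurable_perturbed_integral :
  measurable_fun [set: T] (fun w => \int[mu]_(x in A) (Xhat x w * phi x)).
Proof.
under eq_fun do rewrite Rintegral_mkcond.
pose F (p : 'rV[R]_n * T) := (fun p => Xhat p.1 p.2 * phi p.1) \_ (A `*` setT) p.
rewrite (_ : (fun w => _) = fun w => \int[mu]_x F (x, w)); last first.
  apply/funext => w; apply: eq_Rintegral => x _; rewrite /F !patchE.
  by have -> : ((x, w) \in A `*` [set: T]) = (x \in A) by rewrite in_setX in_setT andbT.
apply: measurable_Rintegral2; apply/(measurable_restrictT _ _).1.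
  exact: measurableX.
under eq_fun do rewrite XhatE.
have on1 (f : 'rV[R]_n -> R) : measurable_fun O f ->
    measurable_fun (A `*` [set: T]) (fun p => f p.1).
  move=> mf; have mfA : measurable_fun A f by exact: measurable_funS mf.
  apply: (measurable_comp mA _ mfA); last exact: measurable_funTS measurable_fst.
  by move=> _ [p [Ap _] <-].
apply: measurable_funB; apply: measurable_funM.
- by apply: measurable_funS mX; [exact: measurableX|move=> p [/AO]].
- exact: on1.
- apply: measurable_funM => //.
  by apply: measurable_funTS; exact: measurableT_comp.
- exact: (on1 _ mpsiphi).
Qed.

End one_set.

(** Along an exhaustion for [X * phi], the integrals of [Xhat * phi] differ from
those of [X * phi] by multiples of [S] whose coefficients tend to
[q^-1 * q = 1]. *)
Lemma perturbed_stochastic_integral0 :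
  stochastic_integral P O (fun x w => Xhat x w * phi x) (cst 0).
Proof.
have [A [exA iA cA]] := SI; have [mA _ AO _] := exA; exists A; split => // [k|].
  by apply: filterS (iA k) => w; exact: (integrable_perturbed (mA k) (AO k) w).2.
pose b k := - (q^-1 * \int[mu]_(x in A k) (psi x * phi x)).
have mI k : measurable_fun [set: T] (weighted_integral X phi (A k)).
  exact: (measurable_weighted_integral mO mX mphi (mA k) (AO k)).
have bS k : measurable_fun [set: T] (fun w => b k * S w) by exact: measurable_funM.
have b1 : b k @[k --> \oo] --> (-1 : R).
  rewrite -(mulVf perturbation_q_neq0); apply: cvgN; apply: cvgMr.
  exact: exhaustion_cvg mO exA hq.
have mNS : measurable_fun [set: T] (fun w => -1 * S w) by exact: measurable_funM.
have := cvgpD mI bS mS mNS cA (cvgpZ L2S b1).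
rewrite (_ : (fun w => S w + -1 * S w) = cst 0); last first.
  by apply/funext => w /=; ring.
apply: cvgp_ae => // k.
- exact: measurable_perturbed_integral.
- exact: measurable_funD.
- by apply: filterS (iA k) => w; exact: (Rintegral_perturbed (mA k) (AO k)).
Qed.

(** Adding [S] to a version of the integral of [Xhat * phi] gives another version
of the integral of [X * phi], which almost surely equals [S]. *)
Lemma perturbed_stochastic_integral_ae0 (J : T -> R) :
  measurable_fun [set: T] J ->
  stochastic_integral P O (fun x w => Xhat x w * phi x) J ->
  {ae P, forall w, J w = 0}.
Proof.
move=> mJ [A [exA iA cA]]; have [mA _ AO _] := exA.
have iXA k : {ae P, forall w, mu.-integrable (A k) (EFin \o (fun x => X x w * phi x))}.
  by apply: filterS (iA k) => w; exact: (integrable_perturbed (mA k) (AO k) w).1.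
pose b k := q^-1 * \int[mu]_(x in A k) (psi x * phi x).
have bS k : measurable_fun [set: T] (fun w => b k * S w) by exact: measurable_funM.
have b1 : b k @[k --> \oo] --> (1 : R).
  rewrite -(mulVf perturbation_q_neq0); apply: cvgMr.
  exact: exhaustion_cvg mO exA hq.
have mS1 : measurable_fun [set: T] (fun w => 1 * S w) by exact: measurable_funM.
have mJS : measurable_fun [set: T] (fun w => J w + 1 * S w) by exact: measurable_funD.
suff SI' : stochastic_integral P O (fun x w => X x w * phi x) (fun w => J w + 1 * S w).
  apply: filterS (stochastic_integral_unique mJS mS SI' SI) => w.
  by rewrite mul1r -[X in _ = X]add0r => /addIr.
exists A; split => //.
have mY k := measurable_perturbed_integral (mA k) (AO k).
apply: cvgp_ae (cvgpD mY bS mJ mS1 cA (cvgpZ L2S b1)) => // k.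
- exact: (measurable_weighted_integral mO mX mphi (mA k) (AO k)).
- exact: measurable_funD.
- apply: filterS (iXA k) => w /(Rintegral_perturbed (mA k) (AO k)) ->.
  by rewrite /weighted_integral mulNr subrK.
Qed.

Lemma perturbed_independent : independent_of_process P (closure O `&` D) Xhat S.
Proof.
have gH2 := L2_closure_gauss (L2_closure_gauss gH).
have HS := stochastic_integral_bi_closure mS SI.
move=> A B; apply: (gauss_orthogonal_independent gH2 HS) => x [cx Dx]; last first.
  exact: ip_perturbed.
have -> : Xhat x = fun w => (- (q^-1 * psi x)) * S w + X x w.
  by apply/funext => w; rewrite /Xhat /perturbed_field; ring.
have [lH2 _ _ _] := gH2; apply: lH2 => //; apply: sub_L2_closure.
  by have [_ ? _ _] := L2_closure_gauss gH.
by apply: sub_L2_closure => //; exact: HX.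
Qed.

(** [Xhat x] is orthogonal to [S]. *)
Lemma covariance_perturbed x y : closure O x -> D x -> closure O y ->
  covariance_fun P Xhat x y = \int[P]_w (Xhat x w * X y w).
Proof.
move=> cx Dx cy; rewrite covariance_funE.
have iXS : L1 P (fun w => Xhat x w * S w) by apply: L1M => //; exact: L2_perturbed.
have iXX : L1 P (fun w => Xhat x w * X y w).
  by apply: L1M; [exact: L2_perturbed|exact: L2X].
have -> : (fun w => Xhat x w * Xhat y w) =
    fun w => Xhat x w * X y w - (q^-1 * psi y) * (Xhat x w * S w).
  by apply/funext => w; rewrite {2}/Xhat /perturbed_field; ring.
by rewrite (EB iXX (L1Z _ iXS)) (EZ _ iXS) ip_perturbed// mulr0 subr0.
Qed.

Lemma covariance_perturbed_dom x y : closure O x -> D x -> closure O y -> D y ->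
  covariance_fun P Xhat x y = G x y - q^-1 * psi x * psi y.
Proof.
move=> cx Dx cy Dy; rewrite covariance_perturbed// covariance_funE.
have iSX : L1 P (fun w => S w * X y w) by apply: L1M => //; exact: L2X.
have iXX : L1 P (fun w => X x w * X y w) by apply: L1M; exact: L2X.
have -> : (fun w => Xhat x w * X y w) =
    fun w => X x w * X y w - (q^-1 * psi x) * (S w * X y w).
  by apply/funext => w; rewrite /Xhat /perturbed_field; ring.
by rewrite (EB iXX (L1Z _ iSX)) (EZ _ iSX) (ip_stochastic_integral_field mS SI).
Qed.

(** Only [psi * phi] is known to be measurable, not [psi]; measurability in [y]
therefore comes from the covariance of [Xhat x] with [X y], in which [psi y] does
not occur. *)
Lemma measurable_covariance_perturbed x : closure O x -> D x ->
  measurable_fun O (covariance_fun P Xhat x).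
Proof.
move=> cx Dx; rewrite (measurable_restrictT _ mO).
pose F (p : 'rV[R]_n * T) := (fun p => Xhat x p.2 * X p.1 p.2) \_ (O `*` setT) p.
have -> : covariance_fun P Xhat x \_ O = fun y => \int[P]_w F (y, w).
  apply/funext => y; rewrite patchE; case: ifPn => yO.
    rewrite covariance_perturbed//; last by apply: subset_closure; rewrite -inE.
    by apply: eq_Rintegral => w _; rewrite /F patchE in_setX in_setT yO.
  rewrite -[LHS](E_cst P); apply: eq_Rintegral => w _.
  by rewrite /F patchE in_setX (negbTE yO).
apply: measurable_Rintegral1; apply/(measurable_restrictT _ _).1.
  exact: measurableX.
apply: measurable_funM => //; apply: measurable_funTS.
have [mXx _] := L2_perturbed cx; exact: measurableT_comp.
Qed.

(** The image of [phi] at [x] is [psi x - q^-1 * psi x * q]. *)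
Lemma perturbed_operator0 x : O x -> D x ->
  integral_operator_dom O (covariance_fun P Xhat) phi x /\
  integral_operator O (covariance_fun P Xhat) phi x = 0.
Proof.
move=> Ox Dx; have cx := subset_closure Ox.
pose g y := G x y * phi y - (q^-1 * psi x) * (psi y * phi y).
have ipsi : mu.-integrable O (EFin \o (fun y => (q^-1 * psi x) * (psi y * phi y))).
  exact: (integrableZl mO (q^-1 * psi x) hq).
have ig : mu.-integrable O (EFin \o g).
  have := integrableB mO Dx ipsi; congr (integrable _ _ _).
have mK : measurable_fun O (fun y => (covariance_fun P Xhat x y * phi y)%:E).
  by apply/measurable_EFinP; apply: measurable_funM => //;
    exact: measurable_covariance_perturbed.
have e : ae_eq mu O (fun y => (covariance_fun P Xhat x y * phi y)%:E) (EFin \o g).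
  apply: filterS hpsi => y Dy Oy; congr EFin.
  rewrite covariance_perturbed_dom//; [|exact: subset_closure|exact: Dy].
  by rewrite /g; ring.
split.
  apply/integrableP; split => //; have /integrableP[_] := ig.
  congr (_ < _)%E; apply: ae_eq_integral => //.
  - by apply: measurableT_comp => //; exact: measurable_int ig.
  - exact: measurableT_comp.
  - by apply: filterS e => y ey Oy; rewrite ey.
transitivity (\int[mu]_(y in O) g y).
  by congr fine; apply: ae_eq_integral => //; exact: measurable_int ig.
rewrite RintegralB// RintegralZl//.
by rewrite -/(psi x) -/q mulrAC mulVf ?mul1r ?subrr// perturbation_q_neq0.
Qed.

End perturbed.
End perturbation.

(** * Orthogonality, independence and the zero eigenvalue *)

Unset Implicit Arguments.
Set Strict Implicit.
Set Printing Implicit Defensive.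

Theorem corollary2 (R : realType) (n : nat)
    (d : measure_display) (Omega : measurableType d) (P : probability Omega R)
    (O : set 'rV[R]_n) (hO : bounded_domain O)
    (X : 'rV[R]_n -> Omega -> R)
    (hXgauss : gaussian_field P (closure O) X)
    (hXmean : forall x, closure O x -> ('E_P[X x] = 0)%E)
    (hXmeas : measurable_fun (O `*` [set: Omega])
       (fun p : 'rV[R]_n * Omega => X p.1 p.2))
    (phi : 'rV[R]_n -> R) (hphi : locally_summable O phi) :
  let mu := lebesgue_rV R n in
  let G := covariance_fun P X in
  let psi := integral_operator O G phi in
  let D := integral_operator_dom O G phi in
  forall (hpsi : {ae mu, forall x, O x -> D x})
    (hpsi0 : exists x, [/\ O x, D x & psi x != 0])
    (hq : mu.-integrable O (fun x => (psi x * phi x)%:E))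
    (S : {RV P >-> R})
    (hS : stochastic_integral P O (fun x w => X x w * phi x) S),
  let q := \int[mu]_(x in O) (psi x * phi x) in
  let Xhat := perturbed_field X psi S q^-1 in
  [/\ stochastic_integral P O (fun x w => Xhat x w * phi x) (cst 0) /\
      (forall I : {RV P >-> R},
        stochastic_integral P O (fun x w => Xhat x w * phi x) I ->
        {ae P, forall w, I w = 0}),
      independent_of_process P (closure O `&` D) Xhat S &
      square_summable O phi ->
        eigenfunction O (covariance_fun P Xhat) 0 phi].
Proof.
move=> mu G psi D hpsi hpsi0 hq S hS q Xhat.
have mO : measurable O by apply: open_measurable_rV; case: hO.
have mphi : measurable_fun O phi by case: hphi.
have mS : measurable_fun [set: Omega] S by [].
pose H := field_span (closure O) X.
have gH : gauss_space P H by exact: field_span_gauss hXgauss hXmean.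
have H0 : H (cst 0) by exact: field_span0.
have HX x : closure O x -> H (X x) by exact: mem_field_span.
split.
- split; first exact: (perturbed_stochastic_integral0 mO gH H0 HX hXmeas mphi hpsi hq mS hS hpsi0).
  move=> J; apply: (perturbed_stochastic_integral_ae0 mO gH H0 HX hXmeas mphi hpsi hq mS hS hpsi0).
  by [].
- exact: (perturbed_independent mO gH H0 HX hXmeas mphi hpsi hq mS hS hpsi0).
- move=> L2phi; split => //; last first.
    have op0 := (perturbed_operator0 mO gH H0 HX hXmeas mphi hpsi hq mS hS hpsi0).
    by apply: filterS hpsi => x Dx Ox; rewrite mul0r; exact: op0 Ox (Dx Ox).
  have [x [Ox Dx /eqP psi_neq0]] := hpsi0 => phi0; apply: psi_neq0.
  rewrite /psi /integral_operator /Rintegral (ae_eq_integral (cst 0%E)) ?integral0//.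
    exact: measurable_int Dx.
  by apply: filterS phi0 => y phi_y Oy; rewrite phi_y// mulr0.
Qed.
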